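(* Let $G:\mathbb{R}^d\to[0,\infty)$, let $\bm\mu_0,\bm\mu\in\mathbb{R}^d$, let $\bm\Sigma_0,\bm\Sigma$ be $d\times d$ (symmetric positive definite) covariance matrices, and let $\bm L$ be a $d\times d$ matrix with $\bm L\bm L^T=\bm\Sigma$. If all the eigenvalues of the matrix $\bm L^T\bm\Sigma_0^{-1}\bm L$ are not smaller than $1$ and $\tilde G(\bm z)=G(\bm\mu+\bm L\bm z)$ satisfies the ''QMC-friendly'' boundary growth condition, then for arbitrarily small $\epsilon>0$, $$\sqrt{\mathbb{E}\left[(\hat I_N(G_{\mathrm{IS}})-I(G_{\mathrm{IS}}))^2\right]}=O(N^{-1+\epsilon}),$$ where $G_{\mathrm{IS}}(\bm z)=G(\bm\mu+\bm L\bm z)W(\bm z)$ and $$W(\bm z)=\frac{\det(\bm\Sigma)^{1/2}}{\det(\bm\Sigma_0)^{1/2}}\exp\left\{\frac12\bm z^T\bm z-\frac12(\bm\mu-\bm\mu_0+\bm L\bm z)^T\bm\Sigma_0^{-1}(\bm\mu-\bm\mu_0+\bm L\bm z)\right\}.$$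
   Context: For $v\subseteq\{1,\dots,d\}$, $D_vG$ denotes the mixed partial derivative of a function $G$ taken once with respect to each $z_j$, $j\in v$, with $D_\emptyset G=G$; integrands are assumed smooth enough that these derivatives exist and are continuous. $\Phi$ is the standard normal CDF and $\Phi^{-1}$ its inverse (applied componentwise to vectors). QMC-friendly boundary growth condition for $G:\mathbb{R}^d\to\mathbb{R}$: for arbitrarily small $B_1,\dots,B_d>0$ there exists a constant $B>0$ (depending on the $B_i$) such that for every $v\subseteq\{1,\dots,d\}$ and all $\bm z\in\mathbb{R}^d$, $$|(D_vG)(\bm z)|\le B\prod_{i=1}^d[1-\Phi(|z_i|)]^{-B_i}.$$ For $H:\mathbb{R}^d\to\mathbb{R}$: $I(H)=\int_{\mathbb{R}^d}H(\bm z)p(\bm z;\bm 0,\bm I_d)\,d\bm z$, where $p(\cdot;\bm\mu,\bm\Sigma)$ is the density of the $d$-dimensional normal distribution $N(\bm\mu,\bm\Sigma)$, and $\hat I_N(H)=\frac1N\sum_{i=1}^NH(\Phi^{-1}(\bm u_i))$, where $\bm u_1,\dots,\bm u_N$ are a scrambled $(t,m,d)$-net in base $b\ge2$ with $N=b^m$. (Then $I(G_{\mathrm{IS}})=\int_{\mathbb{R}^d}G(\bm z)p(\bm z;\bm\mu_0,\bm\Sigma_0)\,d\bm z$.) Nets: an elementary interval in base $b$ is a set $\prod_{j=1}^d[a_jb^{-k_j},(a_j+1)b^{-k_j})$ with integers $k_j\ge0$, $0\le a_j<b^{k_j}$. A collection of $b^m$ points of $[0,1)^d$ is a $(t,m,d)$-net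 in base $b$ (integers $0\le t\le m$) if every elementary interval in base $b$ of volume $b^{t-m}$ contains exactly $b^t$ of the points. Scrambled net (Owen's nested uniform scrambling): given a (deterministic) $(t,m,d)$-net $\bm a_1,\dots,\bm a_N$ with base-$b$ digits $a_i^j=\sum_{k\ge1}a_{ijk}b^{-k}$ of the $j$-th coordinate of $\bm a_i$, the scrambled points $\bm u_i$ have coordinates $u_i^j=\sum_{k\ge1}u_{ijk}b^{-k}$ with $u_{ij1}=\pi_j(a_{ij1})$ and $u_{ijk}=\pi_{j;a_{ij1},\dots,a_{ij,k-1}}(a_{ijk})$ for $k\ge2$, where all the permutations $\pi_\cdot$ are mutually independent and uniformly distributed over the permutations of $\{0,\dots,b-1\}$. The $O(\cdot)$ statement is as $N=b^m\to\infty$ with $t,b,d$ fixed; its implied constant may depend on $\epsilon$. *)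

(* Defs.v *)
From HB Require Import structures.
From mathcomp Require Import all_boot all_order all_algebra all_fingroup.
From mathcomp Require Import all_classical all_reals all_analysis.

Set Implicit Arguments.
Unset Strict Implicit.
Unset Printing Implicit Defensive.

Import Order.TTheory GRing.Theory Num.Theory.
Import numFieldNormedType.Exports.

Local Open Scope classical_set_scope.
Local Open Scope ring_scope.

(* The library's own instance on m1 \x m2 is shadowed by the one for
   subprobabilities. *)
Lemma product_sigma_finite d1 d2 (T1 : measurableType d1)
    (T2 : measurableType d2) (R : realType)
    (m1 : {sigma_finite_measure set T1 -> \bar R})
    (m2 : {sigma_finite_measure set T2 -> \bar R}) :
  sigma_finite setT (m1 \x m2)%E.
Proof.
have /sigma_finiteP[F [TF ndF Foo]] := sigma_finiteT m1.
have /sigma_finiteP[G [TG ndG Goo]] := sigma_finiteT m2.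
exists (fun n => F n `*` G n).
  rewrite -setXTT TF TG predeqE => -[x y]; split.
    move=> [/= [n _ Fnx] [k _ Gky]]; exists (maxn n k) => //; split.
    - by move: x Fnx; exact/subsetPset/ndF/leq_maxl.
    - by move: y Gky; exact/subsetPset/ndG/leq_maxr.
  by move=> [n _ []/= ? ?]; split; exists n.
move=> k; have [? ?] := Foo k; have [? ?] := Goo k.
split; first exact: measurableX.
by rewrite product_measure1E// lte_mul_pinfty// ge0_fin_numE.
Qed.

Lemma pushforward_sigma_finite d1 d2 (T1 : measurableType d1)
    (T2 : measurableType d2) (R : realType)
    (mu : {measure set T1 -> \bar R}) (f : T1 -> T2) (g : T2 -> T1) :
  sigma_finite setT mu ->
  measurable_fun setT f -> measurable_fun setT g -> cancel f g ->
  exists nu : {sigma_finite_measure set T2 -> \bar R}, pushforward mu f = nu.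
Proof.
move=> [F FT mF] mf mg fK.
pose m : {measure set T2 -> \bar R} :=
  measure_function_pushforward__canonical__measure_function_Measure mu mf.
have sm : sigma_finite setT m.
  exists (fun i => g @^-1` F i).
    by rewrite -preimage_bigcup -FT preimage_setT.
  move=> i; have [mFi Fi] := mF i; split.
    by rewrite -[X in measurable X]setTI; exact: mg.
  rewrite /m /= /pushforward -comp_preimage.
  by rewrite (_ : g \o f = id) ?preimage_id//; apply/funext => x /=; rewrite fK.
pose H := Measure_isSigmaFinite.Build _ _ _ m sm.
by exists (HB.pack_for (SigmaFiniteMeasure.type T2 R) (Measure.sort m) H).
Qed.

Section lebesgue_tuple.
Variable R : realType.

Definition consT (n : nat) (p : R * n.-tuple R) : n.+1.-tuple R :=
  [tuple of p.1 :: p.2].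

(* R^n is n.-tuple R with its product sigma-algebra; unlike matrices, tuples
   carry a measurable structure in the library. *)
Fixpoint lebesgue_tuple (n : nat) : set (n.-tuple R) -> \bar R :=
  match n with
  | 0 => \d_ [tuple]
  | n'.+1 => pushforward (lebesgue_measure \x lebesgue_tuple (n := n'))%E
                         (@consT n')
  end.

Lemma measurable_consT n : measurable_fun [set: R * n.-tuple R] (@consT n).
Proof. exact: measurable_cons. Qed.

Let unconsT n (t : n.+1.-tuple R) : R * n.-tuple R :=
  (thead t, [tuple of behead t]).

Let measurable_unconsT n : measurable_fun [set: n.+1.-tuple R] (@unconsT n).
Proof.
apply/measurable_fun_pairP; split; last exact: measurable_behead.
exact: measurable_tnth.
Qed.

Let consTK n : cancel (@consT n) (@unconsT n).
Proof.
move=> [x t]; rewrite /unconsT /consT /= theadE; congr (_, _).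
exact/val_inj.
Qed.

Let lebesgue_tupleP n :
  exists nu : {sigma_finite_measure set (n.-tuple R) -> \bar R},
    @lebesgue_tuple n = nu.
Proof.
elim: n => [|n [nu nuE]] /=; first by exists (\d_ [tuple]).
rewrite nuE.
pose lm : {measure set (measurableTypeR R * n.-tuple R)%type -> \bar R} :=
  (lebesgue_measure \x nu)%E.
apply: (@pushforward_sigma_finite _ _ _ _ _ lm _ (@unconsT n)) (@consTK n).
- exact: product_sigma_finite.
- exact: measurable_consT.
- exact: measurable_unconsT.
Qed.

Let lebesgue_tuple_measure n : {sigma_finite_measure set (n.-tuple R) -> \bar R} :=
  sval (cid (lebesgue_tupleP n)).

Let lebesgue_tupleE n : @lebesgue_tuple n = lebesgue_tuple_measure n.
Proof. by rewrite /lebesgue_tuple_measure; case: cid. Qed.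

Let lebesgue_tuple0 n : @lebesgue_tuple n set0 = 0%E.
Proof. by rewrite lebesgue_tupleE measure0. Qed.

Let lebesgue_tuple_ge0 n A : (0 <= @lebesgue_tuple n A)%E.
Proof. by rewrite lebesgue_tupleE. Qed.

Let lebesgue_tuple_sigma_additive n : semi_sigma_additive (@lebesgue_tuple n).
Proof. rewrite lebesgue_tupleE; exact: measure_semi_sigma_additive. Qed.

HB.instance Definition _ n := isMeasure.Build _ _ _ (@lebesgue_tuple n)
  (@lebesgue_tuple0 n) (@lebesgue_tuple_ge0 n) (@lebesgue_tuple_sigma_additive n).

Let lebesgue_tuple_sigma_finite n : sigma_finite setT (@lebesgue_tuple n).
Proof. rewrite lebesgue_tupleE; exact: sigma_finiteT. Qed.

HB.instance Definition _ n := Measure_isSigmaFinite.Build _ _ _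
  (@lebesgue_tuple n) (@lebesgue_tuple_sigma_finite n).

End lebesgue_tuple.

Section linear_algebra.
Variable R : realType.

Definition posdefmx (d : nat) (Sigma : 'M[R]_d) : Prop :=
  Sigma^T = Sigma /\ forall x : 'cV[R]_d, x != 0 -> 0 < (x^T *m Sigma *m x) ord0 ord0.

Definition normal_density (d : nat) (m : 'cV[R]_d) (Sigma : 'M[R]_d)
    (z : 'cV[R]_d) : R :=
  (Num.sqrt ((2 * pi) ^+ d * \det Sigma))^-1 *
  expR (- (1 / 2) * ((z - m)^T *m invmx Sigma *m (z - m)) ord0 ord0).

Definition gauss_integral (d : nat) (H : 'cV[R]_d -> R) : R :=
  (\int[@lebesgue_tuple R d]_t
     (H (\col_j tnth t j) * normal_density 0 1%:M (\col_j tnth t j)))%R.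

Definition importance_weight (d : nat) (mu0 mu : 'cV[R]_d) (Sigma0 Sigma L : 'M[R]_d)
    (z : 'cV[R]_d) : R :=
  Num.sqrt (\det Sigma) / Num.sqrt (\det Sigma0) *
  expR (1 / 2 * (z^T *m z) ord0 ord0
        - 1 / 2 * ((mu - mu0 + L *m z)^T *m invmx Sigma0 *m (mu - mu0 + L *m z))
                    ord0 ord0).

End linear_algebra.

Section growth.
Variable R : realType.

Definition Phi (x : R) : R := fine (normal_prob 0 1 `]-oo, x]).

(* For u outside ]0, 1[ no preimage exists and the value is the default 0; a
   coordinate of a scrambled point is almost surely in ]0, 1[. *)
Definition Phi_inv (u : R) : R := xget 0 [set x | Phi x = u].

(* iterated partial derivative D_{j_1} ( ... (D_{j_k} G)) for s = [:: j_1; ...; j_k] *)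
Definition partials (d : nat) (s : seq 'I_d) (G : 'cV[R]_d -> R) :
    'cV[R]_d -> R :=
  foldr (fun j F z => 'D_(delta_mx j ord0) F z) G s.

(* All mixed partial derivatives of order at most one in each variable exist
   and are continuous, in every order of differentiation; hence the order does
   not matter and mixed_partial below may use the increasing one. *)
Definition mixed_smooth (d : nat) (G : 'cV[R]_d -> R) : Prop :=
  forall s : seq 'I_d, uniq s ->
    continuous (partials s G) /\
    forall j z, j \notin s -> derivable (partials s G) z (delta_mx j ord0).

Definition mixed_partial (d : nat) (v : {set 'I_d}) (G : 'cV[R]_d -> R) :
    'cV[R]_d -> R :=
  partials (enum v) G.

Definition qmc_friendly (d : nat) (G : 'cV[R]_d -> R) : Prop :=
  forall Bs : 'I_d -> R, (forall i, 0 < Bs i) ->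
  exists2 B : R, 0 < B &
    forall (v : {set 'I_d}) (z : 'cV[R]_d),
      `|mixed_partial v G z| <=
        B * \prod_(i < d) (1 - Phi `|z i ord0|) `^ (- Bs i).

End growth.

Section nets.
Variable R : realType.

(* The points are indexed by 'I_(b ^ m), so repeated ones count with
   multiplicity. *)
Definition is_net (t m d b : nat) (a : 'I_(b ^ m) -> 'cV[R]_d) : Prop :=
  [/\ (t <= m)%N,
      forall i j, 0 <= a i j ord0 < 1 &
      forall k c : 'I_d -> nat, (forall j, (c j < b ^ k j)%N) ->
        \prod_(j < d) (b%:R ^- k j : R) = b%:R ^ (t%:Z - m%:Z) ->
        #|[pred i | [forall j, (c j)%:R * b%:R ^- k j <= a i j ord0
                              < (c j).+1%:R * b%:R ^- k j]]| = (b ^ t)%N].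

(* k counts from 0: digit x k is the coefficient of b^-(k+1) in the expansion
   of x in [0,1) *)
Definition digit (b : nat) (b_gt1 : (1 < b)%N) (x : R) (k : nat) : 'I_b :=
  Ordinal (ltn_pmod (Num.truncn (x * b%:R ^+ k.+1)) (ltnW b_gt1)).

(* perms j s is the permutation attached to coordinate j and digit prefix s *)
Definition scrambled_digit (b : nat) (b_gt1 : (1 < b)%N) (d : nat)
    (perms : 'I_d -> seq 'I_b -> {perm 'I_b}) (j : 'I_d) (x : R) (k : nat) :
    'I_b :=
  perms j [seq digit b_gt1 x l | l <- iota 0 k] (digit b_gt1 x k).

Definition scramble (b : nat) (b_gt1 : (1 < b)%N) (d : nat)
    (perms : 'I_d -> seq 'I_b -> {perm 'I_b}) (a : 'cV[R]_d) : 'cV[R]_d :=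
  \col_j limn (series (fun k =>
    (scrambled_digit b_gt1 perms j (a j ord0) k)%:R * b%:R ^- k.+1 : R)).

Definition mutually_independent disp (Omega : measurableType disp)
    (P : probability Omega R) (I : eqType) (T : finType) (X : I -> Omega -> T) :
    Prop :=
  forall s : seq I, uniq s -> forall A : I -> set T,
    P (\bigcap_(i in [set` s]) X i @^-1` A i) =
    (\prod_(i <- s) P (X i @^-1` A i))%E.

Definition owen_permutations disp (Omega : measurableType disp)
    (P : probability Omega R) (b d : nat)
    (perms : 'I_d -> seq 'I_b -> Omega -> {perm 'I_b}) : Prop :=
  [/\ forall j s sigma, measurable (perms j s @^-1` [set sigma]),
      forall j s sigma,
        P (perms j s @^-1` [set sigma]) = ((b`!)%:R^-1)%:E &
      mutually_independent P
        (fun js : 'I_d * seq 'I_b => perms js.1 js.2)].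

Definition qmc_estimate (d N : nat) (H : 'cV[R]_d -> R)
    (u : 'I_N -> 'cV[R]_d) : R :=
  N%:R^-1 * \sum_(i < N) H (map_mx (@Phi_inv R) (u i)).

End nets.

(* Main.v *)
(** Since [L^T Sigma0^-1 L >= 1], the quadratic part of the exponent of the weight is
nonpositive, so that the weight grows at most exponentially in [z], and the
integrand [H] together with its mixed derivatives is bounded by
[C * \prod_j expR (beta * z_j ^+ 2)] for every [beta > 0].

Replace [H \o Phi_inv] by its values on the grid of mesh [b^-K] and expand these
in multivariate Haar components, indexed by levels [kap : 'I_d -> nat]. The
derivative bounds show that the component of level [kap] has mean square at most
of order [b^(-(1 - e) |kap|)]: a one-dimensional difference of [H] is dominated
by a difference of the monotone function [z * expR (beta * z ^+ 2)], whose
oscillations over the cells of a grid telescope. A scrambled net integrates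
the component exactly when [|kap| <= m - t], because it meets every elementary
interval of level [kap] equally often. When [|kap| > m - t], two points contribute
to the second moment only if they agree on the first [kap_j - 1] digits in every
coordinate [j], since otherwise one point uses a permutation that the other does
not; as at most [b^(d + t)] points agree with a given one, the mean square error
of the component is at most [b^(d + t) / b^m] times its mean square. Summing
over [|kap| > m - t] gives [O(N^(-2 + 2 e))] uniformly in [K], and Fatou's lemma
gives the limit [K -> oo]. *)

Require Import Defs.
From HB Require Import structures.
From mathcomp Require Import all_boot all_order all_algebra all_fingroup.
From mathcomp Require Import all_classical all_reals all_analysis.
From mathcomp Require Import measurable_realfun.
From mathcomp Require Import ring lra zify.

Set Implicit Arguments.
Unset Strict Implicit.
Unset Printing Implicit Defensive.

Import Order.TTheory GRing.Theory Num.Theory.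
Import numFieldNormedType.Exports.

Local Open Scope classical_set_scope.
Local Open Scope ring_scope.

(** * The standard normal distribution function *)

(** The integrand is unbounded near the faces of the cube and the derivative of [Phi_inv] blows up
    there, so nothing is differentiated in the uniform variable: derivatives stay in [z], and only
    values of the majorant [Psi] are compared across cells. On the two outermost cells of an axis
    the increments of [Psi] are not controlled, and its square is summed instead, like an integrable
    power: [Psi^2] is at most a constant times [exp (3 beta z^2)], and the Gaussian tails turn
    [exp (gamma z^2)] into [u^(-4 gamma)]. Hence [beta = e / 12] for a decay [b^(-(1 - e))] per
    level.

    On a finite grid a scrambling is a finite family of uniform permutations, so expectations are
    finite averages and orthogonality is a change of variables in a sum. Components of different
    levels are not shown to be orthogonal; a weighted Cauchy-Schwarz inequality over the levels
    replaces this. It uses up [b^(-e |kap|)] of the decay; what remains, [b^(-(1 - 2 e) |kap|)], and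
    the factor [b^(-m)] from the count of close points give [N^(-2 + 2 e)]. *)

Section standard_normal.
Variable R : realType.
Implicit Types x y z u s : R.

Local Notation gam := (@normal_prob R 0 1).
Local Notation peak := (@normal_peak R 1).

Let peak_gt0 : 0 < peak. Proof. exact: normal_peak_gt0. Qed.

Lemma std_normal_pdfE x : normal_pdf 0 1 x = peak * expR (- (x ^+ 2 / 2)).
Proof.
by rewrite normal_pdfE// /normal_fun subr0 expr1n mulNr.
Qed.

Lemma PhiE x : gam `]-oo, x] = (Phi x)%:E.
Proof. by rewrite /Phi fineK// fin_num_measure. Qed.

Lemma Phi_itv x y : x <= y -> gam `]x, y] = (Phi y - Phi x)%:E.
Proof.
move=> xy.
have -> : `]x, y]%classic = `]-oo, y] `\` `]-oo, x].
  by apply/seteqP; split => z /=; rewrite !in_itv/=;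
    [move=> /andP[xz ->]; split => //; rewrite leNgt xz
    |move=> [-> /negP]; rewrite -ltNge => ->].
rewrite measureD//= ?PhiE ?ltry//.
have -> : `]-oo, y] `&` `]-oo, x] = `]-oo, x]%classic.
  apply/seteqP; split => z /=; rewrite !in_itv/=; first by case.
  by move=> zx; split => //; exact: le_trans xy.
by rewrite PhiE.
Qed.

Lemma Phi_lower (M : R) x y : x <= y -> `|x| <= M -> `|y| <= M ->
  (y - x) * (peak * expR (- (M ^+ 2 / 2))) <= Phi y - Phi x.
Proof.
move=> xy xM yM; rewrite -lee_fin -Phi_itv//.
have -> : ((y - x) * (peak * expR (- (M ^+ 2 / 2))))%:E =
   (\int[lebesgue_measure]_(z in `]x, y]) (cst (peak * expR (- (M ^+ 2 / 2)))%:E z))%E.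
  rewrite integral_cst//= lebesgue_measure_itv/= lte_fin.
  case: ltP => [_|yx]; first by rewrite -EFinB -EFinM mulrC.
  by rewrite mule0 (@le_anti _ _ x y) ?xy// subrr mul0r.
apply: ge0_le_integral => //=.
- by move=> z _; rewrite lee_fin mulr_ge0 ?expR_ge0// ltW.
- by apply/measurable_EFinP/measurable_funTS; exact: measurable_normal_pdf.
- move=> z; rewrite in_itv/= => /andP[xz zy].
  rewrite lee_fin std_normal_pdfE ler_pM2l// ler_expR lerN2 ler_pM2r ?invr_gt0//.
  have zM : `|z| <= M.
    rewrite ler_norml; move: xM yM; rewrite !ler_norml => /andP[? ?] /andP[? ?].
    by apply/andP; split; lra.
  by rewrite -(real_normK (num_real z)) ler_sqr ?nnegrE// (le_trans _ zM).
Qed.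

Lemma Phi_upper x y : x <= y -> Phi y - Phi x <= (y - x) * peak.
Proof.
move=> xy; rewrite -lee_fin -Phi_itv//.
have -> : ((y - x) * peak)%:E =
   (\int[lebesgue_measure]_(z in `]x, y]) (cst peak%:E z))%E.
  rewrite integral_cst//= lebesgue_measure_itv/= lte_fin.
  case: ltP => [_|yx]; first by rewrite -EFinB -EFinM mulrC.
  by rewrite mule0 (@le_anti _ _ x y) ?xy// subrr mul0r.
apply: ge0_le_integral => //=.
- by move=> z _; rewrite lee_fin normal_pdf_ge0.
- by apply/measurable_EFinP/measurable_funTS; exact: measurable_normal_pdf.
- by move=> z _; rewrite lee_fin normal_pdf_ub.
Qed.

Lemma Phi_ge0 x : 0 <= Phi x.
Proof. by rewrite -lee_fin -PhiE. Qed.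

Lemma Phi_le1 x : Phi x <= 1.
Proof. by rewrite -lee_fin -PhiE probability_le1. Qed.

(** Each tail at [x] contains a unit interval ending at [x], on which the density is at least its
    value at [|x| + 1]. As [(|x| + 1)^2 / 2 <= x^2 + 1], this value is at least
    [tail_const * exp (- x^2)]. *)
Definition tail_const : R := peak * expR (- 1).

Lemma tail_const_gt0 : 0 < tail_const.
Proof. by rewrite mulr_gt0// expR_gt0. Qed.

Let tail_aux x : tail_const * expR (- x ^+ 2) <=
  peak * expR (- ((`|x| + 1) ^+ 2 / 2)).
Proof.
rewrite /tail_const -mulrA ler_pM2l// -expRD ler_expR.
have := sqr_ge0 (`|x| - 1); have := real_normK (num_real x).
rewrite !expr2; lra.
Qed.

Lemma Phi_ge_exp x : tail_const * expR (- x ^+ 2) <= Phi x.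
Proof.
apply: (le_trans (tail_aux x)); have := @Phi_lower (`|x| + 1) (x - 1) x.
have -> : x - (x - 1) = 1 by lra.
rewrite mul1r => /(_ _ _ _)/le_trans; apply.
- lra.
- by rewrite (le_trans (ler_normB _ _))// normr1.
- by rewrite lerDl.
- by rewrite lerBlDr lerDl Phi_ge0.
Qed.

Lemma onem_Phi_ge_exp x : tail_const * expR (- x ^+ 2) <= 1 - Phi x.
Proof.
apply: (le_trans (tail_aux x)); have := @Phi_lower (`|x| + 1) x (x + 1).
have -> : (x + 1) - x = 1 by lra.
rewrite mul1r => /(_ _ _ _)/le_trans; apply.
- lra.
- by rewrite lerDl.
- by rewrite (le_trans (ler_normD _ _))// normr1.
- by rewrite lerD2r Phi_le1.
Qed.

Lemma Phi_gt0 x : 0 < Phi x.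
Proof.
by apply: lt_le_trans (Phi_ge_exp x); rewrite mulr_gt0 ?expR_gt0// tail_const_gt0.
Qed.

Lemma Phi_lt1 x : Phi x < 1.
Proof.
rewrite -subr_gt0; apply: lt_le_trans (onem_Phi_ge_exp x).
by rewrite mulr_gt0 ?expR_gt0// tail_const_gt0.
Qed.

Lemma Phi_lt x y : x < y -> Phi x < Phi y.
Proof.
move=> xy; rewrite -subr_gt0.
apply: lt_le_trans (@Phi_lower (Num.max `|x| `|y|) x y _ _ _).
- by rewrite !mulr_gt0 ?expR_gt0// subr_gt0.
- exact: ltW.
- by rewrite le_max lexx.
- by rewrite le_max lexx orbT.
Qed.

Lemma ltr_Phi x y : (Phi x < Phi y) = (x < y).
Proof. by apply: leW_mono; apply: le_mono => ? ?; exact: Phi_lt. Qed.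

Lemma ler_Phi x y : (Phi x <= Phi y) = (x <= y).
Proof. by apply: le_mono => ? ?; exact: Phi_lt. Qed.

Lemma Phi_inj : injective (@Phi R).
Proof. by move=> x y e; apply/eqP; rewrite eq_le -(ler_Phi x) -(ler_Phi y x) e lexx. Qed.

Lemma Phi_lipschitz x y : `|Phi y - Phi x| <= `|y - x| * peak.
Proof.
wlog xy : x y / x <= y.
  move=> H; have [xy|/ltW xy] := leP x y; first exact: H.
  by rewrite distrC (distrC y); exact: H.
rewrite !ger0_norm ?subr_ge0 ?ler_Phi//; exact: Phi_upper.
Qed.

Lemma continuous_Phi : continuous (@Phi R).
Proof.
move=> x; apply/cvgrPdist_le => e e0; near=> y.
rewrite (le_trans (Phi_lipschitz _ _))// -ler_pdivlMr//.
near: y; apply: cvgr_dist_le; first exact: cvg_id.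
by rewrite divr_gt0.
Unshelve. all: by end_near. Qed.

(** The exponent [- x^2 / 2] becomes [- x^2 / 4], that of variance 2. The resulting moment [sqrt 2]
    gives the upper tail bounds and, later, an integrable majorant. *)
Let expR4E x : expR (x ^+ 2 / 4) * normal_pdf 0 1 x =
  Num.sqrt 2 * normal_pdf 0 (Num.sqrt 2) x.
Proof.
have s2 : Num.sqrt 2 != 0 :> R by rewrite gt_eqF// sqrtr_gt0.
rewrite std_normal_pdfE (normal_pdfE _ s2) /normal_fun /normal_peak.
rewrite subr0 sqr_sqrtr// expr1n mul1r mulrCA -expRD mulrA; congr (_ * expR _).
  rewrite -[in RHS]mulrnAr sqrtrM// invfM mulrA divff// mul1r.
  by rewrite mulr2n.
by rewrite -mulr_natr; field.
Qed.

Lemma integral_expR4 :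
  (\int[lebesgue_measure]_x (expR (x ^+ 2 / 4) * normal_pdf 0 1 x)%:E =
   (Num.sqrt 2 : R)%:E)%E.
Proof.
under eq_integral do rewrite expR4E EFinM.
rewrite ge0_integralZl//= ?lee_fin//.
- by rewrite integral_normal_pdf mule1.
- by apply/measurable_EFinP; exact: measurable_normal_pdf.
- by move=> x _; rewrite lee_fin normal_pdf_ge0.
Qed.

(** Markov's inequality with [expR (x ^+ 2 / 4)], whose mean is [sqrt 2 <= 2]. *)
Lemma normal_prob_tail (A : set R) z : measurable A ->
  (forall x, A x -> z ^+ 2 <= x ^+ 2) ->
  (gam A <= (2 * expR (- (z ^+ 2 / 4)))%:E)%E.
Proof.
move=> mA Az.
have mf : measurable_fun [set: R]
    (fun x : R => (expR (x ^+ 2 / 4) * normal_pdf 0 1 x)%:E).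
  apply/measurable_EFinP; apply: measurable_funM; last exact: measurable_normal_pdf.
  by apply: measurableT_comp => //; exact: measurable_funM.
have f0 x : (0 <= (expR (x ^+ 2 / 4) * normal_pdf 0 1 x)%:E)%E.
  by rewrite lee_fin mulr_ge0 ?expR_ge0 ?normal_pdf_ge0.
apply: (@le_trans _ _ (\int[lebesgue_measure]_(x in A)
   ((expR (- (z ^+ 2 / 4)))%:E * (expR (x ^+ 2 / 4) * normal_pdf 0 1 x)%:E)))%E.
  apply: ge0_le_integral => //=.
  - by move=> x _; rewrite lee_fin normal_pdf_ge0.
  - by apply/measurable_EFinP/measurable_funTS; exact: measurable_normal_pdf.
  - by apply: measurable_funTS; apply: emeasurable_funM.
  - move=> x Ax; rewrite -EFinM lee_fin mulrA -expRD ler_peMl ?normal_pdf_ge0//.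
    by rewrite -expR0 ler_expR addrC subr_ge0 ler_pM2r// Az.
rewrite ge0_integralZl//=; last first.
  exact: measurable_funTS.
rewrite muleC EFinM; apply: lee_pmul => //.
- by apply: integral_ge0 => *; exact: f0.
- apply: (@le_trans _ _ (\int[lebesgue_measure]_x
     ((expR (x ^+ 2 / 4) * normal_pdf 0 1 x)%:E)))%E.
    exact: ge0_subset_integral.
  rewrite integral_expR4 lee_fin -ler_sqr ?nnegrE ?sqrtr_ge0// sqr_sqrtr//.
  by rewrite -natrX ler_nat.
Qed.

Lemma Phi_le_exp z : z <= 0 -> Phi z <= 2 * expR (- (z ^+ 2 / 4)).
Proof.
move=> z0; rewrite -lee_fin -PhiE; apply: normal_prob_tail => // x /=.
rewrite in_itv/= => xz; rewrite -[leLHS]sqrrN -[leRHS]sqrrN ler_sqr ?nnegrE; lra.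
Qed.

Lemma onem_Phi_le_exp z : 0 <= z -> 1 - Phi z <= 2 * expR (- (z ^+ 2 / 4)).
Proof.
move=> z0; rewrite -lee_fin EFinB -PhiE -probability_setC//.
apply: normal_prob_tail => [|x /=]; first exact: measurableC.
by rewrite in_itv/= => /negP; rewrite -ltNge => xz; rewrite ler_sqr ?nnegrE; lra.
Qed.

Lemma Phi_surj u : 0 < u < 1 -> exists x, Phi x = u.
Proof.
move=> /andP[u0 u1].
have key (e : R) : 0 < e -> exists2 z, 0 <= z & 2 * expR (- (z ^+ 2 / 4)) < e.
  move=> e0; exists (8 / e + 4); first by rewrite addr_ge0 ?divr_ge0// ltW.
  have e8 : 0 < 8 / e by rewrite divr_gt0.
  rewrite expRN ltr_pdivrMr ?expR_gt0//.
  have h : 2 < e * (1 + 2 / e).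
    by rewrite mulrDr mulr1 mulrCA divff ?gt_eqF// mulr1 ltrDr.
  apply: (lt_le_trans h); rewrite ler_pM2l//; apply: le_trans (expR_ge1Dx _).
  rewrite lerD2l expr2; have -> : 8 / e = 4 * (2 / e) by field; rewrite gt_eqF.
  have : 0 < 2 / e by rewrite divr_gt0.
  move: (2 / e) => w w0; nra.
have [a a0 Ha] := key _ u0.
have [c c0 Hc] : exists2 z, 0 <= z & 2 * expR (- (z ^+ 2 / 4)) < 1 - u.
  by apply: key; lra.
have Na : Phi (- a) < u.
  by apply: le_lt_trans Ha; rewrite -(sqrrN a); apply: Phi_le_exp; lra.
have Nc : u < Phi c.
  by have := le_lt_trans (onem_Phi_le_exp c0) Hc; lra.
have ac : - a <= c by lra.
have [||x _ xu] := @IVT R (@Phi R) (- a) c u ac.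
- by apply: continuous_subspaceT => y; exact: continuous_Phi.
- by rewrite ge_min le_max (ltW Na) (ltW Nc) orbT.
by exists x.
Qed.

Lemma PhiK : cancel (@Phi R) (@Phi_inv R).
Proof.
move=> x; rewrite /Phi_inv; case: xgetP => [y _ /Phi_inj //|].
by move=> /(_ x)/(_ erefl).
Qed.

Lemma Phi_invK u : 0 < u < 1 -> Phi (Phi_inv u) = u.
Proof. by move=> /Phi_surj[x <-]; rewrite PhiK. Qed.

Lemma Phi_inv0 u : ~~ (0 < u < 1) -> Phi_inv u = 0.
Proof.
move=> u01; rewrite /Phi_inv; case: xgetP => // y _ yu.
by move: u01; rewrite -yu Phi_gt0 Phi_lt1.
Qed.

Lemma Phi_inv_le u v : 0 < u -> v < 1 -> u <= v -> Phi_inv u <= Phi_inv v.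
Proof.
by move=> u0 v1 uv; rewrite -ler_Phi !Phi_invK// ?u0 ?v1 (lt_le_trans u0, le_lt_trans uv).
Qed.

Lemma continuous_Phi_inv u : 0 < u < 1 -> {for u, continuous (@Phi_inv R)}.
Proof.
move=> u01; have [x xu] := Phi_surj u01; rewrite /prop_for /continuous_at -{2}xu PhiK.
apply/cvgrPdist_le => e e0.
have h1 : Phi (x - e) < u by rewrite -xu ltr_Phi; lra.
have h2 : u < Phi (x + e) by rewrite -xu ltr_Phi; lra.
near=> v.
have v1 : Phi (x - e) < v by near: v; exact: lt_nbhsr.
have v2 : v < Phi (x + e) by near: v; exact: lt_nbhsl.
have v01 : 0 < v < 1 by rewrite (lt_trans (Phi_gt0 _) v1) (lt_trans v2 (Phi_lt1 _)).
have w1 : x - e < Phi_inv v by rewrite -ltr_Phi Phi_invK.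
have w2 : Phi_inv v < x + e by rewrite -ltr_Phi Phi_invK.
by rewrite ler_distl; apply/andP; split; lra.
Unshelve. all: by end_near. Qed.

(** Trades Gaussian growth in [z] for a power singularity of [u = Phi z] at the endpoints: if [p] is
    the tail probability on the side of [z], then [exp (z^2 / 4) <= 2 / p], and this is raised to
    the power [4 * beta]. *)
Lemma expR_sqr_le_tail (beta : R) z : 0 <= beta ->
  expR (beta * z ^+ 2) <=
  2 `^ (4 * beta) * (Phi z `^ (- (4 * beta)) + (1 - Phi z) `^ (- (4 * beta))).
Proof.
move=> b0.
have aux (p : R) : 0 < p -> p <= 2 * expR (- (z ^+ 2 / 4)) ->
    expR (beta * z ^+ 2) <= 2 `^ (4 * beta) * p `^ (- (4 * beta)).
  move=> p0 ple; rewrite powRN -(ler_pM2r (_ : 0 < p `^ (4 * beta))) ?powR_gt0//.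
  rewrite mulfVK ?gt_eqF ?powR_gt0//.
  have -> : expR (beta * z ^+ 2) = expR (z ^+ 2 / 4) `^ (4 * beta).
    by rewrite -expRM; congr expR; field.
  rewrite -powRM ?expR_ge0 ?(ltW p0)//.
  apply: (@ge0_ler_powR R (4 * beta)); rewrite ?nnegrE.
  - by rewrite mulr_ge0.
  - by rewrite mulr_ge0 ?expR_ge0 ?(ltW p0).
  - by [].
  - by rewrite mulrC -ler_pdivlMr ?expR_gt0// -expRN.
rewrite mulrDr; case: (leP z 0) => [z0|/ltW z0].
  rewrite -[leLHS]addr0; apply: lerD; last by rewrite mulr_ge0 ?powR_ge0.
  by apply: aux; [exact: Phi_gt0|exact: Phi_le_exp].
rewrite -[leLHS]add0r; apply: lerD; first by rewrite mulr_ge0 ?powR_ge0.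
by apply: aux; [rewrite subr_gt0 Phi_lt1|exact: onem_Phi_le_exp].
Qed.

End standard_normal.

(** * Variance of a monotone function over the cells of a grid *)

Section power_sums.
Variable R : realType.
Implicit Types s : R.

(** Young's inequality with exponents [1 / a] and [1 / (1 - a)], one of the two factors being
    [1]. *)
Lemma powR_le_affine (a y : R) : 0 < a < 1 -> 0 <= y -> y `^ a <= a * y + (1 - a).
Proof.
move=> /andP[a0 a1] y0; have b0 : 0 < 1 - a by rewrite subr_gt0.
have := @conjugate_powR R (y `^ a) 1 a^-1 (1 - a)^-1 (powR_ge0 _ _) ler01.
rewrite !invr_gt0 => /(_ a0 b0); rewrite !invrK subrKC => /(_ erefl).
by rewrite mulr1 -powRrM divff ?gt_eqF// powRr1// powR1 mul1r mulrC.
Qed.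

(** Samples of the singularity [u^(-s)]; the value [0] at [x = 0] fits the grid, whose point [0]
    carries the value [0]. *)
Definition pw s (n x : nat) : R := if x == 0%N then 0 else (x%:R / n%:R) `^ (- s).

Lemma pw_ge0 s n x : 0 <= pw s n x.
Proof. by rewrite /pw; case: ifP => // _; exact: powR_ge0. Qed.

Lemma pw_anti s n x y : 0 <= s -> (0 < x)%N -> (x <= y)%N -> pw s n y <= pw s n x.
Proof.
move=> s0 x0 xy; rewrite /pw !gtn_eqF//; last exact: leq_trans xy.
case: n => [|n]; first by rewrite !invr0 !mulr0.
rewrite !powRN lef_pV2 ?posrE ?powR_gt0 ?divr_gt0 ?ltr0n//; last exact: leq_trans xy.
by apply: ge0_ler_powR; rewrite ?nnegrE ?divr_ge0// ler_pM2r ?invr_gt0 ?ltr0n// ler_nat.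
Qed.

(** Comparison with the integral of [u^(-s)] over [[0, M / n]]; the induction step is
    [powR_le_affine] at [y = M / (M + 1)]. *)
Lemma sum_pw_initial s n M : 0 < s < 1 -> (0 < n)%N ->
  \sum_(0 <= x < M.+1) pw s n x <= n%:R * (M%:R / n%:R) `^ (1 - s) / (1 - s).
Proof.
move=> /andP[s0 s1] n0; have a0 : 0 < 1 - s by lra.
elim: M => [|M IH].
  by rewrite big_nat1 /pw eqxx mul0r powR0 ?gt_eqF// mulr0 mul0r.
rewrite big_nat_recr//=; apply: le_trans (lerD IH (lexx _)) _.
rewrite /pw /= ler_pdivlMr// mulrDl mulfVK ?gt_eqF//.
set x := M.+1%:R / n%:R.
have x0 : 0 < x by rewrite divr_gt0 ?ltr0n.
have -> : x `^ (- s) = n%:R * (x `^ (1 - s) / M.+1%:R).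
  rewrite powRD ?powRr1 ?ltW//; last by rewrite (gt_eqF x0) implybT.
  move: (x `^ (- s)) => p; rewrite /x.
  have : n%:R != 0 :> R by rewrite pnatr_eq0 -lt0n.
  have : M.+1%:R != 0 :> R by rewrite pnatr_eq0.
  by move: (M.+1%:R) (n%:R) => m n' hm hn; field; rewrite ?hm ?hn.
rewrite -mulrA -mulrDr ler_pM2l ?ltr0n//.
have -> : M%:R / n%:R = (M%:R / M.+1%:R) * x.
  rewrite /x; have : n%:R != 0 :> R by rewrite pnatr_eq0 -lt0n.
  have : M.+1%:R != 0 :> R by rewrite pnatr_eq0.
  by move: (M.+1%:R) (n%:R) => m n' hm hn; field; rewrite ?hm ?hn.
rewrite powRM ?(ltW x0) ?divr_ge0//.
have y0 : 0 <= M%:R / M.+1%:R :> R by rewrite divr_ge0.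
have aI : 0 < 1 - s < 1 by apply/andP; split; lra.
have := powR_le_affine aI y0.
have -> : (1 - s) * (M%:R / M.+1%:R) + (1 - (1 - s)) = 1 - (1 - s) / M.+1%:R.
  rewrite -!natr1; field.
  by rewrite ?nat1r ?natr1 pnatr_eq0.
move=> h; apply: (@le_trans _ _ ((1 - (1 - s) / M.+1%:R) * x `^ (1 - s) +
   x `^ (1 - s) / M.+1%:R * (1 - s))).
  by rewrite lerD2r ler_wpM2r// powR_ge0.
rewrite le_eqVlt; apply/orP; left; apply/eqP; field.
by rewrite ?nat1r ?natr1 pnatr_eq0.
Qed.

(** The first block is part of an initial sum; in a later one every term is at most the value at
    [M], which stays within the same bound. The shift [e = 1] serves the reversed sum, where [r]
    becomes [M - 1 - r]. *)
Lemma sum_pw_block s (q M i e : nat) : 0 < s < 1 -> (0 < q)%N -> (0 < M)%N ->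
  (e <= 1)%N ->
  \sum_(0 <= r < M) pw s (q * M) (i * M + r + e) <=
  (q * M)%:R * q%:R^-1 `^ (1 - s) / (1 - s).
Proof.
move=> s01 q0 M0 e1; have [s0 s1] := andP s01; have a0 : 0 < 1 - s by lra.
have Mq : M%:R / (q * M)%:R = q%:R^-1 :> R.
  rewrite natrM invfM mulrCA divff ?mulr1// pnatr_eq0 -lt0n//.
case: i => [|i].
  apply: (@le_trans _ _ (\sum_(0 <= x < M.+1) pw s (q * M) x)).
    case: e e1 => [|[|//]] _.
      rewrite big_nat_recr//=; under eq_bigr do rewrite mul0n add0n addn0.
      by rewrite lerDl pw_ge0.
    rewrite big_nat_recl//=; under eq_bigr do rewrite mul0n add0n addn1.
    by rewrite lerDr pw_ge0.
  by rewrite -Mq; apply: sum_pw_initial => //; rewrite muln_gt0 q0.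
apply: (@le_trans _ _ (\sum_(0 <= r < M) q%:R^-1 `^ (- s))).
  apply: ler_sum => r _; rewrite -Mq.
  have -> : (M%:R / (q * M)%:R) `^ (- s) = pw s (q * M) M.
    by rewrite /pw gtn_eqF.
  apply: pw_anti => //; first exact: ltW.
  by rewrite mulSn -!addnA leq_addr.
rewrite sumr_const_nat subn0 powRD; last by rewrite invr_eq0 pnatr_eq0 gtn_eqF// implybT.
rewrite powRr1 ?invr_ge0// -[_ *+ M]mulr_natr ler_pdivlMr// natrM.
have -> : q%:R * M%:R * (q%:R^-1 * q%:R^-1 `^ (- s)) = q%:R^-1 `^ (- s) * M%:R :> R.
  by field; rewrite pnatr_eq0 -lt0n.
by rewrite ler_piMr ?mulr_ge0 ?powR_ge0//; lra.
Qed.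

Lemma sum_pw_block_rev s (q M i : nat) : 0 < s < 1 -> (i < q)%N -> (0 < M)%N ->
  \sum_(0 <= r < M) pw s (q * M) (q * M - (i * M + r)) <=
  (q * M)%:R * q%:R^-1 `^ (1 - s) / (1 - s).
Proof.
move=> s01 iq M0; rewrite big_nat_rev/=.
have q0 : (0 < q)%N by exact: leq_trans iq.
apply: le_trans (@sum_pw_block s q M (q - i.+1) 1 s01 q0 M0 (leqnn _)).
apply: ler_sum_nat => r /andP[_ rM]; rewrite le_eqVlt; apply/orP; left; apply/eqP.
congr (pw _ _ _); rewrite add0n mulnBl mulSn.
have : (i.+1 * M <= q * M)%N by rewrite leq_mul2r iq orbT.
rewrite mulSn; lia.
Qed.

End power_sums.

Section cell_variance.
Variable R : realType.
Implicit Types (f : nat -> R) (s : R).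

Lemma sum_nat_blocks (q M : nat) (F : nat -> R) :
  \sum_(0 <= x < q * M) F x =
  \sum_(0 <= i < q) \sum_(0 <= r < M) F (i * M + r)%N.
Proof.
rewrite big_nat_mul; apply: eq_bigr => i _.
by rewrite -{1}[(i * M)%N]add0n big_addn mulSn addnK; apply: eq_bigr => r _; rewrite addnC.
Qed.

Lemma sum_same_block (q M : nat) (G : nat -> nat -> R) : (0 < M)%N ->
  \sum_(0 <= x < q * M) \sum_(0 <= y < q * M | (x %/ M == y %/ M)%N) G x y =
  \sum_(0 <= i < q) \sum_(0 <= r < M) \sum_(0 <= r' < M) G (i * M + r)%N (i * M + r')%N.
Proof.
move=> M0; rewrite sum_nat_blocks; apply: eq_big_nat => i /andP[_ iq].
apply: eq_big_nat => r /andP[_ rM].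
rewrite big_mkcond/= sum_nat_blocks (bigD1_seq i) ?mem_index_iota ?iq ?iota_uniq//=.
rewrite [X in _ + X]big1 ?addr0 => [|i' ii'].
  apply: eq_big_nat => r' /andP[_ r'M].
  by rewrite !divnMDl// !divn_small// !addn0 eqxx.
rewrite big_nat_cond big1// => r' /andP[/andP[_ r'M] _].
by rewrite !divnMDl// !divn_small// !addn0 eq_sym (negbTE ii').
Qed.

Lemma sum_sqr_le (n : nat) (a : nat -> R) : (forall i, (i < n)%N -> 0 <= a i) ->
  \sum_(0 <= i < n) a i ^+ 2 <= (\sum_(0 <= i < n) a i) ^+ 2.
Proof.
elim: n => [|n IH] a0; first by rewrite !big_nil expr0n.
rewrite !big_nat_recr//= sqrrD addrAC -[leLHS]addr0.
apply: lerD; first by rewrite lerD2r; apply: IH => i /ltnW; exact: a0.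
rewrite mulrn_wge0// mulr_ge0 ?a0// big_nat_cond.
by apply: sumr_ge0 => i; rewrite andbT => /andP[_ /ltnW]; exact: a0.
Qed.

Lemma sum_interior (q : nat) (T : nat -> R) :
  \sum_(0 <= i < q) (if (i == 0)%N || (i.+1 == q) then 0 else T i.+1 - T i) =
  if (2 < q)%N then T q.-1 - T 1%N else 0.
Proof.
case: q => [|[|q]]; rewrite ?big_nil ?big_nat1//.
rewrite big_nat_recl//= big_nat_recr//= eqxx addr0 add0r.
transitivity (\sum_(0 <= i < q) (T i.+2 - T i.+1)).
  by apply: eq_big_nat => i /andP[_ iq]; rewrite !eqSS ltn_eqF.
rewrite (telescope_sumr (fun i => T i.+1))//; case: q => //=.
by rewrite subrr.
Qed.

(* On the inner cells [f] is squeezed between the values of [T] at the endpoints,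
   and the sum of the squared increments of [T] is at most the square of their
   telescoping sum; the two outer cells are covered by the power sums. *)
Lemma cell_variance_le f (T : nat -> R) (s C : R) (q M : nat) :
  0 < s < 1 -> (0 < q)%N -> (0 < M)%N -> 0 <= C ->
  (forall x, (x < q * M)%N -> f x ^+ 2 <= C * (pw s (q * M) x + pw s (q * M) (q * M - x))) ->
  (forall i, (0 < i < q)%N -> T i ^+ 2 <= C * (pw s q i + pw s q (q - i))) ->
  (forall i x, (0 < i)%N -> (i.+1 < q)%N -> (i * M <= x < i.+1 * M)%N ->
     T i <= f x <= T i.+1) ->
  (q * M)%:R^-1 * \sum_(0 <= x < q * M) \sum_(0 <= y < q * M | (x %/ M == y %/ M)%N)
     M%:R^-1 * (f x - f y) ^+ 2 <=
  24 * C / (1 - s) * q%:R^-1 `^ (1 - s).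
Proof.
move=> s01 q0 M0 C0 Hf HT mono; have [s0 s1] := andP s01.
have a0 : 0 < 1 - s by lra.
have n0 : (0 < q * M)%N by rewrite muln_gt0 q0.
set n := (q * M)%N in Hf n0 *; set dl := q%:R^-1 `^ (1 - s).
have dl0 : 0 <= dl by exact: powR_ge0.
set A := 8 * C / (1 - s) * n%:R * dl.
have A0 : 0 <= A by rewrite /A !mulr_ge0// ltW ?invr_gt0.
pose S i := \sum_(0 <= r < M) \sum_(0 <= r' < M)
  M%:R^-1 * (f (i * M + r)%N - f (i * M + r')%N) ^+ 2.
rewrite sum_same_block// -/(S _).
(* Crude bound by the second moment of [f] on the cell, meant for the two outer cells, where [T]
   gives no control. *)
have S_le i : (i < q)%N -> S i <= A.
  move=> iq.
  have sf : \sum_(0 <= r < M) f (i * M + r)%N ^+ 2 <= 2 * C / (1 - s) * n%:R * dl.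
    apply: (@le_trans _ _ (\sum_(0 <= r < M) C * (pw s n (i * M + r) + pw s n (n - (i * M + r))))).
      apply: ler_sum_nat => r /andP[_ rM]; apply: Hf.
      apply: (@leq_trans (i.+1 * M)); first by rewrite mulSn addnC ltn_add2r.
      by rewrite leq_mul2r iq orbT.
    rewrite -mulr_sumr big_split/=.
    have -> : 2 * C / (1 - s) * n%:R * dl = C * (n%:R * dl / (1 - s) + n%:R * dl / (1 - s)).
      by field; lra.
    rewrite ler_wpM2l//; apply: lerD; last exact: sum_pw_block_rev.
    under eq_bigr do rewrite -[X in pw _ _ X]addn0.
    exact: sum_pw_block.
  have M0' : 0 < M%:R :> R by rewrite ltr0n.
  apply: (@le_trans _ _ (\sum_(0 <= r < M) \sum_(0 <= r' < M)
     M%:R^-1 * (2 * f (i * M + r)%N ^+ 2 + 2 * f (i * M + r')%N ^+ 2))).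
    apply: ler_sum => r _; apply: ler_sum => r' _; rewrite ler_pM2l ?invr_gt0//.
    have := sqr_ge0 (f (i * M + r)%N + f (i * M + r')%N); rewrite sqrrD sqrrB; lra.
  set SF := \sum_(0 <= r < M) f (i * M + r)%N ^+ 2 in sf *.
  have inner r : \sum_(0 <= r' < M)
     M%:R^-1 * (2 * f (i * M + r)%N ^+ 2 + 2 * f (i * M + r')%N ^+ 2) =
     2 * f (i * M + r)%N ^+ 2 + M%:R^-1 * (2 * SF).
    rewrite -mulr_sumr big_split/= sumr_const_nat subn0 -mulr_sumr -/SF -[(2 * _) *+ M]mulr_natr.
    by field; rewrite gt_eqF.
  under eq_bigr do rewrite inner.
  rewrite big_split/= -mulr_sumr sumr_const_nat subn0 -/SF -[(_ * (2 * SF)) *+ M]mulr_natr.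
  rewrite [leLHS](_ : _ = 4 * SF); last by field; rewrite gt_eqF.
  apply: (@le_trans _ _ (4 * (2 * C / (1 - s) * n%:R * dl))); first by rewrite ler_pM2l.
  rewrite /A le_eqVlt; apply/orP; left; apply/eqP; field; lra.
have S_int i : (0 < i)%N -> (i.+1 < q)%N -> S i <= M%:R * (T i.+1 - T i) ^+ 2.
  move=> i0 iq.
  have Ti r : (r < M)%N -> T i <= f (i * M + r)%N <= T i.+1.
    by move=> rM; apply: mono => //; rewrite leq_addr mulSn addnC ltn_add2r.
  apply: (@le_trans _ _ (\sum_(0 <= r < M) \sum_(0 <= r' < M)
     M%:R^-1 * (T i.+1 - T i) ^+ 2)).
    apply: ler_sum_nat => r /andP[_ /Ti/andP[? ?]].
    apply: ler_sum_nat => r' /andP[_ /Ti/andP[? ?]].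
    rewrite ler_pM2l ?invr_gt0 ?ltr0n//.
    rewrite -(real_normK (num_real (f _ - f _))) ler_sqr ?nnegrE//; last by lra.
    by rewrite ler_norml; apply/andP; split; lra.
  rewrite !sumr_const_nat !subn0 -mulrnA -[(_ * _) *+ _]mulr_natr natrM.
  rewrite [leLHS](_ : _ = M%:R * (T i.+1 - T i) ^+ 2)//.
  by field; rewrite pnatr_eq0 -lt0n.
pose B i := if (i == 0)%N || (i.+1 == q) then 0 else T i.+1 - T i.
have B0 i : (i < q)%N -> 0 <= B i.
  rewrite /B; case: ifPn => // /norP[i0 iq] iq'; rewrite subr_ge0.
  have /andP[] : T i <= f (i * M)%N <= T i.+1; last exact: le_trans.
  by apply: mono; [rewrite lt0n|rewrite ltn_neqAle iq|rewrite leqnn/= ltn_mul2r M0 ltnSn].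
(* The sum telescopes to [T q.-1 - T 1], and each of these two values has square at most
   [2 * C * q^s], being taken at distance at least [1 / q] from both endpoints. *)
have sumB : (\sum_(0 <= i < q) B i) ^+ 2 <= 8 * C * q%:R^-1 `^ (- s).
  rewrite sum_interior; case: ifPn => [q2|_]; last by rewrite expr0n !mulr_ge0 ?powR_ge0.
  have p1 : pw s q 1 = q%:R^-1 `^ (- s) by rewrite /pw /= mul1r.
  have [e1 e2 e3 e4] : [/\ (q - q.-1 = 1)%N, (q - 1 = q.-1)%N, (0 < q.-1 < q)%N & (0 < 1 < q)%N].
    by clear -q2; split; lia.
  have pq : pw s q q.-1 <= q%:R^-1 `^ (- s).
    by rewrite -p1; apply: pw_anti; [exact: ltW| |case/andP: e3].
  have h1 := HT _ e3; rewrite e1 p1 in h1.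
  have h2 := HT _ e4; rewrite e2 p1 in h2.
  apply: (@le_trans _ _ (2 * T q.-1 ^+ 2 + 2 * T 1%N ^+ 2)).
    have := sqr_ge0 (T q.-1 + T 1%N); rewrite sqrrD sqrrB; lra.
  have : C * pw s q q.-1 <= C * q%:R^-1 `^ (- s) by rewrite ler_wpM2l.
  move: h1 h2; rewrite !mulrDr; lra.
have sumS : \sum_(0 <= i < q) S i <= 2 * A + M%:R * (8 * C * q%:R^-1 `^ (- s)).
  apply: (@le_trans _ _ (\sum_(0 <= i < q) ((if (i == 0)%N then A else 0) +
     (if (i == q.-1)%N then A else 0) + M%:R * B i ^+ 2))).
    apply: ler_sum_nat => i /andP[_ iq]; rewrite /B.
    have -> : (i == q.-1)%N = (i.+1 == q)%N by clear -q0; lia.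
    case: ifPn => i0 /=.
      by rewrite expr0n mulr0 addr0 (le_trans (S_le _ iq))// lerDl; case: ifP.
    case: ifPn => i1; first by rewrite expr0n mulr0 addr0 add0r S_le.
    by rewrite addr0 add0r S_int ?lt0n// ltn_neqAle i1.
  rewrite !big_split/= -mulr_sumr; apply: lerD.
    have sum1 j : (j < q)%N -> \sum_(0 <= i < q) (if (i == j)%N then A else 0) = A.
      move=> jq; rewrite (bigD1_seq j) ?mem_index_iota ?iota_uniq//= eqxx.
      by rewrite big1 ?addr0// => i /negbTE ->.
    by rewrite !sum1 ?ltn_predL// mulr2n mulrDl mul1r.
  rewrite ler_wpM2l// (le_trans _ sumB)//; exact: sum_sqr_le.
rewrite ler_pdivrMl ?ltr0n//; apply: (le_trans sumS).
have E : q%:R^-1 `^ (- s) = q%:R * dl.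
  rewrite /dl powRD; last by rewrite invr_eq0 pnatr_eq0 gtn_eqF// implybT.
  by rewrite powRr1 ?invr_ge0// mulrA divff ?mul1r// pnatr_eq0 -lt0n.
rewrite E /A /n natrM.
(* The outer cells contribute [16 * C / (1 - s)] and the inner ones [8 * C], enlarged to
   [8 * C / (1 - s)]: hence [24]. *)
have h : 8 * C <= 8 * C / (1 - s).
  by rewrite ler_peMr ?mulr_ge0// invf_ge1//; lra.
rewrite [leRHS](_ : _ = 2 * (8 * C / (1 - s) * (q%:R * M%:R) * dl) +
   M%:R * (8 * C / (1 - s) * (q%:R * dl))); last by field; lra.
by rewrite lerD2l ler_wpM2l// ler_wpM2r// mulr_ge0.
Qed.

End cell_variance.

(** * Normal quantiles on the grid and the monotone majorant *)

Section grid_points.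
Variable R : realType.
Implicit Types (beta s z : R).

(* The outermost cells carry the value [0]: it is also the junk value of
   [Phi_inv] at 0 and 1, so that grid points converge to [Phi_inv u] for every
   [u] in [0, 1]. *)
Definition gridpt (n x : nat) : R :=
  if x.+1 == n then 0 else Phi_inv (x%:R / n%:R).

(** Its derivative [(1 + 2 beta z^2) exp (beta z^2)] dominates [exp (beta z^2)], so its increments
    dominate those of any function whose derivative has that growth; unlike a primitive of
    [exp (beta z^2)], it has a closed form. *)
Definition Psi beta z : R := z * expR (beta * z ^+ 2).

Lemma Psi_le beta z z' : 0 <= beta -> z <= z' -> Psi beta z <= Psi beta z'.
Proof.
move=> b0; rewrite /Psi.
have pos (x y : R) : 0 <= x -> x <= y -> x * expR (beta * x ^+ 2) <= y * expR (beta * y ^+ 2).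
  move=> x0 xy; apply: ler_pM; rewrite ?expR_ge0//.
  by rewrite ler_expR ler_wpM2l// ler_sqr ?nnegrE// (le_trans x0).
move=> zz'; case: (leP 0 z) => [z0|z0]; first exact: pos.
case: (leP 0 z') => [z'0|z'0].
  apply: (@le_trans _ _ 0); last by rewrite mulr_ge0 ?expR_ge0.
  by rewrite mulr_le0_ge0 ?expR_ge0 ?ltW.
have := pos (- z') (- z); rewrite !sqrrN !mulNr !lerN2; apply; lra.
Qed.

(** One more factor [exp (beta z^2)] absorbs [z^2]. This is where [3 * beta], and hence [12 * beta],
    comes from. *)
Lemma Psi_sqr_le beta z : 0 < beta ->
  Psi beta z ^+ 2 <= beta^-1 * expR (3 * beta * z ^+ 2).
Proof.
move=> b0; rewrite /Psi exprMn -expRM_natl.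
have -> : 3 * beta * z ^+ 2 = beta * z ^+ 2 + 2 * (beta * z ^+ 2) by ring.
rewrite expRD [leRHS]mulrA ler_pM2r ?expR_gt0// ler_pdivlMl//.
by apply: le_trans (expR_ge1Dx _); rewrite lerDr.
Qed.

Lemma expR_tail_grid beta (n x : nat) : 0 <= beta -> (0 < x < n)%N ->
  expR (beta * Phi_inv (x%:R / n%:R) ^+ 2) <=
  2 `^ (4 * beta) * (pw (4 * beta) n x + pw (4 * beta) n (n - x)).
Proof.
move=> b0 /andP[x0 xn]; set s := 4 * beta.
have n0 : 0 < n%:R :> R by rewrite ltr0n (leq_trans _ xn).
have u01 : 0 < (x%:R / n%:R : R) < 1.
  by rewrite ltr_pdivrMr// mul1r ltr_nat xn andbT divr_gt0// ltr0n.
apply: le_trans (expR_sqr_le_tail _ b0) _; rewrite Phi_invK//.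
rewrite /pw gtn_eqF// gtn_eqF ?subn_gt0// natrB ?(ltnW xn)//.
by rewrite mulrBl divff// gt_eqF.
Qed.

Lemma expR_gridpt beta (n x : nat) : 0 <= beta -> (x < n)%N ->
  expR (beta * gridpt n x ^+ 2) <=
  1 + 2 `^ (4 * beta) * (pw (4 * beta) n x + pw (4 * beta) n (n - x)).
Proof.
move=> b0 xn; set s := 4 * beta; have w0 : 0 <= 2 `^ s * (pw s n x + pw s n (n - x)).
  by rewrite mulr_ge0 ?powR_ge0 ?addr_ge0 ?pw_ge0.
rewrite /gridpt; case: ifPn => [_|xn1]; first by rewrite expr0n mulr0 expR0 lerDl.
have [->|x0] := posnP x.
  by rewrite mul0r Phi_inv0 ?ltxx// expr0n mulr0 expR0 lerDl mulr_ge0 ?powR_ge0 ?addr_ge0 ?pw_ge0.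
by apply: le_trans (expR_tail_grid b0 _) _; rewrite ?x0// lerDr.
Qed.

Lemma mean_expR_gridpt beta : 0 < 4 * beta < 1 ->
  exists2 C : R, 0 <= C & forall n, (0 < n)%N ->
    n%:R^-1 * \sum_(0 <= x < n) expR (beta * gridpt n x ^+ 2) <= C.
Proof.
move=> s01; have /andP[s0 s1] := s01; have b0 : 0 <= beta by lra.
set s := 4 * beta in s0 s1 s01 *; have a0 : 0 < 1 - s by lra.
exists (1 + 2 `^ s * (2 / (1 - s))).
  by rewrite addr_ge0// mulr_ge0 ?powR_ge0// divr_ge0// ltW.
move=> n n0; rewrite ler_pdivrMl ?ltr0n//.
apply: (@le_trans _ _ (\sum_(0 <= x < n) (1 + 2 `^ s * (pw s n x + pw s n (n - x))))).
  by apply: ler_sum_nat => x /andP[_ xn]; exact: expR_gridpt.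
rewrite big_split/= sumr_const_nat subn0 mulrDr mulr1 lerD2l -mulr_sumr mulrCA.
rewrite ler_wpM2l ?powR_ge0// big_split/=.
(* The whole grid is a single block: [q = 1], [M = n]. *)
have h1 : \sum_(0 <= x < n) pw s n x <= n%:R / (1 - s).
  have := @sum_pw_block _ s 1 n 0 0 s01 isT n0 isT.
  rewrite mul1n invr1 powR1 mulr1; apply: le_trans.
  by under [leRHS]eq_bigr do rewrite mul0n add0n addn0.
have h2 : \sum_(0 <= x < n) pw s n (n - x) <= n%:R / (1 - s).
  have := @sum_pw_block_rev _ s 1 n 0 s01 isT n0.
  rewrite mul1n invr1 powR1 mulr1; apply: le_trans.
  by under [leRHS]eq_bigr do rewrite mul0n add0n.
apply: le_trans (lerD h1 h2) _; rewrite le_eqVlt; apply/orP; left; apply/eqP.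
by field; lra.
Qed.

Lemma gridpt_variance beta : 0 < 12 * beta < 1 ->
  exists2 C : R, 0 <= C & forall q M : nat, (0 < q)%N -> (0 < M)%N ->
    (q * M)%:R^-1 * \sum_(0 <= x < q * M) \sum_(0 <= y < q * M | (x %/ M == y %/ M)%N)
       M%:R^-1 * (Psi beta (gridpt (q * M) x) - Psi beta (gridpt (q * M) y)) ^+ 2 <=
    C * q%:R^-1 `^ (1 - 12 * beta).
Proof.
move=> s01; have /andP[s0 s1] := s01; have b0 : 0 < beta by lra.
set s := 12 * beta in s0 s1 s01 *; have a0 : 0 < 1 - s by lra.
set C := beta^-1 * 2 `^ s.
have C0 : 0 <= C by rewrite mulr_ge0 ?powR_ge0// invr_ge0 ltW.
exists (24 * C / (1 - s)); first by apply: divr_ge0; [rewrite mulr_ge0|exact: ltW].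
move=> q M q0 M0; pose f x := Psi beta (gridpt (q * M) x).
have HPhi n x : (0 < x < n)%N -> Psi beta (Phi_inv (x%:R / n%:R)) ^+ 2 <=
    C * (pw s n x + pw s n (n - x)).
  move=> xn; apply: le_trans (Psi_sqr_le _ b0) _.
  rewrite /C -[leRHS]mulrA ler_pM2l ?invr_gt0//.
  have -> : s = 4 * (3 * beta) by rewrite /s; ring.
  by apply: expR_tail_grid => //; lra.
have Psi0 : Psi beta 0 = 0 by rewrite /Psi mul0r.
apply: (cell_variance_le (f := f) (T := fun i => Psi beta (Phi_inv (i%:R / q%:R)))) => //.
- move=> x xn; rewrite /f /gridpt; case: ifPn => [_|xn1].
    by rewrite Psi0 expr0n mulr_ge0 ?addr_ge0 ?pw_ge0.
  have [->|x0] := posnP x; last by apply: HPhi; rewrite x0.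
  by rewrite mul0r Phi_inv0 ?ltxx// Psi0 expr0n mulr_ge0 ?addr_ge0 ?pw_ge0.
- by move=> i iq; exact: HPhi.
(* An inner coarse cell contains neither outermost fine cell, so [gridpt] is a true quantile there
   and monotonicity applies. *)
- move=> i x i0 iq /andP[ix xi]; rewrite /f /gridpt.
  have iqM : (i.+1 * M < q * M)%N by rewrite ltn_mul2r M0.
  rewrite ltn_eqF ?(leq_ltn_trans xi)//.
  have q0' : 0 < q%:R :> R by rewrite ltr0n.
  have n0 : 0 < (q * M)%:R :> R by rewrite ltr0n muln_gt0 q0.
  have i1 : i.+1%:R / q%:R < 1 :> R by rewrite ltr_pdivrMr// mul1r ltr_nat.
  have i1' : 0 < i%:R / q%:R :> R by rewrite divr_gt0// ltr0n.
  have l1 : i%:R / q%:R <= x%:R / (q * M)%:R :> R.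
    by rewrite ler_pdivrMr// mulrAC ler_pdivlMr// -!natrM ler_nat mulnCA
      [leqRHS]mulnC leq_mul2l ix orbT.
  have l2 : x%:R / (q * M)%:R <= i.+1%:R / q%:R :> R.
    rewrite ler_pdivrMr// mulrAC ler_pdivlMr// -!natrM ler_nat mulnCA [leqLHS]mulnC.
    by rewrite leq_mul2l (ltnW xi) orbT.
  by apply/andP; split; apply: Psi_le; rewrite ?(ltW b0)//; apply: Phi_inv_le => //;
    [exact: le_lt_trans l2 i1|exact: lt_le_trans i1' l1].
Qed.

End grid_points.

(** * Haar kernels and scrambling of finitely many digits *)

Lemma sumr_cst (R : pzSemiRingType) (I : finType) (x : R) : \sum_(i : I) x = #|I|%:R * x.
Proof. by rewrite sumr_const [RHS]mulr_natl. Qed.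

Lemma natr_card_pred (R : pzSemiRingType) (I : finType) (P : pred I) :
  #|[pred i | P i]|%:R = \sum_i (P i)%:R :> R.
Proof.
rewrite -sum1_card natr_sum big_mkcond/=; apply: eq_bigr => i _.
by rewrite inE; case: (P i).
Qed.

Section haar_kernel.
Variables (R : realFieldType) (A : finType) (K : nat).
Implicit Types (x y : K.-tuple A) (k : nat) (l : 'I_K) (e : A).

Lemma eq_takeP k x y :
  reflect (forall l, (l < k)%N -> tnth x l = tnth y l) (take k x == take k y).
Proof.
have tE (z : K.-tuple A) : take k z = [seq tnth z i | i <- take k (enum 'I_K)].
  by rewrite map_take map_tnth_enum.
have ltk l : (l \in take k (enum 'I_K)) = (l < k)%N.
  by rewrite in_take ?mem_enum// index_enum_ord.
rewrite !tE; apply: (iffP eqP) => [/eq_in_map E l lk|E].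
  by apply: E; rewrite ltk.
by apply/eq_in_map => l; rewrite ltk; exact: E.
Qed.

Lemma eq_take_leq k k' x y : (k' <= k)%N -> take k x = take k y -> take k' x = take k' y.
Proof. by move=> kk' E; rewrite -(take_takel _ kk') E take_takel. Qed.

Definition set_digit l e x : K.-tuple A :=
  [tuple if i == l then e else tnth x i | i < K].

Lemma tnth_set_digit l e x i :
  tnth (set_digit l e x) i = if i == l then e else tnth x i.
Proof. by rewrite tnth_mktuple. Qed.

Lemma take_set_digit k l e x : (k <= l)%N -> take k (set_digit l e x) = take k x.
Proof.
move=> kl; apply/eqP/eq_takeP => i ik; rewrite tnth_set_digit ifN//.
by rewrite -val_eqE/= ltn_eqF// (leq_trans ik).
Qed.

Lemma eq_take_set_digit l e x y :
  (take l.+1 (set_digit l e x) == take l.+1 y) =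
  (take l x == take l y) && (e == tnth y l).
Proof.
apply/eq_takeP/andP => [E|[/eq_takeP E /eqP el] i].
  split; last by rewrite -(E l)// tnth_set_digit eqxx.
  apply/eq_takeP => i il; rewrite -(E i (ltnW il)) tnth_set_digit ifN//.
  by rewrite -val_eqE/= ltn_eqF.
rewrite tnth_set_digit ltnS leq_eqVlt val_eqE; case: eqVneq => [->|il] //= => ?.
exact: E.
Qed.

Definition cellk k x y : R := (#|A| ^ (K - k))%:R^-1 * (take k x == take k y)%:R.

(* [cellk k] is the kernel of the conditional expectation given the first [k]
   digits, and [haark k] that of the increment from [k - 1] to [k] digits. *)
Definition haark k x y : R :=
  if k is k'.+1 then cellk k x y - cellk k' x y else cellk 0 x y.

Lemma cellk_ge0 k x y : 0 <= cellk k x y.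
Proof. by rewrite mulr_ge0 ?invr_ge0. Qed.

Lemma cellkC k x y : cellk k x y = cellk k y x.
Proof. by rewrite /cellk eq_sym. Qed.

Hypothesis A0 : (0 < #|A|)%N.

Let b0 n : (#|A| ^ n)%:R != 0 :> R.
Proof. by rewrite pnatr_eq0 -lt0n expn_gt0 A0. Qed.

(** Exactly one value of digit [l] agrees with [y]; the factor [#|A|] is the ratio of the two
    normalisations. *)
Lemma sum_cellk_set_digit l x y :
  \sum_e cellk l.+1 (set_digit l e x) y = #|A|%:R * cellk l x y.
Proof.
rewrite /cellk -mulr_sumr.
under eq_bigr do rewrite eq_take_set_digit.
have -> : \sum_e ((take l x == take l y) && (e == tnth y l))%:R =
    (take l x == take l y)%:R :> R.
  rewrite (bigD1 (tnth y l))//= eqxx andbT big1 ?addr0// => e /negbTE ->.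
  by rewrite andbF.
rewrite mulrA; congr (_ * _).
have -> : (K - l = (K - l.+1).+1)%N by rewrite subnSK.
rewrite expnS natrM invfM mulrA divff ?mul1r//.
by have := b0 1; rewrite expn1.
Qed.

(** The martingale difference property: an increment vanishes when averaged over its last digit.
    Orthogonality under scrambling rests on it. *)
Lemma sum_haark_set_digit l x y : \sum_e haark l.+1 (set_digit l e x) y = 0.
Proof.
rewrite sumrB sum_cellk_set_digit.
under eq_bigr do rewrite /cellk take_set_digit//.
by rewrite sumr_const -[(_ * _) *+ _]mulr_natl subrr.
Qed.

Lemma eq_haark k x x' y : take k x = take k x' -> haark k x y = haark k x' y.
Proof.
move=> E; case: k E => [|k] E /=; first by rewrite /cellk !take0.
by rewrite /cellk E (eq_take_leq (leqnSn k) E).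
Qed.

Lemma sum_haark x y : \sum_(k < K.+1) haark k x y = (x == y)%:R.
Proof.
have E m : \sum_(k < m.+1) haark k x y = cellk m x y.
  elim: m => [|m IH]; first by rewrite big_ord1.
  by rewrite big_ord_recr/= IH subrKC.
by rewrite E /cellk subnn expn0 invr1 mul1r !take_oversize ?size_tuple.
Qed.

(** Downward induction on [k]: for [k >= K] the kernel is the identity, and averaging over digit [k]
    passes from [k + 1] to [k]. *)
Lemma sum_cellk k x : \sum_y cellk k x y = 1.
Proof.
under eq_bigr do rewrite cellkC.
have base k' (y : K.-tuple A) : (K <= k')%N -> \sum_x0 cellk k' x0 y = 1.
  move=> Kk; rewrite (bigD1 y)//= big1 => [|x0 yx].
    by rewrite addr0 /cellk (eqP Kk) invr1 mul1r eqxx.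
  by rewrite /cellk !take_oversize ?size_tuple// val_eqE (negbTE yx) mulr0.
have [n] : exists n, (K <= k + n)%N by exists K; rewrite leq_addl.
elim: n k x => [|n IH] k x Kk; first by apply: base; rewrite -(addn0 k).
have [/base//|kK] := leqP K k.
pose l := Ordinal kK.
rewrite addnS -addSn in Kk.
have {}IH : \sum_e \sum_y cellk k.+1 y (set_digit l e x) = #|A|%:R.
  by under eq_bigr do rewrite IH//; rewrite sumr_const.
rewrite exchange_big/= in IH.
have : #|A|%:R * \sum_y cellk k y x = #|A|%:R.
  rewrite -[RHS]IH mulr_sumr; apply: eq_bigr => y _.
  rewrite cellkC -(sum_cellk_set_digit l); apply: eq_bigr => e _; exact: cellkC.
by move=> /(canRL (mulKf _)) ->; [rewrite mulVf|]; have := b0 1; rewrite expn1.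
Qed.

Lemma sum_haark_eq0 k x : \sum_y haark k.+1 x y = 0.
Proof. by rewrite sumrB !sum_cellk subrr. Qed.

Lemma haarkC k x y : haark k x y = haark k y x.
Proof. by case: k => [|k] /=; [exact: cellkC|rewrite (cellkC k.+1) (cellkC k)]. Qed.

Lemma normr_haark k x y : `|haark k x y| <= cellk k x y + cellk k.-1 x y.
Proof.
case: k => [|k] /=; first by rewrite ger0_norm ?cellk_ge0// lerDl cellk_ge0.
by rewrite (le_trans (ler_normB _ _))// !ger0_norm ?cellk_ge0.
Qed.

Variable d : nat.
Local Notation grid := {ffun 'I_d -> K.-tuple A}.
Implicit Types (c : grid) (kap : 'I_d -> nat) (g : grid -> R).

(** A tensor product of one-dimensional martingale increments; only the projections onto levels are
    used, and no Haar basis is chosen. *)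
Definition haar g kap c : R :=
  \sum_(c' : grid) (\prod_j haark (kap j) (c j) (c' j)) * g c'.

(** Distributing the product over the levels turns the summed kernels into a product of identity
    kernels. *)
Lemma sum_haar g c : g c = \sum_(kap : {ffun 'I_d -> 'I_K.+1}) haar g (fun j => kap j) c.
Proof.
rewrite exchange_big/= (bigD1 c)//= [X in _ = _ + X]big1 => [|c' cc'].
  rewrite addr0 -mulr_suml -(bigA_distr_bigA (fun j (k : 'I_K.+1) => haark k (c j) (c j))).
  by rewrite big1 ?mul1r// => j _; rewrite sum_haark eqxx.
rewrite -mulr_suml -(bigA_distr_bigA (fun j (k : 'I_K.+1) => haark k (c j) (c' j))).
suff [j cj] : exists j, c j != c' j.
  by rewrite (bigD1 j)//= sum_haark (negbTE cj) !mul0r.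
apply/existsP; apply: contraNT cc'; rewrite negb_exists => /forallP cc'.
by apply/eqP/ffunP => j; have := cc' j; rewrite negbK => /eqP.
Qed.

Definition upd c j x : grid := [ffun i => if i == j then x else c i].

Lemma sum_haar_set_digit g kap c j l : kap j = l.+1 ->
  \sum_e haar g kap (upd c j (set_digit l e (c j))) = 0.
Proof.
move=> kj; rewrite exchange_big/= big1// => c' _.
rewrite -mulr_suml.
under eq_bigr => e _.
  rewrite (bigD1 j)//= ffunE eqxx kj.
  under eq_bigr => i ij do rewrite ffunE (negbTE ij).
  over.
by rewrite -mulr_suml sum_haark_set_digit !mul0r.
Qed.

Lemma eq_haar g kap c c' : (forall j, take (kap j) (c j) = take (kap j) (c' j)) ->
  haar g kap c = haar g kap c'.
Proof.
move=> E; apply: eq_bigr => c'' _; congr (_ * _).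
by apply: eq_bigr => j _; exact: eq_haark.
Qed.

Lemma sum_haar_grid g kap j : (0 < kap j)%N -> \sum_c haar g kap c = 0.
Proof.
move=> kj; rewrite exchange_big/= big1// => c' _; rewrite -mulr_suml.
rewrite -(bigA_distr_bigA (fun j (x : K.-tuple A) => haark (kap j) x (c' j))).
rewrite (bigD1 j)//=; under eq_bigr do rewrite haarkC.
by case: (kap j) kj => // k _; rewrite sum_haark_eq0 !mul0r.
Qed.

Lemma haar0 g kap c : (forall j, kap j = 0%N) ->
  haar g kap c = (#|A| ^ (K * d))%:R^-1 * \sum_c' g c'.
Proof.
move=> k0; rewrite /haar mulr_sumr; apply: eq_bigr => c' _; congr (_ * _).
under eq_bigr do rewrite k0 /= /cellk !take0 eqxx mulr1 subn0.
by rewrite prodr_const card_ord exprVn -natrX -expnM.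
Qed.

End haar_kernel.

(** * Uniform scrambling of finitely many digits *)

Section finite_scrambling.
Variables (R : realFieldType) (A : finType) (K d : nat).
Hypothesis A0 : (0 < #|A|)%N.
Local Notation grid := {ffun 'I_d -> K.-tuple A}.
Local Notation fam := {ffun 'I_d * K.-bseq A -> {perm A}}.
Implicit Types (pi : fam) (a c : grid) (h : grid -> R).

(* The permutation applied to digit [k] in coordinate [j] of [a] is the one at
   [key a j k]. *)
Definition key a (j : 'I_d) (k : nat) : 'I_d * K.-bseq A := (j, insub_bseq K (take k (a j))).

Definition scr pi a : grid :=
  [ffun j => [tuple pi (key a j l) (tnth (a j) l) | l < K]].

Lemma tnth_scr pi a j l : tnth (scr pi a j) l = pi (key a j l) (tnth (a j) l).
Proof. by rewrite ffunE tnth_mktuple. Qed.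

Lemma val_key a j (k : nat) : val (key a j k).2 = take k (a j).
Proof.
rewrite /key /= /insub_bseq val_insubd ifT// size_take size_tuple.
by case: ltnP => // /ltnW.
Qed.

Lemma eq_key a a' j k : take k (a j) = take k (a' j) -> key a j k = key a' j k.
Proof. by rewrite /key => ->. Qed.

(** As long as the digits agree, both points meet the same permutation, which is injective; so the
    length of a common prefix is preserved. *)
Lemma eq_take_scr pi a a' j (k : nat) :
  (take k (scr pi a j) == take k (scr pi a' j)) = (take k (a j) == take k (a' j)).
Proof.
apply/eq_takeP/eq_takeP => [E|E l lk]; last first.
  rewrite !tnth_scr E// (@eq_key a a')//.
  by apply/eqP/eq_takeP => i il; apply: E; exact: ltn_trans lk.
suff E' n (l : 'I_K) : (l <= n)%N -> (l < k)%N -> tnth (a j) l = tnth (a' j) l.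
  by move=> l; exact: (E' l).
elim: n l => [|n IH] l ln lk.
  have := E l lk; rewrite !tnth_scr (@eq_key a a'); first exact: perm_inj.
  by move: ln; rewrite leqn0 => /eqP ->; rewrite !take0.
have := E l lk; rewrite !tnth_scr (@eq_key a a'); first exact: perm_inj.
apply/eqP/eq_takeP => i il; apply: IH; last exact: ltn_trans lk.
by rewrite -ltnS; exact: leq_trans ln.
Qed.

Lemma scr_inj pi : injective (scr pi).
Proof.
move=> a a' E; apply/ffunP => j; apply/val_inj => /=.
have := eq_take_scr pi a a' j K.
by rewrite E eqxx !take_oversize ?size_tuple// => /esym/eqP.
Qed.

Lemma sum_scr a h : #|{: grid}|%:R * \sum_pi h (scr pi a) = #|{: fam}|%:R * \sum_c h c.
Proof.
(* Precomposing the permutations with transpositions preserves the uniform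
   distribution and replaces the digits of [a] by those of any other [c]. *)
pose T (c : grid) pi : fam := [ffun q : 'I_d * K.-bseq A =>
  if (insub (size q.2) : option 'I_K) is Some l then
    (tperm (tnth (a q.1) l) (tnth (c q.1) l) * pi q)%g else pi q].
have TK c : involutive (T c).
  move=> pi; apply/ffunP => q; rewrite !ffunE; case: insub => // l.
  by rewrite mulgA tperm2 mul1g.
(* [S pi c] scrambles the digits of [c] by the permutations attached to the prefixes of [a]. For
   fixed [pi] it is injective in [c], hence permutes the grid. *)
pose S pi (c : grid) : grid := [ffun j => [tuple pi (key a j l) (tnth (c j) l) | l < K]].
have ST pi c : scr (T c pi) a = S pi c.
  apply/ffunP => j; apply: eq_from_tnth => l.
  rewrite tnth_scr /S /T [in RHS]ffunE tnth_mktuple ffunE val_key size_take size_tuple ltn_ord.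
  by rewrite insubT//= => lK; rewrite permM (_ : Sub _ _ = l) ?tpermL//; exact: val_inj.
have Sinj pi : injective (S pi).
  move=> c c' E; apply/ffunP => j; apply: eq_from_tnth => l.
  by move/ffunP/(_ j)/(congr1 (fun x => tnth x l)) : E; rewrite !ffunE !tnth_mktuple => /perm_inj.
transitivity (\sum_(c : grid) \sum_pi h (scr pi a)).
  by rewrite sumr_cst.
transitivity (\sum_(c : grid) \sum_pi h (S pi c)).
  apply: eq_bigr => c _; rewrite (reindex_inj (inv_inj (TK c))).
  by apply: eq_bigr => pi _; rewrite ST.
rewrite exchange_big/= mulr_natl -sumr_const; apply: eq_bigr => pi _.
by rewrite [RHS](reindex_inj (Sinj pi)).
Qed.

Lemma sum_scr_ortho a a' j (l : 'I_K) h h' :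
  take l (a j) != take l (a' j) ->
  (forall c, \sum_e h (upd c j (set_digit l e (c j))) = 0) ->
  \sum_pi h (scr pi a) * h' (scr pi a') = 0.
Proof.
(* The permutation at [key a j l] acts on digit [l] of [a] and is not used by [a']. *)
move=> aa' h0; set q0 := key a j l; set x := tnth (a j) l.
pose T e pi : fam := [ffun q => if q == q0 then (tperm x e * pi q)%g else pi q].
have TK e : involutive (T e).
  move=> pi; apply/ffunP => q; rewrite !ffunE; case: (q == q0) => //.
  by rewrite mulgA tperm2 mul1g.
have Ta' e pi : scr (T e pi) a' = scr pi a'.
  apply/ffunP => i; apply: eq_from_tnth => k; rewrite !tnth_scr ffunE ifN//.
  apply: contra aa' => /eqP kq.
  have ij : i = j by have := congr1 fst kq.
  move/(congr1 (fun q => val q.2)) : kq; rewrite /q0 !val_key ij => E.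
  have := congr1 size E; rewrite !size_take !size_tuple !ltn_ord => kl.
  by rewrite -E kl.
have Ta e pi : scr (T e pi) a = upd (scr pi a) j (set_digit l (pi q0 e) (scr pi a j)).
  apply/ffunP => i; apply: eq_from_tnth => k; rewrite tnth_scr ffunE [in RHS]ffunE.
  case: ifPn => [/eqP kq|kq].
    have ij : i = j by have := congr1 fst kq.
    move/(congr1 (fun q => val q.2)) : kq; rewrite /q0 !val_key ij => E.
    have := congr1 size E; rewrite !size_take !size_tuple !ltn_ord => kl.
    have {}kl : k = l by exact: val_inj.
    by rewrite eqxx tnth_set_digit kl eqxx permM tpermL.
  case: eqVneq => [ij|ij]; last by rewrite tnth_scr.
  rewrite tnth_set_digit; case: eqVneq => [kl|_]; last by rewrite ij tnth_scr.
  by rewrite ij kl /q0 eqxx in kq.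
have : #|A|%:R * \sum_pi h (scr pi a) * h' (scr pi a') = 0.
  rewrite mulr_natl -sumr_const.
  rewrite (eq_bigr (fun e => \sum_pi
    h (upd (scr pi a) j (set_digit l (pi q0 e) (scr pi a j))) * h' (scr pi a'))).
    rewrite exchange_big/= big1// => pi _; rewrite -mulr_suml.
    have := h0 (scr pi a); rewrite (reindex_inj (@perm_inj _ (pi q0))) => ->.
    by rewrite mul0r.
  move=> e _; rewrite (reindex_inj (inv_inj (TK e))).
  by apply: eq_bigr => pi _; rewrite Ta Ta'.
by move=> /eqP; rewrite mulf_eq0 pnatr_eq0 -(negbK (_ == 0%N)) -lt0n A0/= => /eqP.
Qed.

Variables (I : finType) (p : I -> grid).

(** In terms of digits, an elementary interval is a class of points with prescribed prefixes of
    lengths [kap j], given here by a member [e]. *)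
Definition balanced (kap : 'I_d -> nat) (B : nat) : Prop :=
  forall e : grid, #|[pred i | [forall j, take (kap j) (p i j) == take (kap j) (e j)]]| = B.

(** A scrambling permutes the cells of level [kap], so each of them still holds [B] points, and a
    function constant on these cells is integrated exactly. *)
Lemma sum_scr_balanced pi kap B h : balanced kap B ->
  (forall c c', (forall j, take (kap j) (c j) = take (kap j) (c' j)) -> h c = h c') ->
  \sum_c h c = 0 -> \sum_i h (scr pi (p i)) = 0.
Proof.
move=> pB hk h0.
pose w (c c' : grid) : R := \prod_j cellk R (kap j) (c j) (c' j).
have w1 c : \sum_c' w c c' = 1.
  rewrite -(bigA_distr_bigA (fun j (x : K.-tuple A) => cellk R (kap j) (c j) x)).
  by rewrite big1// => j _; rewrite sum_cellk.
have wE c c' : w c c' = (\prod_j (#|A| ^ (K - kap j))%:R^-1) *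
    [forall j, take (kap j) (c j) == take (kap j) (c' j)]%:R.
  rewrite /w big_split/=; congr (_ * _).
  case: (boolP [forall j, _]) => [/forallP H|].
    by rewrite big1// => j _; rewrite H.
  by rewrite negb_forall => /existsP[j /negbTE Hj]; rewrite (bigD1 j)//= Hj mul0r.
transitivity (\sum_i \sum_c w (scr pi (p i)) c * h c).
  apply: eq_bigr => i _; rewrite -[LHS]mul1r -(w1 (scr pi (p i))) mulr_suml.
  apply: eq_bigr => c _; rewrite wE.
  case: (boolP [forall j, _]) => [/forallP H|]; last by rewrite mulr0 !mul0r.
  by congr (_ * _); apply: hk => j; apply/eqP.
rewrite exchange_big/=; under eq_bigr do rewrite -mulr_suml.
rewrite (eq_bigr (fun c => (\prod_j (#|A| ^ (K - kap j))%:R^-1 * B%:R) * h c)).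
  by rewrite -mulr_sumr h0 mulr0.
move=> c _; congr (_ * _).
have [e <-] : exists e, scr pi e = c.
  by have [f _ fK] := injF_bij (@scr_inj pi); exists (f c).
rewrite (eq_bigr _ (fun i _ => wE (scr pi (p i)) (scr pi e))).
rewrite -mulr_sumr -(pB e) natr_card_pred; congr (_ * _).
by apply: eq_bigr => i _; rewrite (eq_forallb (fun j => eq_take_scr pi (p i) e j (kap j))).
Qed.

Lemma sum_scr_sqr_le (kap : 'I_d -> nat) (B : nat) h :
  (forall j, (kap j <= K)%N) ->
  (forall i, #|[pred i' | [forall j,
     take (kap j).-1 (p i j) == take (kap j).-1 (p i' j)]]| <= B)%N ->
  (forall c j (l : 'I_K), kap j = l.+1 -> \sum_e h (upd c j (set_digit l e (c j))) = 0) ->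
  #|{: grid}|%:R * \sum_pi (\sum_i h (scr pi (p i))) ^+ 2 <=
  #|{: fam}|%:R * (#|I| * B)%:R * \sum_c h c ^+ 2.
Proof.
move=> kK cnt h0.
pose close i i' := [forall j, take (kap j).-1 (p i j) == take (kap j).-1 (p i' j)].
have -> : \sum_pi (\sum_i h (scr pi (p i))) ^+ 2 =
    \sum_i \sum_(i' | close i i') \sum_pi h (scr pi (p i)) * h (scr pi (p i')).
  under eq_bigr do rewrite expr2 mulr_suml; rewrite exchange_big/=.
  apply: eq_bigr => i _; under eq_bigr do rewrite mulr_sumr; rewrite exchange_big/=.
  rewrite [RHS]big_mkcond/=; apply: eq_bigr => i' _; case: ifPn => //.
  rewrite negb_forall => /existsP[j aj].
  have k0 : (0 < kap j)%N by case: (kap j) aj => //=; rewrite !take0 eqxx.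
  have lK : ((kap j).-1 < K)%N by rewrite prednK.
  apply: (@sum_scr_ortho _ _ j (Ordinal lK)) => // c.
  by apply: h0; rewrite /= prednK.
(* A single scrambled point is uniform, so for every [a], [V] is the number of grid points times the
   sum over [pi] of [h (scr pi a) ^+ 2]; close pairs are then handled by [2 x y <= x^2 + y^2]. *)
set V := #|{: fam}|%:R * \sum_c h c ^+ 2.
have V0 : 0 <= V by rewrite mulr_ge0// sumr_ge0// => c _; exact: sqr_ge0.
rewrite [leRHS](_ : _ = \sum_(i : I) B%:R * V); last first.
  by rewrite sumr_cst /V natrM; ring.
rewrite mulr_sumr; apply: ler_sum => i _; rewrite mulr_sumr.
apply: (@le_trans _ _ (\sum_(i' | close i i') V)).
  apply: ler_sum => i' _.
  have -> : V = 2^-1 * (V + V) by field.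
  rewrite {1}/V -(sum_scr (p i) (fun c => h c ^+ 2)) /V -(sum_scr (p i') (fun c => h c ^+ 2)).
  rewrite -mulrDr mulrCA ler_wpM2l// -big_split/= mulr_sumr; apply: ler_sum => pi _.
  have := sqr_ge0 (h (scr pi (p i)) - h (scr pi (p i'))); rewrite sqrrB; lra.
by rewrite sumr_const -[leLHS]mulr_natl ler_wpM2r// ler_nat cnt.
Qed.

Lemma card_close_le (q kap : 'I_d -> nat) (B : nat) (i : I) : balanced kap B ->
  (forall j, (kap j <= (q j).+1)%N) ->
  (#|[pred i' | [forall j, take (q j) (p i j) == take (q j) (p i' j)]]| <= #|A| ^ d * B)%N.
Proof.
(* The first [kap j] digits are determined by the first [q j] ones and one more. *)
move=> pB kq.
pose E (f : {ffun 'I_d -> A}) : grid := [ffun j =>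
  if (insub (q j) : option 'I_K) is Some l then set_digit l (f j) (p i j) else p i j].
rewrite -sum1_card.
apply: (@leq_trans (\sum_i' \sum_(f : {ffun 'I_d -> A})
  [forall j, take (kap j) (p i' j) == take (kap j) (E f j)])).
  rewrite big_mkcond/=; apply: leq_sum => i' _; case: ifPn => //.
  rewrite inE => /forallP ii'.
  (* A filler for the coordinates with [q j >= K]: there the prefix is the whole coordinate, and [E]
     keeps that of [p i]. *)
  have [x0 _] : exists x0 : A, true by case/card_gt0P : A0 => x0; exists x0.
  pose f : {ffun 'I_d -> A} := [ffun j =>
    if (insub (q j) : option 'I_K) is Some l then tnth (p i' j) l else x0].
  rewrite (bigD1 f)//= [X in (_ <= nat_of_bool X + _)%N](_ : _ = true)//.
  apply/forallP => j; rewrite ffunE.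
  have := ii' j; case: insubP => [l _ lq|]; last first.
    rewrite -leqNgt => Kq; move=> /eqP E'; rewrite (_ : p i' j = p i j) ?eqxx//.
    by apply/val_inj; move: E'; rewrite !take_oversize ?size_tuple.
  move=> /eqP ij; apply/eqP/(eq_take_leq (kq j))/eqP; rewrite -lq eq_sym.
  by rewrite eq_take_set_digit lq ij eqxx ffunE -lq valK eqxx.
rewrite exchange_big/=.
rewrite (eq_bigr (fun _ => B)) => [|f _].
  by rewrite sum_nat_const card_ffun card_ord.
rewrite -(pB (E f)) -sum1_card [RHS]big_mkcond/=; apply: eq_bigr => i' _.
by rewrite -topredE/=; case: [forall j, _].
Qed.

End finite_scrambling.

(** * Haar coefficients and mixed partial derivatives *)

Section directional_derivatives.
Variable R : realType.

(** A directional derivative depends only on the restriction to a line, so it can be moved between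
    spaces along a common parametrisation. *)
Lemma is_derive_line (V U : normedModType R) (F : V -> R) (G : U -> R) a v x u (D : R) :
  (forall h : R, F (h *: v + a) = G (h *: u + x)) ->
  is_derive a v F D -> is_derive x u G D.
Proof.
move=> FG [Fd FD]; have Fa : F a = G x by have := FG 0; rewrite !scale0r !add0r.
have E : (fun h : R => h^-1 *: ((F \o shift a) (h *: v) - F a)) =
         (fun h : R => h^-1 *: ((G \o shift x) (h *: u) - G x)).
  by apply/funext => h; rewrite /= FG Fa.
by split; rewrite /derivable /derive -E.
Qed.

Lemma is_derive_sum_fin (V : normedModType R) (D : finType) (h : D -> V -> R)
    (dh : D -> R) (x v : V) : (forall y, is_derive x v (h y) (dh y)) ->
  is_derive x v (fun z => \sum_y h y z) (\sum_y dh y).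
Proof.
move=> hd; elim: index_enum => [|y s IH].
  rewrite big_nil [X in is_derive _ _ X](_ : _ = cst 0); first exact: is_derive_cst.
  by apply/funext => z; rewrite big_nil.
rewrite big_cons [X in is_derive _ _ X](_ : _ = h y + (fun z => \sum_(y <- s) h y z)).
  exact: is_deriveD.
by apply/funext => z; rewrite big_cons.
Qed.

(** Both [C * P - g] and [C * P + g] have a nonnegative derivative, hence are nondecreasing. *)
Lemma derive_dominated (g dg P dP : R -> R) (C x y : R) : 0 <= C ->
  (forall t : R, is_derive t (1 : R) g (dg t)) -> (forall t : R, is_derive t (1 : R) P (dP t)) ->
  (forall t, `|dg t| <= C * dP t) -> `|g x - g y| <= C * `|P x - P y|.
Proof.
move=> C0 hg hP gP.
wlog yx : x y / y <= x.
  move=> H; have [|/ltW] := leP y x; first exact: H.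
  by rewrite distrC (distrC (P x)); exact: H.
have key (e : R) : `|e| <= 1 -> 0 <= (C * P x - e * g x) - (C * P y - e * g y).
  move=> e1.
  have hd (t : R) : is_derive t (1 : R) (fun t => C * P t - e * g t) (C * dP t - e * dg t).
    exact: is_deriveB.
  have [|c _ ->] := @MVT_segment R (fun t => C * P t - e * g t)
    (fun t => C * dP t - e * dg t) y x yx.
    apply: derivable_within_continuous => t _; exact: ex_derive.
  rewrite mulr_ge0 ?subr_ge0// (le_trans _ (gP c))//.
  rewrite (le_trans (ler_norm _))// normrM ler_piMl//.
have k1 : 0 <= (C * P x - 1 * g x) - (C * P y - 1 * g y).
  by apply: key; rewrite normr1.
have k2 : 0 <= (C * P x - (- 1) * g x) - (C * P y - (- 1) * g y).
  by apply: key; rewrite normrN1.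
have Cle : C * (P x - P y) <= C * `|P x - P y| by rewrite ler_wpM2l// ler_norm.
by rewrite ler_norml; apply/andP; split; lra.
Qed.

End directional_derivatives.

(** * Functionals applied one coordinate at a time *)

Section iterated_functionals.
Variables (R : realType) (d : nat) (D : finType) (mu : 'I_d -> D -> R) (pt : D -> R).
Implicit Types (F : 'cV[R]_d -> R) (z : 'cV[R]_d) (j : 'I_d) (s l : seq 'I_d).

Definition set_coord z j (x : R) : 'cV[R]_d :=
  \col_i (if i == j then x else z i ord0).

Definition apply_coord j F : 'cV[R]_d -> R :=
  fun z => \sum_y mu j y * F (set_coord z j (pt y)).

Definition apply_coords l F := foldl (fun F j => apply_coord j F) F l.

Fixpoint partially_derivable s F : Prop :=
  if s is j :: s' then
    (forall z, derivable (partials s' F) z (delta_mx j ord0)) /\ partially_derivable s' F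
  else True.

Lemma is_derive_set_coord F z i j p : i != j ->
  derivable F (set_coord z j p) (delta_mx i ord0) ->
  is_derive z (delta_mx i ord0) (fun z => F (set_coord z j p))
    ('D_(delta_mx i ord0) F (set_coord z j p)).
Proof.
move=> ij /derivableP; apply: is_derive_line => h; congr F.
apply/colP => k; rewrite !mxE; case: (eqVneq k j) => [->|//].
by rewrite eq_sym (negbTE ij) mulr0 add0r.
Qed.

Lemma is_derive_apply_coord F z i j : i != j ->
  (forall z, derivable F z (delta_mx i ord0)) ->
  is_derive z (delta_mx i ord0) (apply_coord j F)
    (apply_coord j (fun z => 'D_(delta_mx i ord0) F z) z).
Proof.
move=> ij Fd; apply: is_derive_sum_fin => y.
exact: is_deriveZ (is_derive_set_coord ij (Fd _)).
Qed.

Lemma partials_apply_coord s F j : j \notin s -> partially_derivable s F ->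
  partials s (apply_coord j F) = apply_coord j (partials s F) /\
  partially_derivable s (apply_coord j F).
Proof.
elim: s => [//|i s IH]; rewrite inE negb_or eq_sym => /andP[ij js] [Fd Fs].
have [E1 E2] := IH js Fs; split => /=; last first.
  by split => // z; rewrite E1; have [] := @is_derive_apply_coord _ z _ _ ij Fd.
apply/funext => z; rewrite -/(partials s _) E1 -/(partials s F).
by have [] := @is_derive_apply_coord _ z _ _ ij Fd.
Qed.

Lemma is_derive_coord_line F z j x :
  derivable F (set_coord z j x) (delta_mx j ord0) ->
  is_derive x (1 : R) (fun t => F (set_coord z j t)) ('D_(delta_mx j ord0) F (set_coord z j x)).
Proof.
move=> /derivableP; apply: is_derive_line => h; congr F.
apply/colP => k; rewrite !mxE; case: (eqVneq k j) => _ /=; first by rewrite /GRing.scale/= ?eqxx.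
by rewrite mulr0 add0r.
Qed.

Variables (P dP w : R -> R) (v : pred 'I_d) (q lam : 'I_d -> R).
Hypothesis P_derive : forall t : R, is_derive t (1 : R) P (dP t).
Hypothesis dP_ge0 : forall t, 0 <= dP t.
Hypothesis w_ge0 : forall t, 0 <= w t.
Hypothesis mu0 : forall j, v j -> \sum_y mu j y = 0.
Hypothesis lam1 : forall j, v j -> \sum_y `|mu j y| * `|P (pt y) - P (q j)| <= lam j.
Hypothesis lam0 : forall j, ~~ v j -> \sum_y `|mu j y| * w (pt y) <= lam j.

(** The coordinates contribute their factors [lam j] in turn. For [j] in [v] the total mass of
    [mu j] is zero, so the value at [q j] may be subtracted and the difference bounded through the
    derivative in that coordinate. The head of [l] is both the first coordinate integrated and the
    outermost derivative, so derivatives are never interchanged. *)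
Lemma apply_coords_le l F (C : R) : uniq l -> 0 <= C ->
  partially_derivable (seq.filter v l) F ->
  (forall z, `|partials (seq.filter v l) F z| <=
     C * \prod_(j <- l) (if v j then dP (z j ord0) else w (z j ord0))) ->
  forall z, `|apply_coords l F z| <= C * \prod_(j <- l) lam j.
Proof.
elim: l F C => [|j l IH] F C; first by move=> _ _ _ H z; have := H z; rewrite !big_nil.
rewrite [uniq _]/= => /andP[jl ul] C0 Fd FC z.
have lamj0 : 0 <= lam j.
  have [vj|vj] := boolP (v j); [apply: le_trans (lam1 vj)|apply: le_trans (lam0 vj)];
    by apply: sumr_ge0 => y _; rewrite mulr_ge0.
rewrite big_cons mulrA /apply_coords /=; apply: IH => //.
- exact: mulr_ge0.
- have jl' : j \notin seq.filter v l by rewrite mem_filter (negbTE jl) andbF.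
  move: Fd => /=; case: (v j) => [[_]|] Fs; by have [] := partials_apply_coord jl' Fs.
move=> {}z; have jl' : j \notin seq.filter v l by rewrite mem_filter (negbTE jl) andbF.
set rest := \prod_(i <- l) _.
have rest0 : 0 <= rest by apply: prodr_ge0 => i _; case: ifP.
have restE t : \prod_(i <- l) (if v i then dP (set_coord z j t i ord0)
     else w (set_coord z j t i ord0)) = rest.
  apply: eq_big_seq => i il; rewrite !mxE (_ : (i == j) = false)//.
  by apply/eqP => ij; move: jl; rewrite -ij il.
have at_j t : set_coord z j t j ord0 = t by rewrite mxE eqxx.
have [vj|vj] := boolP (v j).
  move: Fd FC; rewrite /= vj => -[Fd Fs] FC.
  have [-> _] := partials_apply_coord jl' Fs.
  have -> : apply_coord j (partials (seq.filter v l) F) z =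
      \sum_y mu j y * (partials (seq.filter v l) F (set_coord z j (pt y)) -
                       partials (seq.filter v l) F (set_coord z j (q j))).
    under [RHS]eq_bigr do rewrite mulrBr.
    by rewrite sumrB -mulr_suml mu0// mul0r subr0.
  apply: le_trans (ler_norm_sum _ _ _) _.
  rewrite mulrAC; apply: (@le_trans _ _ (C * rest *
      \sum_y `|mu j y| * `|P (pt y) - P (q j)|)); last first.
    by rewrite ler_wpM2l ?lam1// mulr_ge0.
  rewrite mulr_sumr; apply: ler_sum => y _; rewrite normrM mulrCA ler_wpM2l//.
  apply: (@derive_dominated R (fun t => partials (seq.filter v l) F (set_coord z j t))
    (fun t => 'D_(delta_mx j ord0) (partials (seq.filter v l) F) (set_coord z j t))
    P dP (C * rest) (pt y) (q j)) => //.
  - exact: mulr_ge0.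
  - by move=> t; exact: is_derive_coord_line.
  - move=> t; have := FC (set_coord z j t).
    by rewrite big_cons vj restE at_j mulrCA mulrC.
move: Fd FC; rewrite /= (negbTE vj) => Fs FC.
have [-> _] := partials_apply_coord jl' Fs.
apply: le_trans (ler_norm_sum _ _ _) _.
rewrite mulrAC; apply: (@le_trans _ _ (C * rest *
    \sum_y `|mu j y| * w (pt y))); last first.
  by rewrite ler_wpM2l ?lam0// mulr_ge0.
rewrite mulr_sumr; apply: ler_sum => y _; rewrite normrM mulrCA ler_wpM2l//.
by have := FC (set_coord z j (pt y)); rewrite big_cons (negbTE vj) restE at_j mulrCA mulrC.
Qed.

End iterated_functionals.

Section functional_expansion.
Variables (R : realType) (d : nat) (D : finType) (mu : 'I_d -> D -> R) (pt : D -> R).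
Implicit Types (F : 'cV[R]_d -> R) (z : 'cV[R]_d) (j : 'I_d) (l : seq 'I_d).
Local Notation grid := {ffun 'I_d -> D}.

Let put (c : grid) j y : grid := [ffun i => if i == j then y else c i].

Let sum_put (G : grid -> R) j y0 :
  \sum_c G c = \sum_(c : grid | c j == y0) \sum_y G (put c j y).
Proof.
rewrite exchange_big/= (partition_big (fun c : grid => c j) xpredT)//=.
apply: eq_bigr => y _.
rewrite (reindex_onto (fun c => put c j y) (fun c => put c j y0))/=.
  apply: eq_bigl => c; rewrite ffunE eqxx eqxx/=.
  apply/eqP/eqP => [<-|cj]; first by rewrite ffunE eqxx.
  by apply/ffunP => i; rewrite !ffunE; case: eqVneq => // ->.
move=> c /eqP cj; apply/ffunP => i; rewrite !ffunE; case: eqVneq => // ->.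
by rewrite cj.
Qed.

(** The factor [c j == y0] pins the coordinates outside [l], so that all stages of the induction sum
    over the same grid. *)
Lemma apply_coordsE l F z (y0 : D) : uniq l ->
  apply_coords mu pt l F z =
  \sum_(c : grid) (\prod_j (if j \in l then mu j (c j) else (c j == y0)%:R)) *
     F (\col_j (if j \in l then pt (c j) else z j ord0)).
Proof.
elim: l F => [|j l IH] F.
  move=> _; rewrite (bigD1 [ffun=> y0])//= [X in _ + X]big1 => [|c cy].
    rewrite addr0 big1 ?mul1r => [|j _]; last by rewrite ffunE eqxx.
    by congr F; apply/colP => j; rewrite mxE.
  suff [j cj] : exists j, c j != y0 by rewrite (bigD1 j)//= (negbTE cj) !mul0r.
  apply/existsP; apply: contraNT cy; rewrite negb_exists => /forallP cy.
  by apply/eqP/ffunP => j; rewrite ffunE; have := cy j; rewrite negbK => /eqP.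
rewrite [uniq _]/= => /andP[jl ul]; rewrite [LHS]IH//.
rewrite [RHS](sum_put _ j y0) [LHS](bigID (fun c : grid => c j == y0))/=.
rewrite [X in _ + X]big1 ?addr0 => [|c cj]; last first.
  by rewrite (bigD1 j)//= (negbTE jl) (negbTE cj) !mul0r.
apply: eq_bigr => c /eqP cj; rewrite mulr_sumr; apply: eq_bigr => y _.
rewrite mulrA; congr (_ * F _); last first.
  by apply/colP => i; rewrite !mxE ffunE inE; case: eqVneq.
rewrite (bigD1 j)//= (negbTE jl) cj eqxx mul1r mulrC.
rewrite [RHS](bigD1 j)//= mem_head ffunE eqxx; congr (_ * _).
by apply: eq_bigr => i ij; rewrite inE (negbTE ij)/= ffunE (negbTE ij).
Qed.

End functional_expansion.

Section haar_coefficient_bound.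
Variables (R : realType) (A : finType) (K d : nat) (pt : K.-tuple A -> R).
Hypothesis A0 : (0 < #|A|)%N.
Variables (P dP w : R -> R) (H : 'cV[R]_d -> R) (C : R).
Hypothesis P_derive : forall t : R, is_derive t (1 : R) P (dP t).
Hypothesis dP_ge0 : forall t, 0 <= dP t.
Hypothesis w_ge0 : forall t, 0 <= w t.
Hypothesis C_ge0 : 0 <= C.

(** The one-dimensional factor in the bound of a component. For [k > 0] the two cell kernels bound
    the absolute value of [haark k], and [P (pt x)] is the reference value subtracted thanks to mean
    zero. *)
Definition haar_weight (k : nat) (x : K.-tuple A) : R :=
  if k is 0 then \sum_y cellk R 0 x y * w (pt y)
  else \sum_y (cellk R k x y + cellk R k.-1 x y) * `|P (pt y) - P (pt x)|.

Lemma normr_haar_le (kap : 'I_d -> nat) (c : {ffun 'I_d -> K.-tuple A}) :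
  let v := [pred j | (0 < kap j)%N] in
  partially_derivable (seq.filter v (enum 'I_d)) H ->
  (forall z, `|partials (seq.filter v (enum 'I_d)) H z| <=
     C * \prod_j (if v j then dP (z j ord0) else w (z j ord0))) ->
  `|haar (fun c => H (\col_j pt (c j))) kap c| <= C * \prod_j haar_weight (kap j) (c j).
Proof.
move=> v Hd HC; pose mu (j : 'I_d) y : R := haark R (kap j) (c j) y.
have -> : haar (fun c => H (\col_j pt (c j))) kap c = apply_coords mu pt (enum 'I_d) H 0.
  (* [apply_coordsE] needs a digit string [y0]; it is taken from a coordinate of [c], which requires
     [0 < d]. *)
  have [d0|d0] := posnP d.
    have E : enum 'I_d = [::] by apply: size0nil; rewrite size_enum_ord d0.
    have nd (j : 'I_d) : False by have := ltn_ord j; rewrite [X in (_ < X)%N]d0.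
    rewrite E /apply_coords /= /haar (bigD1 c)//= [X in _ + X]big1 => [|c' cc']; last first.
      exfalso; move: cc'; rewrite (_ : c' = c) ?eqxx//.
      by apply/ffunP => j; have := nd j.
    rewrite addr0 big1 ?mul1r => [|j _]; last by have := nd j.
    by congr H; apply/colP => j; have := nd j.
  rewrite (@apply_coordsE _ _ _ _ _ _ _ _ (c (Ordinal d0)))// ?enum_uniq//.
  apply: eq_bigr => c' _; congr (_ * H _).
    by apply: eq_bigr => j _; rewrite mem_enum.
  by apply/colP => j; rewrite !mxE mem_enum.
have := @apply_coords_le R d _ mu pt P dP w v (fun j => pt (c j))
  (fun j => haar_weight (kap j) (c j)) P_derive dP_ge0 w_ge0.
have big_enum0 (f : 'I_d -> R) : \prod_(j <- enum 'I_d) f j = \prod_j f j.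
  by rewrite big_enum.
move=> /(_ _ _ _ (enum 'I_d) H C); rewrite big_enum0; apply => //.
- by move=> j /=; rewrite /mu; case: (kap j) => // k _; exact: sum_haark_eq0.
- move=> j /=; rewrite /mu /haar_weight; case: (kap j) => // k _.
  by apply: ler_sum => y _; rewrite ler_wpM2r ?normr_haark.
- move=> j /=; rewrite /mu /haar_weight; case: (kap j) => // _.
  by apply: ler_sum => y _; rewrite /= ger0_norm// cellk_ge0.
- exact: enum_uniq.
- by move=> z; rewrite big_enum0; exact: HC.
Qed.

End haar_coefficient_bound.

(** * Growth of the importance sampling integrand *)

Section rayleigh.
Variables (R : realType) (d : nat) (M : 'M[R]_d).
Implicit Types u v : 'rV[R]_d.

Let B (N : 'M[R]_d) u v : R := (u *m N *m v^T) ord0 ord0.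

Let BE N u v : B N u v = \sum_j (\sum_i u ord0 i * N i j) * v ord0 j.
Proof. by rewrite /B mxE; apply: eq_bigr => j _; rewrite !mxE. Qed.

Let continuous_B N : continuous (fun u => B N u u).
Proof.
have sum_cont (f : 'I_d -> 'rV[R]_d -> R) : (forall i, continuous (f i)) ->
    continuous (fun u => \sum_i f i u).
  move=> fc; elim: index_enum => [|i s IH].
    rewrite (_ : (fun u => _) = cst 0); first exact: cst_continuous.
    by apply/funext => u'; rewrite big_nil.
  rewrite (_ : (fun u => _) = (fun u => f i u + \sum_(k <- s) f k u)); last first.
    by apply/funext => u'; rewrite big_cons.
  by move=> u; exact: cvgD (fc i u) (IH u).
under eq_fun do rewrite BE.
have inner j : continuous (fun u => \sum_i u ord0 i * N i j).
  apply: (sum_cont (fun i u => u ord0 i * N i j)) => i u.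
  have c1 : continuous (fun u : 'rV[R]_d => u ord0 i) by exact: coord_continuous.
  have c2 : continuous (fun u : 'rV[R]_d => N i j) by exact: cst_continuous.
  exact: cvgM (c1 u) (c2 u).
apply: (sum_cont (fun j u => (\sum_i u ord0 i * N i j) * u ord0 j)) => j u.
have c1 : continuous (fun u : 'rV[R]_d => u ord0 j) by exact: coord_continuous.
exact: cvgM (inner j u) (c1 u).
Qed.

Let BD N u v t : N^T = N ->
  B N (u + t *: v) (u + t *: v) = B N u u + 2 * t * B N u v + t ^+ 2 * B N v v.
Proof.
move=> NT; have sym : B N v u = B N u v.
  have -> : B N v u = (v *m N *m u^T)^T ord0 ord0 by rewrite /B [RHS]mxE.
  by rewrite !trmx_mul trmxK NT mulmxA.
have E : B N (u + t *: v) (u + t *: v) = B N u u + t * B N u v + (t * B N v u + t * (t * B N v v)).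
  rewrite /B linearD/= linearZ/= mulmxDl mulmxDl mulmxDr mulmxDr.
  by rewrite -!scalemxAl -!scalemxAr !mxE; ring.
by rewrite E sym; ring.
Qed.

Lemma eigenvalue_ge1_quadratic : (0 < d)%N -> M^T = M ->
  (forall a, eigenvalue M a -> 1 <= a) ->
  forall z : 'cV[R]_d, (z^T *m z) ord0 ord0 <= (z^T *m M *m z) ord0 ord0.
Proof.
(* The minimum of the form on the unit sphere is attained at an eigenvector. *)
move=> d0 MT M1 z.
have B1 u v : B 1%:M u v = (u *m v^T) ord0 ord0 by rewrite /B mulmx1.
have sqE u : B 1%:M u u = \sum_i u ord0 i ^+ 2.
  by rewrite B1 mxE; apply: eq_bigr => i _; rewrite mxE expr2.
have sq_ge0 u : 0 <= B 1%:M u u by rewrite sqE sumr_ge0// => i _; exact: sqr_ge0.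
have sq_eq0 u : B 1%:M u u = 0 -> u = 0.
  rewrite sqE => /eqP; rewrite psumr_eq0 => [/allP h|i _]; last exact: sqr_ge0.
  by apply/rowP => i; rewrite mxE; apply/eqP; rewrite -sqrf_eq0; apply: h; rewrite mem_index_enum.
pose S := [set u | B 1%:M u u = 1].
have S0 : S !=set0.
  exists (delta_mx ord0 (Ordinal d0)); rewrite /S/= sqE (bigD1 (Ordinal d0))//= !mxE !eqxx expr1n.
  by rewrite big1 ?addr0// => i /negbTE id0; rewrite !mxE id0 andbF expr0n.
have cS : compact S.
  have := @rV_compact R d (fun=> `[(- 1), 1]%classic) (fun=> @segment_compact _ _ _).
  move=> cB; apply: (subclosed_compact _ cB).
    rewrite (_ : S = (fun u => B 1%:M u u) @^-1` [set 1])//.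
    apply: closed_comp; last exact: closed_eq.
    by move=> u _; exact: continuous_B.
  move=> u /= Su i; rewrite in_itv/= -ler_norml -ler_sqr ?nnegrE// expr1n real_normK ?num_real//.
  by rewrite -Su sqE (bigD1 i)//= lerDl sumr_ge0// => j _; exact: sqr_ge0.
have [c cS' cmin] := EVT_min_rV S0 cS (continuous_subspaceT (@continuous_B M)).
rewrite inE in cS'; set a := B M c c.
have quad u : a * B 1%:M u u <= B M u u.
  have [u0|u0] := eqVneq (B 1%:M u u) 0.
    by rewrite (sq_eq0 _ u0) /B !mul0mx !mxE mulr0.
  have n0 : 0 < B 1%:M u u by rewrite lt_neqAle eq_sym u0 sq_ge0.
  set r := (Num.sqrt (B 1%:M u u))^-1.
  have r2 : r ^+ 2 = (B 1%:M u u)^-1 by rewrite exprVn sqr_sqrtr.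
  have BZ N : B N (r *: u) (r *: u) = r ^+ 2 * B N u u.
    by rewrite /B linearZ/= -!scalemxAl -!scalemxAr !mxE; ring.
  have := cmin (r *: u); rewrite inE /S/= !BZ r2 mulVf// => /(_ erefl).
  by rewrite ler_pdivlMl// mulrC.
pose N := M - a%:M.
have NT : N^T = N by rewrite /N linearB/= MT tr_scalar_mx.
have BN u v : B N u v = B M u v - a * B 1%:M u v.
  by rewrite B1 /B /N mulmxBr mulmxBl mul_mx_scalar -scalemxAl !mxE.
(* [N] is a nonnegative form vanishing at [c]. If [w = c *m N] were nonzero, moving from [c] along
   [- w] would make the form negative; [k] bounds the second-order term, so the step [p / k] is
   short enough. *)
have cN : c *m N = 0.
  pose w := c *m N; set p := B 1%:M w w.
  have pE : B N c w = p by rewrite /p B1.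
  have p0 : 0 <= p by exact: sq_ge0.
  apply: sq_eq0; apply/eqP; rewrite -/w -/p; apply: contraT => pn0.
  have {}p0 : 0 < p by rewrite lt_neqAle eq_sym pn0.
  set k := `|B N w w| + 1.
  have k0 : 0 < k by rewrite ltr_wpDl.
  have := quad (c + (- (p / k)) *: w); rewrite -subr_ge0 -BN BD// pE.
  have -> : B N c c = 0 by rewrite BN (cS' : B 1%:M c c = 1) mulr1 subrr.
  have : B N w w <= k by rewrite /k (le_trans (ler_norm _))// lerDl.
  move: (B N w w) => bb bk.
  have x0 : 0 < p / k by rewrite divr_gt0.
  have xk : p = (p / k) * k by rewrite mulfVK// gt_eqF.
  move: (p / k) x0 xk => x x0 ->; rewrite add0r => h.
  have : x ^+ 2 * bb <= x ^+ 2 * k by rewrite ler_pM2l// exprn_gt0.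
  have : 0 < x ^+ 2 * k by rewrite mulr_gt0// exprn_gt0.
  move: h; rewrite sqrrN !expr2; nra.
have a1 : 1 <= a.
  apply: M1; apply/eigenvalueP; exists c.
    by apply/eqP; rewrite -subr_eq0 -mul_mx_scalar -mulmxBr -/N cN.
  apply/eqP => c0; have : B 1%:M c c = 1 by [].
  by rewrite c0 B1 mul0mx mxE => /esym/eqP; rewrite oner_eq0.
have := quad z^T; rewrite B1 /B trmxK; apply: le_trans.
by rewrite ler_peMl// -[X in _ *m X]trmxK -B1.
Qed.

End rayleigh.

(** * Mixed derivatives of a product with an exponential weight *)

Section growth_of_importance_integrand.
Variables (R : realType) (d : nat).
Implicit Types (z : 'cV[R]_d) (F P : 'cV[R]_d -> R) (beta : R) (s : seq 'I_d).

Definition gauss_growth beta z : R := \prod_j expR (beta * z j ord0 ^+ 2).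

Lemma gauss_growth_gt0 beta z : 0 < gauss_growth beta z.
Proof. by apply: prodr_gt0 => j _; exact: expR_gt0. Qed.

Lemma gauss_growthD b1 b2 z :
  gauss_growth (b1 + b2) z = gauss_growth b1 z * gauss_growth b2 z.
Proof.
by rewrite /gauss_growth -big_split/=; apply: eq_bigr => j _; rewrite mulrDl expRD.
Qed.

Lemma gauss_growth_coord beta z j : 0 <= beta ->
  expR (beta * z j ord0 ^+ 2) <= gauss_growth beta z.
Proof.
move=> b0; rewrite /gauss_growth (bigD1 j)//= ler_peMr ?expR_ge0//.
elim/big_ind : _ => // [x y x1 y1|i _]; first by rewrite mulr_ege1.
by rewrite -expR0 ler_expR mulr_ge0// sqr_ge0.
Qed.

Lemma gauss_growth_ge1 beta z : 0 <= beta -> 1 <= gauss_growth beta z.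
Proof.
move=> b0; rewrite /gauss_growth.
elim/big_ind : _ => // [x y x1 y1|i _]; first by rewrite mulr_ege1.
by rewrite -expR0 ler_expR mulr_ge0// sqr_ge0.
Qed.

(** Growth below [exp (beta |z|^2)] for every [beta > 0]. As [beta] is arbitrary, the class is
    closed under products: each factor takes [beta / 2]. *)
Definition subgaussian F : Prop :=
  forall beta, 0 < beta -> exists2 C : R, 0 <= C & forall z, `|F z| <= C * gauss_growth beta z.

Lemma subgaussianD F P : subgaussian F -> subgaussian P -> subgaussian (fun z => F z + P z).
Proof.
move=> hF hP b b0; have [C C0 HC] := hF b b0; have [C' C'0 HC'] := hP b b0.
exists (C + C'); first exact: addr_ge0.
by move=> z; rewrite mulrDl (le_trans (ler_normD _ _))// lerD.
Qed.

Lemma subgaussianM F P : subgaussian F -> subgaussian P -> subgaussian (fun z => F z * P z).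
Proof.
move=> hF hP b b0; have b20 : 0 < b / 2 by rewrite divr_gt0.
have [C C0 HC] := hF _ b20; have [C' C'0 HC'] := hP _ b20.
exists (C * C'); first exact: mulr_ge0.
move=> z; have -> : b = b / 2 + b / 2 by field.
by rewrite gauss_growthD normrM mulrACA ler_pM.
Qed.

(** Inductive, so that continuity, growth and closure under derivatives follow by induction; it
    covers the exponent of the weight and the factors that exponent produces under
    differentiation. *)
Inductive polynomial_fun : ('cV[R]_d -> R) -> Prop :=
| poly_cst c : polynomial_fun (fun=> c)
| poly_coord i : polynomial_fun (fun z => z i ord0)
| poly_add P Q : polynomial_fun P -> polynomial_fun Q -> polynomial_fun (fun z => P z + Q z)
| poly_mul P Q : polynomial_fun P -> polynomial_fun Q -> polynomial_fun (fun z => P z * Q z).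

Lemma poly_sum (I : finType) (P : I -> 'cV[R]_d -> R) :
  (forall i, polynomial_fun (P i)) -> polynomial_fun (fun z => \sum_i P i z).
Proof.
move=> hP; elim: index_enum => [|i s IH].
  by under eq_fun do rewrite big_nil; exact: poly_cst.
by under eq_fun do rewrite big_cons; exact: poly_add.
Qed.

Lemma poly_continuous P : polynomial_fun P -> continuous P.
Proof.
elim=> [c|i|P1 P2 _ h1 _ h2|P1 P2 _ h1 _ h2] z.
- exact: cst_continuous.
- exact: coord_continuous.
- exact: cvgD (h1 z) (h2 z).
- exact: cvgM (h1 z) (h2 z).
Qed.

Lemma poly_subgaussian P : polynomial_fun P -> subgaussian P.
Proof.
elim=> [c|i|P1 P2 _ h1 _ h2|P1 P2 _ h1 _ h2].
- move=> b b0; exists `|c| => // z; rewrite ler_peMr//.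
  by rewrite gauss_growth_ge1// ltW.
- move=> b b0; exists (1 + b^-1); first by rewrite addr_ge0// invr_ge0 ltW.
  move=> z; apply: le_trans (ler_wpM2l _ (gauss_growth_coord z i (ltW b0))); last first.
    by rewrite addr_ge0// invr_ge0 ltW.
  apply: le_trans (ler_wpM2l _ (expR_ge1Dx _)); last by rewrite addr_ge0// invr_ge0 ltW.
  have bi0 : 0 < b^-1 by rewrite invr_gt0.
  have -> : (1 + b^-1) * (1 + b * z i ord0 ^+ 2) =
      1 + b * z i ord0 ^+ 2 + b^-1 + z i ord0 ^+ 2 by field; rewrite gt_eqF.
  have := real_normK (num_real (z i ord0)); move: `|_| => x <-.
  have : 0 <= b * x ^+ 2 by rewrite mulr_ge0 ?sqr_ge0 ?ltW.
  have := sqr_ge0 (x - 1 / 2); rewrite !expr2; lra.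
- exact: subgaussianD.
- exact: subgaussianM.
Qed.

Lemma poly_derive P j : polynomial_fun P ->
  exists2 P', polynomial_fun P' & forall z, is_derive z (delta_mx j ord0) P (P' z).
Proof.
elim=> [c|i|P1 P2 h1 [Q1 k1 H1] h2 [Q2 k2 H2]|P1 P2 h1 [Q1 k1 H1] h2 [Q2 k2 H2]].
- by exists (fun=> 0); [exact: poly_cst|move=> z; exact: is_derive_cst].
- exists (fun=> (i == j)%:R); first exact: poly_cst.
  move=> z; have := is_derive_id (z i ord0) ((i == j)%:R : R).
  apply: is_derive_line => h /=.
  by rewrite !mxE andbT.
- by exists (fun z => Q1 z + Q2 z); [exact: poly_add|move=> z; exact: is_deriveD].
- exists (fun z => P1 z * Q2 z + P2 z * Q1 z); first by apply: poly_add; exact: poly_mul.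
  by move=> z; exact: is_deriveM.
Qed.

Variables (G W Q : 'cV[R]_d -> R) (cW : R).
Hypothesis G_smooth : mixed_smooth G.
Hypothesis G_growth : forall v : {set 'I_d}, subgaussian (mixed_partial v G).
Hypothesis Q_poly : polynomial_fun Q.
Hypothesis WE : forall z, W z = cW * expR (Q z).
Hypothesis W_growth : subgaussian W.

(* Functions of this form are closed under differentiation in the coordinates
   not yet in [s]; only increasing [s] occur, so no symmetry of mixed partial
   derivatives is needed. *)
Inductive leibniz s : ('cV[R]_d -> R) -> Prop :=
| leibniz_term P s' : subseq s' s -> polynomial_fun P ->
    leibniz s (fun z => P z * partials s' G z * W z)
| leibniz_add F1 F2 : leibniz s F1 -> leibniz s F2 -> leibniz s (fun z => F1 z + F2 z).

Let W_derive j : exists2 P', polynomial_fun P' &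
  forall z, is_derive z (delta_mx j ord0) W (P' z * W z).
Proof.
have [P' hP' HP'] := poly_derive j Q_poly; exists P' => // z.
have Wl : W = cW \*: (expR \o Q) by apply/funext => x; rewrite WE.
rewrite WE mulrCA {1}Wl; apply: is_deriveZ; rewrite mulrC.
have Q1 : is_derive (0 : R) (1 : R) (fun t : R => Q (t *: delta_mx j ord0 + z)) (P' z).
  by apply: is_derive_line (HP' z) => h; rewrite addr0 /GRing.scale/= mulr1.
have Q0 : Q (0 *: delta_mx j ord0 + z) = Q z by rewrite scale0r add0r.
have := is_derive1_comp (is_derive_expR (Q (0 *: delta_mx j ord0 + z))) Q1.
rewrite Q0; apply: is_derive_line => h.
by rewrite /= addr0 /GRing.scale/= mulr1.
Qed.

Let leibniz_derive s F j : uniq (j :: s) -> leibniz s F ->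
  exists2 F', leibniz (j :: s) F' & forall z, is_derive z (delta_mx j ord0) F (F' z).
Proof.
move=> /= /andP[js us]; elim=> [P s' ss' hP|F1 F2 _ [F1' h1 H1] _ [F2' h2 H2]]; last first.
  by exists (fun z => F1' z + F2' z); [exact: leibniz_add|move=> z; exact: is_deriveD].
have [P' hP' HP'] := poly_derive j hP; have [Q' hQ' HQ'] := W_derive j.
have js' : j \notin s' by apply: contra js; exact: mem_subseq.
have us' : uniq s' by exact: subseq_uniq us.
have [_ Gd] := G_smooth us'.
have ss1 : subseq s' (j :: s) by exact: subseq_trans (subseq_cons _ _).
have ss2 : subseq (j :: s') (j :: s) by rewrite /= eqxx.
exists (fun z => (P' z * partials s' G z * W z + P z * partials (j :: s') G z * W z) +
   (P z * Q' z) * partials s' G z * W z).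
  apply: leibniz_add; [apply: leibniz_add|]; apply: leibniz_term => //.
  exact: poly_mul.
move=> z; have /derivableP Gz := Gd j z js'.
have := is_deriveM (is_deriveM (HP' z) Gz) (HQ' z).
rewrite /GRing.scale/=; set D := (X in is_derive _ _ _ X).
move=> H; rewrite (_ : _ + _ = D)//.
by rewrite /D !fctE /GRing.scale/=; ring.
Qed.

Let leibniz_subgaussian s F : subseq s (enum 'I_d) -> leibniz s F -> subgaussian F.
Proof.
move=> ss; elim=> [P s' ss' hP|F1 F2 _ h1 _ h2]; last exact: subgaussianD.
apply: subgaussianM W_growth; apply: subgaussianM; first exact: poly_subgaussian.
have /(subseq_uniqP (enum_uniq _)) s'E := subseq_trans ss' ss.
have -> : partials s' G = mixed_partial [set x in s'] G.
  rewrite /mixed_partial [in LHS]s'E; congr (partials _ G).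
  by rewrite enumT; apply: eq_filter => x; rewrite !inE.
exact: G_growth.
Qed.

Let H z := G z * W z.

Lemma partials_importance s : subseq s (enum 'I_d) ->
  partially_derivable s H /\ subgaussian (partials s H).
Proof.
move=> ss; suff [h1 h2] : partially_derivable s H /\ leibniz s (partials s H).
  by split => //; exact: leibniz_subgaussian h2.
elim: s ss => [|j s IH] ss.
  split => //=; rewrite (_ : H = fun z => 1 * partials [::] G z * W z).
    by apply: leibniz_term => //; exact: poly_cst.
  by apply/funext => z; rewrite mul1r.
have [h1 h2] := IH (subseq_trans (subseq_cons _ _) ss).
have [F' hF' HF'] := leibniz_derive (subseq_uniq ss (enum_uniq _)) h2.
split => /=; first by split => // z; have [] := HF' z.
rewrite (_ : (fun z => _) = F')//; apply/funext => z.
by have [] := HF' z.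
Qed.

Lemma importance_growth beta : 0 < beta -> exists2 C : R, 0 <= C &
  forall v : pred 'I_d, partially_derivable (seq.filter v (enum 'I_d)) H /\
    forall z, `|partials (seq.filter v (enum 'I_d)) H z| <= C * gauss_growth beta z.
Proof.
move=> b0.
have /choice[C HC] (v : {set 'I_d}) : exists C : R, 0 <= C /\
    forall z, `|partials (seq.filter (fun x => x \in v) (enum 'I_d)) H z| <=
      C * gauss_growth beta z.
  have [_ /(_ _ b0)[C C0 HC]] := partials_importance (filter_subseq (fun x => x \in v) (enum 'I_d)).
  by exists C.
(* One constant for all [v]: the constants of the finitely many subsets are added up, and predicates
   are turned into sets to index the sum. *)
exists (\sum_v C v); first by apply: sumr_ge0 => v _; have [] := HC v.
move=> v; have [h1 _] := partials_importance (filter_subseq v (enum 'I_d)).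
split => // z; have [_ /(_ z) h] := HC [set x | v x]%SET.
rewrite (eq_filter (a2 := fun x => x \in [set x | v x]%SET)) => [|x]; last by rewrite inE.
apply: le_trans h _; rewrite ler_wpM2r//; first exact: ltW (gauss_growth_gt0 _ _).
rewrite (bigD1 [set x | v x]%SET)//= lerDl; apply: sumr_ge0 => u _.
by have [] := HC u.
Qed.

Lemma importance_continuous : continuous H.
Proof.
have [Gc _] := @G_smooth [::] isT.
have Wc : continuous W.
  rewrite (_ : W = fun z => cW * expR (Q z)); last exact/funext.
  have EQ : continuous (fun z => expR (Q z)).
    by move=> z; apply: continuous_comp; [exact: poly_continuous|exact: continuous_expR].
  have c1 : continuous (fun z : 'cV[R]_d => cW) by exact: cst_continuous.
  by move=> z; exact: cvgM (c1 z) (EQ z).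
by move=> z; exact: cvgM (Gc z) (Wc z).
Qed.

End growth_of_importance_integrand.

(** * Growth of the importance weight *)

Section importance_weight_growth.
Variables (R : realType) (d : nat).
Implicit Types (z : 'cV[R]_d).

(** Completing the square in each coordinate: [a z <= a^2 / (4 b) + b z^2]. *)
Lemma subgaussian_expR_linear (a : 'I_d -> R) :
  subgaussian (fun z : 'cV[R]_d => expR (\sum_j a j * z j ord0)).
Proof.
move=> b b0; exists (\prod_j expR (a j ^+ 2 / (4 * b))).
  by apply: prodr_ge0 => j _; exact: expR_ge0.
move=> z; rewrite ger0_norm ?expR_ge0// expR_sum /gauss_growth -big_split/=.
apply: ler_prod => j _; rewrite expR_ge0 -expRD ler_expR/=.
have -> : a j ^+ 2 / (4 * b) + b * z j ord0 ^+ 2 =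
    b * (z j ord0 - a j / (2 * b)) ^+ 2 + a j * z j ord0 by field; rewrite gt_eqF.
by rewrite lerDr mulr_ge0 ?sqr_ge0// ltW.
Qed.

Lemma subgaussian_le (F : 'cV[R]_d -> R) (P : 'cV[R]_d -> R) (C : R) : 0 <= C ->
  (forall z, `|F z| <= C * `|P z|) -> subgaussian P -> subgaussian F.
Proof.
move=> C0 FP hP b b0; have [C' C'0 HC'] := hP b b0.
exists (C * C'); first exact: mulr_ge0.
by move=> z; apply: le_trans (FP z) _; rewrite -mulrA ler_wpM2l.
Qed.

(** The growth condition is used with all [B_i] equal to the desired rate; the lower bound
    [tail_const * exp (- z^2)] on [1 - Phi |z|] then turns it into Gaussian growth. *)
Lemma qmc_friendly_subgaussian (G : 'cV[R]_d -> R) (v : {set 'I_d}) :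
  qmc_friendly G -> subgaussian (mixed_partial v G).
Proof.
move=> qG b b0; have [B B0 HB] := qG (fun=> b) (fun=> b0).
exists (B * \prod_(i < d) tail_const R `^ (- b)).
  by rewrite mulr_ge0 ?(ltW B0)// prodr_ge0// => i _; exact: powR_ge0.
move=> z; apply: le_trans (HB v z) _; rewrite -mulrA ler_pM2l//.
rewrite /gauss_growth -big_split/=; apply: ler_prod => i _.
rewrite powR_ge0/= powRN.
have h := onem_Phi_ge_exp `|z i ord0|.
have t0 : 0 < tail_const R * expR (- `|z i ord0| ^+ 2).
  by rewrite mulr_gt0 ?tail_const_gt0 ?expR_gt0.
have -> : tail_const R `^ (- b) * expR (b * z i ord0 ^+ 2) =
    ((tail_const R * expR (- `|z i ord0| ^+ 2)) `^ b)^-1.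
  rewrite powRM ?expR_ge0 ?ltW ?tail_const_gt0// invfM powRN -expRM.
  by rewrite real_normK ?num_real// -expRN; congr (_ * expR _); ring.
rewrite lef_pV2 ?posrE ?powR_gt0//; last exact: lt_le_trans h.
by apply: (@ge0_ler_powR R b); rewrite ?nnegrE ?(ltW b0) ?(ltW t0)// (le_trans (ltW t0)).
Qed.

Lemma poly_quadratic (N : 'M[R]_d) (a c : 'cV[R]_d -> 'cV[R]_d) :
  (forall i, polynomial_fun (fun z => a z i ord0)) ->
  (forall i, polynomial_fun (fun z => c z i ord0)) ->
  polynomial_fun (fun z => ((a z)^T *m N *m c z) ord0 ord0).
Proof.
move=> ha hc.
rewrite (_ : (fun z => _) = fun z => \sum_j (\sum_i a z i ord0 * N i j) * c z j ord0).
  apply: poly_sum => j; apply: poly_mul => //; apply: poly_sum => i.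
  by apply: poly_mul => //; exact: poly_cst.
apply/funext => z; rewrite mxE; apply: eq_bigr => j _; rewrite mxE; congr (_ * _).
by apply: eq_bigr => i _; rewrite mxE.
Qed.

Variables (mu0 mu : 'cV[R]_d) (Sigma0 Sigma L : 'M[R]_d).
Hypothesis d_gt0 : (0 < d)%N.
Hypothesis Sigma0_sym : Sigma0^T = Sigma0.
Hypothesis eigen_ge1 : forall a : R, eigenvalue (L^T *m invmx Sigma0 *m L) a -> 1 <= a.

Let cW : R := Num.sqrt (\det Sigma) / Num.sqrt (\det Sigma0).
Let S := invmx Sigma0.
Let dl := mu - mu0.
Let Q z : R := 1 / 2 * (z^T *m z) ord0 ord0
  - 1 / 2 * ((dl + L *m z)^T *m S *m (dl + L *m z)) ord0 ord0.
Let W z := importance_weight mu0 mu Sigma0 Sigma L z.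

Let Q_poly : polynomial_fun Q.
Proof.
have h1 : polynomial_fun (fun z : 'cV[R]_d => (z^T *m 1%:M *m z) ord0 ord0).
  by apply: poly_quadratic; exact: poly_coord.
have h2 : polynomial_fun (fun z => ((dl + L *m z)^T *m S *m (dl + L *m z)) ord0 ord0).
  have hl i : polynomial_fun (fun z => (dl + L *m z) i ord0).
    rewrite (_ : (fun z => _) = fun z => dl i ord0 + \sum_j L i j * z j ord0); last first.
      by apply/funext => z; rewrite !mxE.
    apply: poly_add; first exact: poly_cst.
    by apply: poly_sum => j; apply: poly_mul; [exact: poly_cst|exact: poly_coord].
  exact: poly_quadratic.
rewrite (_ : Q = fun z => 1 / 2 * (z^T *m 1%:M *m z) ord0 ord0 +
    (- (1 / 2)) * ((dl + L *m z)^T *m S *m (dl + L *m z)) ord0 ord0).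
  by apply: poly_add; apply: poly_mul => //; exact: poly_cst.
by apply/funext => z; rewrite mulmx1 mulNr.
Qed.

Let ST : S^T = S. Proof. by rewrite /S trmx_inv Sigma0_sym. Qed.

(** The eigenvalue hypothesis enters here: it makes the quadratic part nonpositive, and a constant
    and a linear term in the shift [dl] remain. *)
Let Q_le z : Q z <= - (1 / 2) * (dl^T *m S *m dl) ord0 ord0 +
  \sum_j (- (dl^T *m S *m L) ord0 j) * z j ord0.
Proof.
set M := L^T *m S *m L.
have MT : M^T = M by rewrite /M !trmx_mul trmxK ST mulmxA.
have zM := eigenvalue_ge1_quadratic d_gt0 MT eigen_ge1 z.
have -> : \sum_j (- (dl^T *m S *m L) ord0 j) * z j ord0 = - (dl^T *m S *m (L *m z)) ord0 ord0.
  rewrite mulmxA [in RHS]mxE -sumrN; apply: eq_bigr => j _; rewrite mulNr//.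
have cross : ((L *m z)^T *m S *m dl) ord0 ord0 = (dl^T *m S *m (L *m z)) ord0 ord0.
  transitivity (((L *m z)^T *m S *m dl)^T ord0 ord0); first by rewrite [RHS]mxE.
  by rewrite !trmx_mul !trmxK ST !mulmxA.
have quad : ((L *m z)^T *m S *m (L *m z)) ord0 ord0 = (z^T *m M *m z) ord0 ord0.
  by rewrite /M trmx_mul !mulmxA.
rewrite /Q.
have -> : ((dl + L *m z)^T *m S *m (dl + L *m z)) ord0 ord0 =
    (dl^T *m S *m dl) ord0 ord0 + (dl^T *m S *m (L *m z)) ord0 ord0 +
    (((L *m z)^T *m S *m dl) ord0 ord0 + ((L *m z)^T *m S *m (L *m z)) ord0 ord0).
  have -> : (dl + L *m z)^T = dl^T + (L *m z)^T by apply/matrixP => i j; rewrite !mxE.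
  rewrite !mulmxDl !mulmxDr.
  move: (dl^T *m S *m dl) (dl^T *m S *m (L *m z)) ((L *m z)^T *m S *m dl)
    ((L *m z)^T *m S *m (L *m z)).
  by move=> a1 a2 a3 a4; rewrite !mxE.
rewrite cross quad; lra.
Qed.

Let W_growth : subgaussian W.
Proof.
apply: (@subgaussian_le _ (fun z => expR (\sum_j (- (dl^T *m S *m L) ord0 j) * z j ord0))
  (cW * expR (- (1 / 2) * (dl^T *m S *m dl) ord0 ord0))).
- by rewrite mulr_ge0 ?expR_ge0// divr_ge0 ?sqrtr_ge0.
- move=> z; rewrite !ger0_norm ?expR_ge0//; last first.
    by rewrite mulr_ge0 ?expR_ge0// divr_ge0 ?sqrtr_ge0.
  rewrite -mulrA -expRD /W /importance_weight -/cW -/dl -/S ler_wpM2l ?divr_ge0 ?sqrtr_ge0//.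
  by rewrite ler_expR; exact: Q_le.
- exact: subgaussian_expR_linear.
Qed.

Variable G : 'cV[R]_d -> R.
Hypothesis G_smooth : mixed_smooth G.
Hypothesis G_friendly : qmc_friendly G.

Lemma importance_integrand_growth beta : 0 < beta -> exists2 C : R, 0 <= C &
  forall v : pred 'I_d, partially_derivable (seq.filter v (enum 'I_d)) (fun z => G z * W z) /\
    forall z, `|partials (seq.filter v (enum 'I_d)) (fun z => G z * W z) z| <=
      C * gauss_growth beta z.
Proof.
apply: (importance_growth G_smooth _ Q_poly (cW := cW)) => // v.
exact: qmc_friendly_subgaussian.
Qed.

Lemma importance_integrand_continuous : continuous (fun z => G z * W z).
Proof. by apply: (importance_continuous G_smooth Q_poly (cW := cW)). Qed.

End importance_weight_growth.

(** * Digits and nets *)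

Section base_b_numerals.
Variables (b : nat) (b_gt1 : (1 < b)%N).
Implicit Types s : seq 'I_b.

Let b0 : (0 < b)%N. Proof. exact: ltnW. Qed.

Definition numeral s : nat := foldl (fun acc (e : 'I_b) => acc * b + e)%N 0%N s.

Lemma numeral_rcons s e : numeral (rcons s e) = (numeral s * b + e)%N.
Proof. by rewrite /numeral foldl_rcons. Qed.

Lemma numeral_cat s1 s2 : numeral (s1 ++ s2) = (numeral s1 * b ^ size s2 + numeral s2)%N.
Proof.
elim/last_ind: s2 => [|s2 e IH]; first by rewrite cats0 muln1 addn0.
rewrite -rcons_cat !numeral_rcons IH size_rcons expnSr mulnDl -!mulnA; lia.
Qed.

Lemma numeral_lt s : (numeral s < b ^ size s)%N.
Proof.
elim/last_ind: s => [//|s e IH]; rewrite numeral_rcons size_rcons expnSr.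
apply: (@leq_trans ((numeral s).+1 * b)); last by rewrite leq_mul2r IH orbT.
by rewrite mulSn addnC ltn_add2r.
Qed.

Lemma numeral_inj s1 s2 : size s1 = size s2 -> numeral s1 = numeral s2 -> s1 = s2.
Proof.
elim/last_ind: s1 s2 => [|s1 e1 IH] s2; first by move=> /esym/size0nil ->.
case/lastP: s2 => [|s2 e2]; first by rewrite size_rcons.
rewrite !size_rcons !numeral_rcons => -[ss] E.
have E1 : numeral s1 = numeral s2.
  by have := congr1 (divn^~ b) E; rewrite !divnMDl// !divn_small// !addn0.
have E2 : e1 = e2 by apply/val_inj; move: E; rewrite E1 => /addnI.
by rewrite (IH s2)// E2.
Qed.

(** The most significant digit comes first, so dropping the last [K - k] digits is integer division,
    and prefix classes are the blocks of consecutive integers of the grid estimates. *)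
Lemma numeral_take K (x : K.-tuple 'I_b) k : (k <= K)%N ->
  numeral (take k x) = (numeral x %/ b ^ (K - k))%N.
Proof.
move=> kK; rewrite -[X in (numeral X %/ _)%N](cat_take_drop k) numeral_cat.
have sd : size (drop k x) = (K - k)%N by rewrite size_drop size_tuple.
rewrite sd divnMDl ?expn_gt0 ?b0// divn_small ?addn0//.
by rewrite -sd numeral_lt.
Qed.

Lemma eq_take_numeral K (x y : K.-tuple 'I_b) k : (k <= K)%N ->
  (take k x == take k y) = (numeral x %/ b ^ (K - k) == numeral y %/ b ^ (K - k))%N.
Proof.
move=> kK; rewrite -!numeral_take//; apply/eqP/eqP => [-> //|].
by apply: numeral_inj; rewrite !size_takel ?size_tuple.
Qed.

Definition numeral_ord K (x : K.-tuple 'I_b) : 'I_(b ^ K) :=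
  @Ordinal (b ^ K) (numeral x)
    (eq_ind _ (fun k => (numeral x < b ^ k)%N) (numeral_lt x) _ (size_tuple x)).

Lemma numeral_ord_bij K : bijective (@numeral_ord K).
Proof.
apply: inj_card_bij.
  move=> x y /(congr1 val)/= E; apply/val_inj/numeral_inj => //.
  by rewrite !size_tuple.
by rewrite card_ord card_tuple card_ord.
Qed.

Lemma sum_numeral (V : nmodType) K (F : nat -> V) (P : pred nat) :
  \sum_(x : K.-tuple 'I_b | P (numeral x)) F (numeral x) = \sum_(0 <= i < b ^ K | P i) F i.
Proof. by rewrite big_mkord (reindex _ (onW_bij _ (numeral_ord_bij K))). Qed.

Lemma sum_numeralT (V : nmodType) K (F : nat -> V) :
  \sum_(x : K.-tuple 'I_b) F (numeral x) = \sum_(0 <= i < b ^ K) F i.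
Proof. exact: (@sum_numeral _ _ F xpredT). Qed.

Lemma numeral_surj K i : (i < b ^ K)%N -> exists x : K.-tuple 'I_b, numeral x = i.
Proof.
move=> iK; have [f _ fK] := numeral_ord_bij K.
by exists (f (Ordinal iK)); have := congr1 val (fK (Ordinal iK)).
Qed.

Variable R : realType.
Implicit Types x : R.

Let bR : 0 < b%:R :> R. Proof. by rewrite ltr0n. Qed.

Lemma truncn_digit x k : 0 <= x ->
  Num.truncn (x * b%:R ^+ k.+1) = (Num.truncn (x * b%:R ^+ k) * b + digit b_gt1 x k)%N.
Proof.
move=> x0; rewrite /digit /= [LHS](divn_eq _ b); congr (_ * _ + _)%N.
set y := x * b%:R ^+ k.
have y0 : 0 <= y by rewrite mulr_ge0 ?exprn_ge0// ltW.
have -> : x * b%:R ^+ k.+1 = y * b%:R by rewrite /y exprSr mulrA.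
have yb0 : 0 <= y * b%:R by rewrite mulr_ge0// ltW.
have /andP[h1 h2] := truncn_itv yb0; have /andP[h3 h4] := truncn_itv y0.
set n := Num.truncn (y * b%:R) in h1 h2 *; set k0 := Num.truncn y in h3 h4 *.
apply/eqP; rewrite eqn_leq; apply/andP; split.
  rewrite -ltnS ltn_divLR// -(ltr_nat R) natrM.
  by apply: le_lt_trans h1 _; rewrite ltr_pM2r.
rewrite leq_divRL// -ltnS -(ltr_nat R); apply: le_lt_trans h2.
by rewrite natrM ler_pM2r.
Qed.

Definition digits K x : K.-tuple 'I_b := [tuple digit b_gt1 x l | l < K].

Lemma take_digits K x k : (k <= K)%N ->
  take k (digits K x) = [seq digit b_gt1 x l | l <- iota 0 k].
Proof.
move=> kK; rewrite (_ : val (digits K x) = map (digit b_gt1 x) (map val (enum 'I_K))).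
  by rewrite val_enum_ord -map_take take_iota (minn_idPl kK).
by rewrite -map_comp.
Qed.

Lemma numeral_digits x k : 0 <= x < 1 ->
  numeral [seq digit b_gt1 x l | l <- iota 0 k] = Num.truncn (x * b%:R ^+ k).
Proof.
move=> /andP[x0 x1]; elim: k => [|k IH].
  by rewrite expr0 mulr1; apply/esym/truncn_def; rewrite x0.
by rewrite -[in LHS]addn1 iotaD map_cat cats1 numeral_rcons IH truncn_digit.
Qed.

(** A coordinate has the prefix of [e j] exactly when it lies in the elementary interval indexed by
    the numeral of this prefix; lengths summing to [m - t] give the volume [b^(t - m)]. *)
Lemma net_balanced (t m d K : nat) (a : 'I_(b ^ m) -> 'cV[R]_d) (kap : 'I_d -> nat) :
  is_net t a -> (forall j, (kap j <= K)%N) -> (\sum_j kap j = m - t)%N ->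
  balanced (fun i => [ffun j => digits K (a i j ord0)]) kap (b ^ t).
Proof.
move=> [tm a01 net] kK ksum e.
have szt j : size (take (kap j) (e j)) = kap j by rewrite size_takel// size_tuple.
rewrite -(net kap (fun j => numeral (take (kap j) (e j)))).
- apply: eq_card => i; rewrite !inE; apply: eq_forallb => j.
  rewrite ffunE take_digits//.
  set x := a i j ord0; set c := numeral _.
  have bk : 0 < b%:R ^+ kap j :> R by rewrite exprn_gt0.
  have xb0 : 0 <= x * b%:R ^+ kap j by rewrite mulr_ge0 ?(ltW bk)//; case/andP: (a01 i j).
  rewrite ler_pdivrMr// ltr_pdivlMr//.
  have -> : ([seq digit b_gt1 x l | l <- iota 0 (kap j)] == take (kap j) (e j)) =
      (Num.truncn (x * b%:R ^+ kap j) == c).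
    rewrite -numeral_digits ?a01//; apply/idP/idP => /eqP; first by move=> ->.
    by move=> E; apply/eqP; apply: numeral_inj E; rewrite size_map size_iota szt.
  by rewrite truncn_eq.
- by move=> j; rewrite -[X in (_ < _ ^ X)%N]szt numeral_lt.
- by rewrite prodfV prodrXr ksum exprnN -subzn// opprB.
Qed.

End base_b_numerals.

Lemma powR_expn (R : realType) (x a : R) (k : nat) : 0 <= x ->
  (x ^+ k) `^ a = (x `^ a) ^+ k.
Proof.
move=> x0; rewrite -(powR_mulrn k x0) -(powR_mulrn k (powR_ge0 x a)).
by rewrite -(powRrM x k%:R a) -(powRrM x a k%:R) mulrC.
Qed.

(** * Mean square of the one-dimensional weights *)

Section haar_weight_mean_square.
Variables (R : realType) (b : nat) (b_gt1 : (1 < b)%N) (beta : R).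
Hypothesis beta_itv : 0 < 12 * beta < 1.

Definition grid_value (K : nat) (x : K.-tuple 'I_b) : R := gridpt R (b ^ K) (numeral x).

Definition haar_ratio : R := b%:R^-1 `^ (1 - 12 * beta).

Let wt (t : R) := expR (beta * t ^+ 2).
Let hw K k (x : K.-tuple 'I_b) := haar_weight (@grid_value K) (Psi beta) wt k x.
Let V K k : R := (b ^ K)%:R^-1 * \sum_(x : K.-tuple 'I_b) \sum_(y : K.-tuple 'I_b)
  cellk R k x y * (Psi beta (grid_value x) - Psi beta (grid_value y)) ^+ 2.

Let b0 : (0 < b)%N. Proof. exact: ltnW. Qed.

Let V_le : exists2 C : R, 0 <= C & forall K k, (k <= K)%N -> V K k <= C * haar_ratio ^+ k.
Proof.
have [C C0 HC] := gridpt_variance beta_itv; exists C => // K k kK.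
have := HC (b ^ k)%N (b ^ (K - k))%N; rewrite !expn_gt0 b0 -expnD subnKC// => /(_ isT isT).
have -> : (b ^ k)%:R^-1 `^ (1 - 12 * beta) = haar_ratio ^+ k.
  by rewrite natrX -exprVn; apply: powR_expn; rewrite invr_ge0.
apply: le_trans; rewrite /V ler_pM2l ?invr_gt0 ?ltr0n ?expn_gt0 ?b0//.
rewrite -(sum_numeralT b_gt1) le_eqVlt; apply/orP; left; apply/eqP.
apply: eq_bigr => x _.
have /= <- := @sum_numeral b b_gt1 _ K (fun y => (b ^ (K - k))%:R^-1 *
    (Psi beta (gridpt R (b ^ K) (numeral x)) - Psi beta (gridpt R (b ^ K) y)) ^+ 2)
  (fun y => numeral x %/ b ^ (K - k) == y %/ b ^ (K - k))%N.
rewrite [RHS]big_mkcond/=; apply: eq_bigr => y _.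
rewrite /cellk card_ord eq_take_numeral//.
by case: ifP => _; rewrite ?mulr1// mulr0 mul0r.
Qed.

Let jensen K k (x : K.-tuple 'I_b) (f : K.-tuple 'I_b -> R) :
  (\sum_y cellk R k x y * f y) ^+ 2 <= \sum_y cellk R k x y * f y ^+ 2.
Proof.
set m := \sum_y _ * f y.
have A0 : (0 < #|'I_b|)%N by rewrite card_ord.
have : 0 <= \sum_y cellk R k x y * (f y - m) ^+ 2.
  by apply: sumr_ge0 => y _; rewrite mulr_ge0 ?cellk_ge0 ?sqr_ge0.
have expand c : \sum_y cellk R k x y * (f y - c) ^+ 2 =
   \sum_y cellk R k x y * f y ^+ 2 - 2 * c * (\sum_y cellk R k x y * f y) +
   c ^+ 2 * \sum_y cellk R k x y.
  rewrite !mulr_sumr -sumrB -big_split/=; apply: eq_bigr => y _; ring.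
rewrite expand -/m sum_cellk//; rewrite !expr2; lra.
Qed.

(** At level [0] the weight is a bounded mean. At level [k + 1] it is a sum of averages over two
    nested cells, each controlled by a cell variance; the coarser one decays by one level less,
    whence [haar_ratio^-1]. *)
Lemma haar_weight_mean_square : exists2 C : R, 0 <= C & forall K k, (k <= K)%N ->
  (b ^ K)%:R^-1 * \sum_(x : K.-tuple 'I_b) hw k x ^+ 2 <= C * haar_ratio ^+ k.
Proof.
have bR : 0 < b%:R :> R by rewrite ltr0n.
have r0 : 0 < haar_ratio by rewrite powR_gt0 ?invr_gt0.
have [C C0 HC] := V_le.
have b4 : 0 < 4 * beta < 1 by move/andP: beta_itv => [? ?]; apply/andP; split; lra.
have [C1 C10 HC1] := mean_expR_gridpt b4.
have rV0 : 0 < haar_ratio^-1 by rewrite invr_gt0.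
exists (C1 ^+ 2 + 2 * C * (1 + haar_ratio^-1)).
  by rewrite addr_ge0 ?sqr_ge0// !mulr_ge0// addr_ge0// ltW.
move=> K [_|k kK].
  have hw0 x : hw (K := K) 0 x = (b ^ K)%:R^-1 * \sum_(0 <= i < b ^ K) wt (gridpt R (b ^ K) i).
    rewrite /hw /= mulr_sumr -(sum_numeralT b_gt1); apply: eq_bigr => y _.
    by rewrite /cellk !take0 eqxx mulr1 subn0 card_ord.
  under eq_bigr do rewrite hw0.
  rewrite sumr_cst card_tuple card_ord mulrA mulVf ?mul1r; last first.
    by rewrite pnatr_eq0 -lt0n expn_gt0 b0.
  rewrite expr0 mulr1 -[leLHS]addr0; apply: lerD; last first.
    by rewrite !mulr_ge0// addr_ge0// ltW.
  rewrite ler_sqr ?nnegrE//; first by apply: HC1; rewrite expn_gt0 b0.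
  by rewrite mulr_ge0 ?invr_ge0// sumr_ge0// => i _; exact: expR_ge0.
apply: (@le_trans _ _ (2 * V K k.+1 + 2 * V K k)); last first.
  have h1 := HC _ _ kK; have h2 := HC _ _ (ltnW kK).
  apply: (@le_trans _ _ (2 * (C * haar_ratio ^+ k.+1) + 2 * (C * haar_ratio ^+ k))).
    by apply: lerD; rewrite ler_pM2l.
  have -> : haar_ratio ^+ k = haar_ratio^-1 * haar_ratio ^+ k.+1.
    by rewrite exprS mulKf// gt_eqF.
  have := sqr_ge0 C1; have : 0 <= haar_ratio ^+ k.+1 by rewrite exprn_ge0// ltW.
  move: (haar_ratio ^+ k.+1) (haar_ratio^-1) (C1 ^+ 2) => x y z x0 z0.
  have : 0 <= z * x by rewrite mulr_ge0.
  lra.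
rewrite /V !mulrA !(mulrC 2) -!mulrA -mulrDr ler_pM2l; last first.
  by rewrite invr_gt0 ltr0n expn_gt0 b0.
rewrite !mulr_sumr -big_split/=; apply: ler_sum => x _.
pose f (y : K.-tuple 'I_b) := `|Psi beta (grid_value y) - Psi beta (grid_value x)|.
rewrite [X in X ^+ 2](_ : _ =
  \sum_y cellk R k.+1 x y * f y + \sum_y cellk R k x y * f y); last first.
  by rewrite -big_split/=; apply: eq_bigr => y _; rewrite mulrDl.
have h1 := jensen k.+1 x f; have h2 := jensen k x f.
have fE k' : \sum_y cellk R k' x y * f y ^+ 2 =
    \sum_y cellk R k' x y * (Psi beta (grid_value x) - Psi beta (grid_value y)) ^+ 2.
  by apply: eq_bigr => y _; rewrite /f real_normK ?num_real// -[in LHS]sqrrN opprB.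
rewrite !fE in h1 h2.
move: h1 h2; set p := \sum_y _ * f y; set q := \sum_y _ * f y => h1 h2.
apply: (@le_trans _ _ (2 * p ^+ 2 + 2 * q ^+ 2)).
  have := sqr_ge0 (p - q); rewrite sqrrB sqrrD; lra.
by rewrite lerD ?ler_pM2l.
Qed.

End haar_weight_mean_square.

(** * Refinement of the grid *)

Section grid_limits.
Variables (R : realType) (b : nat) (b_gt1 : (1 < b)%N).

Let bR : 1 < b%:R :> R. Proof. by rewrite ltr1n. Qed.

Let bK0 K : 0 < (b ^ K)%:R :> R.
Proof. by rewrite ltr0n expn_gt0 (ltnW b_gt1). Qed.

Let invb_cvg : (b ^ K)%:R^-1 @[K --> \oo] --> (0 : R).
Proof.
under eq_fun do rewrite natrX -exprVn.
apply: cvg_expr; rewrite ger0_norm ?invr_ge0//.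
by rewrite invf_lt1// (lt_trans ltr01).
Qed.

(** The bracket is closed on both sides to cover expansions ending in repeated digits [b - 1]. For
    [u] equal to [0] or [1] all grid values are [0], the default of [Phi_inv]. *)
Lemma gridpt_cvg (X : nat -> nat) (u : R) : 0 <= u <= 1 ->
  (forall K, (X K < b ^ K)%N) ->
  (forall K, (X K)%:R / (b ^ K)%:R <= u <= (X K).+1%:R / (b ^ K)%:R) ->
  gridpt R (b ^ K) (X K) @[K --> \oo] --> Phi_inv u.
Proof.
move=> /andP[u0 u1] XK Xu.
have [uE|un0] := eqVneq u 0.
  rewrite (_ : (fun K => _) = cst 0); last first.
    apply/funext => K; have /andP[h _] := Xu K.
    have X0 : X K = 0%N.
      apply/eqP; rewrite -leqn0 -(ler_nat R) -(ler_pM2r (_ : 0 < (b ^ K)%:R^-1)).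
        by rewrite mul0r -uE.
      by rewrite invr_gt0.
    by rewrite /gridpt X0; case: ifP => // _; rewrite mul0r Phi_inv0// ltxx.
  rewrite uE Phi_inv0 ?ltxx//; exact: cvg_cst.
have [uE|un1] := eqVneq u 1.
  rewrite (_ : (fun K => _) = cst 0); last first.
    apply/funext => K; have /andP[_ h] := Xu K.
    rewrite /gridpt ifT// eqn_leq XK /= -(ler_nat R).
    by move: h; rewrite uE ler_pdivlMr// mul1r.
  rewrite uE Phi_inv0 ?ltxx ?andbF//; exact: cvg_cst.
have u01 : 0 < u < 1 by rewrite !lt_neqAle eq_sym un0 u0 un1 u1.
have Xcvg : (X K)%:R / (b ^ K)%:R @[K --> \oo] --> u.
  apply: (@squeeze_cvgr _ _ _ _ (fun K => u - (b ^ K)%:R^-1) (fun=> u)).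
  - near=> K; have /andP[h1 h2] := Xu K; rewrite h1 andbT.
    by rewrite lerBlDr; move: h2; rewrite -natr1 mulrDl mul1r.
  - by rewrite -[X in _ --> X]subr0; apply: cvgB; [exact: cvg_cst|exact: invb_cvg].
  - exact: cvg_cst.
have Pcvg : Phi_inv ((X K)%:R / (b ^ K)%:R) @[K --> \oo] --> Phi_inv u.
  exact: (cvg_comp _ _ Xcvg (continuous_Phi_inv u01)).
apply: cvg_trans Pcvg; apply: near_eq_cvg; near=> K.
rewrite /gridpt ifN//; apply/eqP => XE.
(* The last cell starts at [1 - b^(-K)], which eventually exceeds [u]. *)
have small : (b ^ K)%:R^-1 < 1 - u.
  by near: K; apply: cvgr_lt invb_cvg _ _; case/andP: u01 => _ ?; rewrite subr_gt0.
have /andP[h _] := Xu K; move: small.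
rewrite ltNge => /negP; apply.
have XE' : (X K)%:R + 1 = (b ^ K)%:R :> R by rewrite natr1 XE.
have : (X K)%:R / (b ^ K)%:R + (b ^ K)%:R^-1 = 1 :> R.
  by rewrite -{2}[_^-1]mul1r -mulrDl XE' divff// gt_eqF.
by move: h; lra.
Unshelve. all: by end_near. Qed.

Let term (e : nat -> 'I_b) : R ^nat := fun k => (e k)%:R * b%:R ^- k.+1.

Lemma series_digitsE (e : nat -> 'I_b) K :
  series (term e) K = (numeral [seq e l | l <- iota 0 K])%:R / (b ^ K)%:R.
Proof.
elim: K => [|K IH]; first by rewrite /series /= big_geq// mul0r.
rewrite seriesSr IH -[K.+1]addn1 iotaD map_cat cats1 numeral_rcons natrD natrM add0n addn1.
rewrite /term !natrX exprS.
have : b%:R ^+ K != 0 :> R by rewrite expf_neq0// gt_eqF// (lt_trans ltr01).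
have : b%:R != 0 :> R by rewrite gt_eqF// (lt_trans ltr01).
move=> c0 q0; field.
by rewrite ?c0 ?q0.
Qed.

Lemma limn_digits_bounds (e : nat -> 'I_b) K :
  (numeral [seq e l | l <- iota 0 K])%:R / (b ^ K)%:R <= limn (series (term e)) <=
  (numeral [seq e l | l <- iota 0 K]).+1%:R / (b ^ K)%:R.
Proof.
have up : {homo (series (term e)) : n m / (n <= m)%N >-> n <= m}.
  apply/nondecreasing_seqP => k; rewrite seriesSr lerDl mulr_ge0// invr_ge0 exprn_ge0//.
(* The slack [b^(-(n + k))] carries the induction: a digit is at most [b - 1], so the next term is
   paid for by the decrease of the slack. *)
have stepdown k n : series (term e) (n + k)%N <=
    (numeral [seq e l | l <- iota 0 n]).+1%:R / (b ^ n)%:R - (b ^ (n + k))%:R^-1.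
  elim: k => [|k IH].
    by rewrite addn0 series_digitsE -[(numeral _).+1%:R]natr1 mulrDl mul1r addrK.
  rewrite addnS seriesSr; apply: le_trans (lerD IH (lexx _)) _.
  set s := (n + k)%N; rewrite -addrA lerD2l /term.
  have eb : (e s)%:R + 1 <= b%:R :> R by rewrite natr1 ler_nat ltn_ord.
  have c0 : 0 < b%:R :> R by rewrite (lt_trans ltr01).
  have -> : b%:R ^+ s.+1 = b%:R * (b ^ s)%:R :> R by rewrite exprS natrX.
  have -> : (b ^ s.+1)%:R = b%:R * (b ^ s)%:R :> R by rewrite expnS natrM.
  have q0 := bK0 s; move: ((b ^ s)%:R) q0 => q q0.
  rewrite -(ler_pM2l (mulr_gt0 c0 q0)).
  rewrite [leLHS](_ : _ = (e s)%:R - b%:R); last by field; rewrite !gt_eqF.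
  by rewrite [leRHS](_ : _ = - 1); [lra|field; rewrite !gt_eqF].
have cv : cvgn (series (term e)).
  apply: nondecreasing_is_cvgn => //; exists 1 => _ [k _ <-].
  have := stepdown k 0%N; rewrite add0n expn0 divr1 => /le_trans; apply.
  by rewrite gerBl invr_ge0.
apply/andP; split.
  by rewrite -series_digitsE; exact: nondecreasing_cvgn_le.
apply: limr_le => //; near=> n.
have Kn : (K <= n)%N by near: n; exact: nbhs_infty_ge.
rewrite -(subnKC Kn); apply: le_trans (stepdown _ _) _.
by rewrite gerBl invr_ge0 ltW.
Unshelve. all: by end_near. Qed.

Lemma limn_digits_itv (e : nat -> 'I_b) : 0 <= limn (series (term e)) <= 1.
Proof.
by have := limn_digits_bounds e 0; rewrite /= expn0 !divr1.
Qed.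

Lemma gridpt_digits_cvg (e : nat -> 'I_b) :
  gridpt R (b ^ K) (numeral [seq e l | l <- iota 0 K]) @[K --> \oo] -->
  Phi_inv (limn (series (term e))).
Proof.
apply: gridpt_cvg => [|K|K].
- exact: limn_digits_itv.
- by have := numeral_lt [seq e l | l <- iota 0 K]; rewrite size_map size_iota.
- exact: limn_digits_bounds.
Qed.

Lemma gridpt_truncn_cvg (z : R) :
  gridpt R (b ^ K) (Num.truncn ((b ^ K)%:R * Phi z)) @[K --> \oo] --> z.
Proof.
rewrite -[X in _ --> X]PhiK; apply: gridpt_cvg => [|K|K].
- by rewrite Phi_ge0 Phi_le1.
- rewrite truncn_lt_nat ?mulr_ge0 ?Phi_ge0//.
  by rewrite -[ltRHS]mulr1 ltr_pM2l ?Phi_lt1.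
- have := truncn_itv (mulr_ge0 (ltW (bK0 K)) (Phi_ge0 z)).
  by rewrite ler_pdivrMr// ler_pdivlMr// mulrC => /andP[-> /ltW].
Qed.

Lemma cvg_col (d : nat) (f : nat -> 'I_d -> R) (l : 'I_d -> R) :
  (forall j, f K j @[K --> \oo] --> l j) ->
  (\col_j f K j) @[K --> \oo] --> (\col_j l j : 'cV[R]_d).
Proof.
move=> fl; apply/cvg_ballP => e e0.
have : \forall K \near \oo, forall j : 'I_d, ball (l j) e (f K j).
  by apply: filter_forall => j; move: (fl j) => /cvg_ballP; exact.
apply: filterS => K HK; split=> // i j.
by rewrite !mxE; exact: HK.
Qed.

End grid_limits.

(** * Gaussian integrals as limits of grid means *)

Section product_integral.
Variable R : realType.

Lemma measurable_prod_tnth (d : nat) (f : 'I_d -> R -> R) :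
  (forall j, measurable_fun [set: R] (f j)) ->
  measurable_fun [set: d.-tuple R] (fun t => \prod_j f j (tnth t j)).
Proof.
move=> mf; apply: measurable_prod => j _.
by apply: measurableT_comp => //; exact: measurable_tnth.
Qed.

Lemma integral_lebesgue_tuple_prod (d : nat) (f : 'I_d -> R -> R) (I : 'I_d -> R) :
  (forall j, measurable_fun [set: R] (f j)) -> (forall j x, 0 <= f j x) ->
  (forall j, (\int[lebesgue_measure]_x (f j x)%:E = (I j)%:E)%E) ->
  (\int[@lebesgue_tuple R d]_t (\prod_j f j (tnth t j))%:E = (\prod_j I j)%:E)%E.
Proof.
elim: d f I => [|d IH] f I mf f0 If.
  under eq_integral do rewrite big_ord0.
  by rewrite big_ord0 integral_cst//= diracT mul1e.
have mcons := @measurable_consT R d.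
have mF : measurable_fun [set: d.+1.-tuple R] (fun t => (\prod_j f j (tnth t j))%:E).
  by apply/measurable_EFinP; exact: measurable_prod_tnth.
have F0 (t : d.+1.-tuple R) : (0 <= (\prod_j f j (tnth t j))%:E)%E.
  by rewrite lee_fin prodr_ge0.
pose lm : {measure set (measurableTypeR R * d.-tuple R)%type -> \bar R} :=
  (lebesgue_measure \x @lebesgue_tuple R d)%E.
have pf := @ge0_integral_pushforward _ _ (measurableTypeR R * d.-tuple R)%type _ R
  (@consT R d) mcons lm setT _
  measurableT mF (fun t _ => F0 t).
apply: etrans; first exact: pf.
rewrite preimage_setT /lm {pf lm}.
pose f' j := f (lift ord0 j); pose G (t : d.-tuple R) := \prod_j f' j (tnth t j).
have consE (x : R) (t : d.-tuple R) :
    \prod_j f j (tnth (consT (x, t)) j) = f ord0 x * G t.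
  rewrite big_ord_recl; congr (_ * _).
  by apply: eq_bigr => j _; congr (f _ _); rewrite !(tnth_nth x).
have mG : measurable_fun [set: d.-tuple R] (fun t => (G t)%:E).
  by apply/measurable_EFinP; apply: measurable_prod_tnth => j; exact: mf.
have IG : (\int[@lebesgue_tuple R d]_t (G t)%:E = (\prod_j I (lift ord0 j))%:E)%E.
  by apply: IH => [j|j x|j]; [exact: mf|exact: f0|exact: If].
rewrite fubini_tonelli1/=; last 2 first.
- exact: measurableT_comp.
- by move=> p; exact: F0.
transitivity (\int[lebesgue_measure]_x ((f ord0 x)%:E * (\prod_j I (lift ord0 j))%:E))%E.
  apply: eq_integral => x _; rewrite /fubini_F.
  under eq_integral do rewrite /= consE EFinM.
  rewrite ge0_integralZl//; first by rewrite IG.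
  - by move=> t _; rewrite lee_fin prodr_ge0// => j _; exact: f0.
  - by rewrite lee_fin.
rewrite ge0_integralZr//; last 3 first.
- by apply/measurable_EFinP; exact: mf.
- by move=> x _; rewrite lee_fin.
- rewrite -IG; apply: integral_ge0 => t _; rewrite lee_fin prodr_ge0// => j _; exact: f0.
by rewrite If -EFinM [in RHS]big_ord_recl.
Qed.

End product_integral.

(** * Cells of equal probability for the normal distribution *)

Section gaussian_cells.
Variable R : realType.
Local Notation gam := (@normal_prob R 0 1).

(** The probability integral transform: [Phi] of a standard normal variable is uniform. The values
    [0] and [1] are treated apart, having no preimage under [Phi]. *)
Let measurable_lt_prob (v : R) : 0 <= v <= 1 ->
  measurable [set x : R | Phi x < v] /\ gam [set x : R | Phi x < v] = v%:E.
Proof.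
move=> /andP[v0 v1].
have [->|vn0] := eqVneq v 0.
  rewrite (_ : [set _ | _] = set0); first by rewrite measure0.
  by apply/seteqP; split => // x /=; rewrite ltNge Phi_ge0.
have [->|vn1] := eqVneq v 1.
  rewrite (_ : [set _ | _] = setT); first by rewrite probability_setT.
  by apply/seteqP; split => // x _ /=; exact: Phi_lt1.
have v01 : 0 < v < 1 by rewrite !lt_neqAle eq_sym vn0 v0 vn1 v1.
have -> : [set x | Phi x < v] = `]-oo, Phi_inv v[%classic.
  by apply/seteqP; split => x /=; rewrite in_itv/= -(ltr_Phi x) Phi_invK.
split => //.
have m1 z : gam [set z] = 0%E.
  have /null_content_dominatesP := @normal_prob_dominates R 0 1.
  by apply => //; exact: lebesgue_measure_set1.
have E : `]-oo, Phi_inv v[ `|` [set Phi_inv v] = `]-oo, Phi_inv v]%classic.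
  by apply: setUitv1; rewrite bnd_simp.
have := PhiE (Phi_inv v); rewrite Phi_invK// -E measureU//= ?m1 ?adde0//.
by apply/seteqP; split => // z /= [] /[swap] ->; rewrite in_itv/= ltxx.
Qed.

Variable n : nat.
Hypothesis n0 : (0 < n)%N.

Definition cell_of (x : R) : nat := Num.truncn (n%:R * Phi x).

Let nR : 0 < n%:R :> R. Proof. by rewrite ltr0n. Qed.

Lemma cell_of_lt x : (cell_of x < n)%N.
Proof.
rewrite /cell_of truncn_lt_nat ?mulr_ge0 ?Phi_ge0//.
by rewrite -[ltRHS]mulr1 ltr_pM2l ?Phi_lt1.
Qed.

Lemma cell_of_eq x c : (cell_of x == c) = (c%:R / n%:R <= Phi x < c.+1%:R / n%:R).
Proof.
rewrite /cell_of truncn_eq ?mulr_ge0 ?Phi_ge0//.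
by rewrite ler_pdivrMr// ltr_pdivlMr// mulrC.
Qed.

Let cellE c : [set x | cell_of x == c] =
  [set x : R | Phi x < c.+1%:R / n%:R] `\` [set x : R | Phi x < c%:R / n%:R].
Proof.
apply/seteqP; split => x /=; rewrite cell_of_eq.
  by move=> /andP[h1 ->]; split => //; apply/negP; rewrite -leNgt.
by move=> [-> /negP]; rewrite -leNgt => ->.
Qed.

Let frac01 c : (c <= n)%N -> 0 <= (c%:R / n%:R : R) <= 1.
Proof. by move=> cn; rewrite divr_ge0//= ler_pdivrMr// mul1r ler_nat. Qed.

Lemma measurable_cell c : (c < n)%N -> measurable [set x | cell_of x == c].
Proof.
move=> cn; rewrite cellE; apply: measurableD.
  by have [] := measurable_lt_prob (frac01 cn).
by have [] := measurable_lt_prob (frac01 (ltnW cn)).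
Qed.

Lemma normal_prob_cell c : (c < n)%N -> gam [set x | cell_of x == c] = (n%:R^-1)%:E.
Proof.
move=> cn; have [m1 p1] := measurable_lt_prob (frac01 cn).
have [m2 p2] := measurable_lt_prob (frac01 (ltnW cn)).
rewrite cellE measureD//= ?p1 ?ltry//.
rewrite (_ : _ `&` _ = [set x : R | Phi x < c%:R / n%:R]); last first.
  apply/seteqP; split => x /=; first by case.
  move=> h; split => //; apply: lt_le_trans h _.
  by rewrite ler_pM2r ?invr_gt0// ler_nat.
by rewrite p2 -EFinB -mulrBl -natrB// subSnn mul1r.
Qed.

Definition cell_density c (x : R) : R := (cell_of x == c)%:R * normal_pdf 0 1 x.

Lemma cell_densityE c x :
  cell_density c x = \1_[set x | cell_of x == c] x * normal_pdf 0 1 x.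
Proof. by rewrite /cell_density indicE mem_setE. Qed.

Lemma cell_density_ge0 c x : 0 <= cell_density c x.
Proof. by rewrite mulr_ge0 ?normal_pdf_ge0. Qed.

Lemma measurable_cell_density c : (c < n)%N -> measurable_fun [set: R] (cell_density c).
Proof.
move=> cn; rewrite (_ : cell_density c = fun x => \1_[set x | cell_of x == c] x * normal_pdf 0 1 x).
  apply: measurable_funM; last exact: measurable_normal_pdf.
  by apply: measurable_indic; exact: measurable_cell.
by apply/funext => x; exact: cell_densityE.
Qed.

Lemma integral_cell_density c : (c < n)%N ->
  (\int[lebesgue_measure]_x (cell_density c x)%:E = (n%:R^-1)%:E)%E.
Proof.
move=> cn; rewrite -(normal_prob_cell cn) /normal_prob [RHS]integral_mkcond.
apply: eq_integral => x _; rewrite patchE cell_densityE indicE.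
by case: ifP => _; rewrite ?mul1r ?mul0r.
Qed.

End gaussian_cells.

(** * Dominated convergence of the grid means *)

Section gaussian_integral_limit.
Variables (R : realType) (b : nat) (b_gt1 : (1 < b)%N) (d : nat).
Variables (H : 'cV[R]_d -> R) (beta C : R).
Hypothesis H_cont : continuous H.
Hypothesis beta_gt0 : 0 < beta.
Hypothesis beta_le : beta <= 1 / 16.
Hypothesis H_growth : forall z, `|H z| <= C * gauss_growth beta z.

Local Notation mu := (@lebesgue_tuple R d).
Local Notation grid K := {ffun 'I_d -> K.-tuple 'I_b}.

Let pdfs (t : d.-tuple R) : R := \prod_j normal_pdf 0 1 (tnth t j).
Let colt (t : d.-tuple R) : 'cV[R]_d := \col_j tnth t j.

Let C_ge0 : 0 <= C.
Proof.
have := H_growth 0; rewrite -(pmulr_lge0 _ (gauss_growth_gt0 beta (0 : 'cV[R]_d))).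
exact: le_trans.
Qed.

Let normal_densityE t : normal_density 0 1%:M (colt t) = pdfs t.
Proof.
rewrite /normal_density det1 mulr1 invmx1 mulmx1 subr0 /pdfs.
under eq_bigr do rewrite std_normal_pdfE.
rewrite big_split/= -expR_sum prodr_const card_ord; congr (_ * expR _).
  rewrite /normal_peak expr1n mul1r exprVn; congr (_^-1).
  have p0 : 0 <= pi *+ 2 :> R by rewrite mulrn_wge0// pi_ge0.
  have -> : 2 * pi = pi *+ 2 :> R by rewrite mulr_natl.
  elim: d => [|k IH]; first by rewrite !expr0 sqrtr1.
  by rewrite !exprS sqrtrM// IH.
rewrite mxE mulr_sumr; apply: eq_bigr => j _.
by rewrite !mxE expr2; field.
Qed.

Let cellpt K (x : R) : R := gridpt R (b ^ K) (cell_of (b ^ K) x).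

Let bK0 K : (0 < b ^ K)%N. Proof. by rewrite expn_gt0 (ltnW b_gt1). Qed.

(** [H] is frozen on each cell while the density is kept, so that the integral is exactly the mean
    over the grid. *)
Let FK K t := H (\col_j cellpt K (tnth t j)) * pdfs t.

Let FK_sum K t : FK K t = \sum_(c : grid K) H (\col_j grid_value R (c j)) *
  \prod_j cell_density (b ^ K) (numeral (c j)) (tnth t j).
Proof.
have surj j := numeral_surj b_gt1 (cell_of_lt (bK0 K) (tnth t j)).
pose c0 : grid K := [ffun j => sval (cid (surj j))].
have c0E j : numeral (c0 j) = cell_of (b ^ K) (tnth t j).
  by rewrite ffunE; case: cid.
rewrite (bigD1 c0)//= [X in _ = _ + X]big1 => [|c cc].
  rewrite addr0 /FK; congr (H _ * _).
    by apply/colP => j; rewrite !mxE /grid_value c0E.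
  by apply: eq_bigr => j _; rewrite /cell_density c0E eqxx mul1r.
have [j cj] : exists j, c j != c0 j.
  apply/existsP; apply: contraNT cc; rewrite negb_exists => /forallP cc.
  by apply/eqP/ffunP => j; have := cc j; rewrite negbK => /eqP.
rewrite (bigD1 j)//= /cell_density -c0E (_ : (_ == _) = false) ?mul0r ?mulr0//.
apply/negbTE; apply: contra cj => /eqP E; apply/eqP/val_inj.
by apply: (numeral_inj b_gt1) => //; rewrite !size_tuple.
Qed.

Let measurable_cd K (x : K.-tuple 'I_b) :
  measurable_fun [set: R] (cell_density (b ^ K) (numeral x)).
Proof.
apply: measurable_cell_density => //.
by rewrite -[X in (_ < _ ^ X)%N](size_tuple x) numeral_lt.
Qed.

Let measurable_FK K : measurable_fun [set: d.-tuple R] (FK K).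
Proof.
rewrite (_ : FK K = fun t => \sum_(c : grid K) H (\col_j grid_value R (c j)) *
  \prod_j cell_density (b ^ K) (numeral (c j)) (tnth t j)); last first.
  by apply/funext => t; exact: FK_sum.
apply: measurable_sum => c; apply: measurable_funM; first exact: measurable_cst.
apply: (measurable_prod_tnth (f := fun j => cell_density (b ^ K) (numeral (c j)))) => j.
exact: measurable_cd.
Qed.

Let FK_cvg t : FK K t @[K --> \oo] --> H (colt t) * pdfs t.
Proof.
apply: cvgM; last exact: cvg_cst.
apply: (cvg_comp _ H); last exact: H_cont.
by apply: (@cvg_col R d (fun K j => cellpt K (tnth t j))) => j; exact: gridpt_truncn_cvg.
Qed.

Let K2 : R := 1 + 2 `^ (4 * beta) * ((2 `^ (4 * beta) + 1) * tail_const R `^ (- (4 * beta))).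

Let K2_ge0 : 0 <= K2.
Proof. by rewrite addr_ge0// !mulr_ge0 ?powR_ge0// addr_ge0 ?powR_ge0. Qed.

(** A domination uniform in [K]. Passing from [Phi x] to a cell endpoint costs at most a factor [2],
    as [Phi x < (c + 1) / n <= 2 c / n] for [c >= 1]; [beta <= 1 / 16] keeps [exp (4 beta x^2)]
    below [exp (x^2 / 4)]. *)
Let cellpt_le K x : expR (beta * cellpt K x ^+ 2) <= K2 * expR (x ^+ 2 / 4).
Proof.
set s := 4 * beta; set n := (b ^ K)%N; set c := cell_of n x.
have s0 : 0 < s by rewrite mulr_gt0.
have cn : (c < n)%N by apply: cell_of_lt; exact: bK0.
have nR : 0 < n%:R :> R by rewrite ltr0n; exact: bK0.
have e1 : 1 <= expR (x ^+ 2 / 4) by rewrite -expR0 ler_expR divr_ge0// sqr_ge0.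
have := cell_of_eq (bK0 K) x c; rewrite eqxx -/n => /esym/andP[u1 u2].
have tailE : (tail_const R * expR (- x ^+ 2)) `^ (- s) <= tail_const R `^ (- s) * expR (x ^+ 2 / 4).
  rewrite powRM ?expR_ge0 ?(ltW (tail_const_gt0 R))// ler_wpM2l ?powR_ge0// -expRM ler_expR.
  have := sqr_ge0 x; rewrite /s; move: (x ^+ 2) => y y0.
  have : beta * y <= 1 / 16 * y by rewrite ler_wpM2r.
  lra.
have t0 : 0 < tail_const R * expR (- x ^+ 2) by rewrite mulr_gt0 ?expR_gt0 ?tail_const_gt0.
have antitone (p q : R) : 0 < p -> p <= q -> q `^ (- s) <= p `^ (- s).
  move=> p0 pq; rewrite !powRN lef_pV2 ?posrE ?powR_gt0//; last exact: lt_le_trans pq.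
  by apply: (@ge0_ler_powR R s); rewrite ?nnegrE ?(ltW s0) ?(ltW p0)// (le_trans (ltW p0)).
have w1 : pw s n c <= 2 `^ s * (tail_const R `^ (- s) * expR (x ^+ 2 / 4)).
  rewrite /pw; case: posnP => [_|c0]; first by rewrite !mulr_ge0 ?powR_ge0 ?expR_ge0.
  apply: (@le_trans _ _ ((2^-1 * Phi x) `^ (- s))).
    apply: antitone; first by rewrite mulr_gt0 ?Phi_gt0// invr_gt0.
    rewrite ler_pdivrMl//; apply: le_trans (ltW u2) _.
    rewrite mulrA ler_pM2r ?invr_gt0// -natrM ler_nat mul2n -addnn -addn1.
    by rewrite leq_add2l.
  rewrite powRM ?invr_ge0 ?Phi_ge0// -powR_inv1// -powRrM mulN1r opprK ler_wpM2l ?powR_ge0//.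
  by apply: le_trans tailE; apply: antitone => //; exact: Phi_ge_exp.
have w2 : pw s n (n - c) <= tail_const R `^ (- s) * expR (x ^+ 2 / 4).
  rewrite /pw gtn_eqF ?subn_gt0//; apply: le_trans tailE; apply: antitone => //.
  apply: le_trans (onem_Phi_ge_exp x) _; rewrite natrB ?(ltnW cn)// mulrBl divff ?gt_eqF//.
  by rewrite lerD2l lerN2.
have h := @expR_gridpt R beta n c (ltW beta_gt0) cn.
rewrite /cellpt -/n -/c; apply: (le_trans h); rewrite -/s.
rewrite /K2 mulrDl mul1r; apply: lerD => //.
rewrite -[leRHS]mulrA ler_wpM2l ?powR_ge0// -[leRHS]mulrA mulrDl mul1r.
exact: lerD.
Qed.

Let dom (t : d.-tuple R) : R :=
  C * \prod_j (K2 * (expR (tnth t j ^+ 2 / 4) * normal_pdf 0 1 (tnth t j))).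

Let FK_le K t : `|FK K t| <= dom t.
Proof.
have p0 : 0 <= pdfs t by apply: prodr_ge0 => j _; exact: normal_pdf_ge0.
rewrite /FK normrM (ger0_norm p0).
apply: (@le_trans _ _ (C * gauss_growth beta (\col_j cellpt K (tnth t j)) * pdfs t)).
  by rewrite ler_wpM2r.
rewrite -mulrA ler_wpM2l// /gauss_growth /pdfs -big_split/=.
apply: ler_prod => j _; rewrite mulr_ge0 ?expR_ge0 ?normal_pdf_ge0//= mulrA.
by rewrite ler_wpM2r ?normal_pdf_ge0// mxE cellpt_le.
Qed.

Let measurable_dom1 : measurable_fun [set: R]
  (fun x : R => K2 * (expR (x ^+ 2 / 4) * normal_pdf 0 1 x)).
Proof.
apply: measurable_funM => //; apply: measurable_funM; last exact: measurable_normal_pdf.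
by apply: measurableT_comp => //; exact: measurable_funM.
Qed.

Let integrable_dom : mu.-integrable [set: d.-tuple R] (fun t => (dom t)%:E).
Proof.
under eq_fun do rewrite EFinM.
apply: integrableZl => //; apply/integrableP; split.
  apply/measurable_EFinP.
  exact: (measurable_prod_tnth (f := fun _ x => K2 * (expR (x ^+ 2 / 4) * normal_pdf 0 1 x))).
have f0 (x : R) : 0 <= K2 * (expR (x ^+ 2 / 4) * normal_pdf 0 1 x).
  by rewrite !mulr_ge0 ?expR_ge0 ?normal_pdf_ge0.
under eq_integral => t _.
  rewrite gee0_abs ?lee_fin ?prodr_ge0//.
  over.
have := @integral_lebesgue_tuple_prod R d
  (fun _ x => K2 * (expR (x ^+ 2 / 4) * normal_pdf 0 1 x)) (fun=> K2 * Num.sqrt 2).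
move=> ->; rewrite ?ltry// => j.
under eq_integral do rewrite EFinM.
rewrite ge0_integralZl//; first by rewrite integral_expR4 EFinM.
- apply/measurable_EFinP; apply: measurable_funM; last exact: measurable_normal_pdf.
  by apply: measurableT_comp => //; exact: measurable_funM.
- by move=> x _; rewrite lee_fin mulr_ge0 ?expR_ge0 ?normal_pdf_ge0.
Qed.

Let integral_FK K : (\int[mu]_t (FK K t)%:E =
  (#|{: grid K}|%:R^-1 * \sum_(c : grid K) H (\col_j grid_value R (c j)))%:E)%E.
Proof.
have numlt (x : K.-tuple 'I_b) : (numeral x < b ^ K)%N.
  by rewrite -[X in (_ < _ ^ X)%N](size_tuple x) numeral_lt.
have cell_int (c : grid K) :
    (\int[mu]_t (\prod_j cell_density (b ^ K) (numeral (c j)) (tnth t j))%:E =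
     (#|{: grid K}|%:R^-1)%:E)%E.
  rewrite (@integral_lebesgue_tuple_prod R d
    (fun j => cell_density (b ^ K) (numeral (c j))) (fun=> (b ^ K)%:R^-1)).
  - by rewrite prodr_const card_ffun card_tuple !card_ord exprVn -natrX.
  - by move=> j; exact: measurable_cd.
  - by move=> j x; exact: cell_density_ge0.
  - by move=> j; exact: integral_cell_density.
have mP (c : grid K) : measurable_fun [set: d.-tuple R]
    (fun t => (\prod_j cell_density (b ^ K) (numeral (c j)) (tnth t j))%:E).
  apply/measurable_EFinP.
  apply: (measurable_prod_tnth (f := fun j => cell_density (b ^ K) (numeral (c j)))) => j.
  exact: measurable_cd.
have P0 (c : grid K) t : 0 <= \prod_j cell_density (b ^ K) (numeral (c j)) (tnth t j).
  by apply: prodr_ge0 => j _; exact: cell_density_ge0.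
have iP (c : grid K) : mu.-integrable [set: d.-tuple R]
    (fun t => (\prod_j cell_density (b ^ K) (numeral (c j)) (tnth t j))%:E).
  apply/integrableP; split => //.
  rewrite (eq_integral (fun t => (\prod_j cell_density (b ^ K) (numeral (c j)) (tnth t j))%:E)).
    by rewrite cell_int ltry.
  by move=> t _; rewrite gee0_abs// lee_fin P0.
under eq_integral do rewrite FK_sum -sumEFin.
rewrite integral_sum//; last by move=> c; under eq_fun do rewrite EFinM; exact: integrableZl.
rewrite mulr_sumr -sumEFin; apply: eq_bigr => c _.
under eq_integral do rewrite EFinM.
by rewrite integralZl// cell_int -EFinM mulrC.
Qed.

Lemma gauss_integral_cvg :
  #|{: grid K}|%:R^-1 * (\sum_(c : grid K) H (\col_j grid_value R (c j))) @[K --> \oo] -->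
  gauss_integral H.
Proof.
have mlim : measurable_fun [set: d.-tuple R] (fun t => H (colt t) * pdfs t).
  apply: (measurable_fun_cvg (h := FK) (f := fun t => H (colt t) * pdfs t)) => [K|t _].
    exact: measurable_FK.
  exact: FK_cvg.
have [|||||i1 _ i3] := @dominated_convergence _ _ R mu setT measurableT
  (fun K t => (FK K t)%:E) (fun t => (H (colt t) * pdfs t)%:E) (fun t => (dom t)%:E).
- by move=> K; exact/measurable_EFinP.
- exact/measurable_EFinP.
- by apply: aeW => t _; apply: cvg_EFin; [exact: nearW|exact: FK_cvg].
- exact: integrable_dom.
- by apply: aeW => t K _; rewrite lee_fin FK_le.
move: i3; under eq_fun do rewrite integral_FK.
have -> : gauss_integral H = fine (\int[mu]_t (H (colt t) * pdfs t)%:E)%E.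
  rewrite /gauss_integral /Rintegral; congr fine; apply: eq_integral => t _.
  by rewrite normal_densityE.
rewrite -[X in _ --> X -> _]fineK; last exact: integrable_fin_num.
by move=> /fine_cvg.
Qed.

End gaussian_integral_limit.

(** * Mean square error on a grid *)

(** Serves to lower a large level to one of total exactly [M], where the net is balanced. *)
Lemma exists_leq_sum (d : nat) (f : 'I_d -> nat) (M : nat) : (M <= \sum_j f j)%N ->
  exists2 f' : 'I_d -> nat, (forall j, (f' j <= f j)%N) & (\sum_j f' j = M)%N.
Proof.
move=> Mf; have [n] : exists n, (\sum_j f j = M + n)%N.
  by exists (\sum_j f j - M)%N; rewrite subnKC.
elim: n f {Mf} => [|n IH] f; first by rewrite addn0 => <-; exists f.
move=> fE; have [j fj] : exists j, (0 < f j)%N.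
  apply/existsP; apply: contraPT fE; rewrite negb_exists => /forallP f0.
  by rewrite big1 ?addnS// => j _; have := f0 j; rewrite lt0n negbK => /eqP.
have [|f' f'f f'M] := IH (fun i => if i == j then (f i).-1 else f i).
  apply/eqP; rewrite -(eqn_add2l 1) !add1n -addnS -fE.
  rewrite (bigD1 j)//= eqxx [in X in (_ == X)%N](bigD1 j)//= -addSn prednK//.
  by apply/eqP; congr addn; apply: eq_bigr => i /negbTE ->.
exists f' => // i; apply: leq_trans (f'f i) _; case: ifP => // _; exact: leq_pred.
Qed.

(** Weighted Cauchy-Schwarz. With geometric weights over the levels, the bound does not depend on
    the number of levels. *)
Lemma sqr_sum_weighted (R : realFieldType) (I : finType) (P : pred I) (w Y : I -> R) :
  (forall i, 0 < w i) ->
  (\sum_(i | P i) Y i) ^+ 2 <= (\sum_(i | P i) w i) * \sum_(i | P i) Y i ^+ 2 / w i.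
Proof.
move=> w0; set S := \sum_(i | P i) Y i; set T := \sum_(i | P i) w i.
set Z := \sum_(i | P i) Y i ^+ 2 / w i.
have T0 : 0 <= T by apply: sumr_ge0 => i _; exact: ltW.
have Z0 : 0 <= Z by apply: sumr_ge0 => i _; rewrite divr_ge0 ?sqr_ge0// ltW.
have key c : 0 <= Z - 2 * c * S + c ^+ 2 * T.
  rewrite /Z /S /T !mulr_sumr -sumrB -big_split/=; apply: sumr_ge0 => i _.
  have -> : Y i ^+ 2 / w i - 2 * c * Y i + c ^+ 2 * w i = (Y i - c * w i) ^+ 2 / w i.
    by field; rewrite gt_eqF.
  by rewrite divr_ge0 ?sqr_ge0// ltW.
have [T1|T1] := eqVneq T 0.
  suff -> : S = 0 by rewrite expr0n mulr_ge0.
  apply: big1 => i Pi; exfalso.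
  have := T1; rewrite /T (bigD1 i)//= => E; have := w0 i.
  have : 0 <= \sum_(j | P j && (j != i)) w j by apply: sumr_ge0 => j _; exact: ltW.
  by lra.
have {}T0 : 0 < T by rewrite lt_neqAle eq_sym T1.
have := key (S / T); have -> : Z - 2 * (S / T) * S + (S / T) ^+ 2 * T = Z - S ^+ 2 / T.
  by field.
by rewrite subr_ge0 ler_pdivrMr// mulrC.
Qed.

Lemma sum_geometric_le (R : realFieldType) (th : R) (K : nat) : 0 < th < 1 ->
  \sum_(k < K) th ^+ k <= (1 - th)^-1.
Proof.
move=> /andP[t0 t1]; have a0 : 0 < 1 - th by rewrite subr_gt0.
rewrite -[leRHS]mul1r ler_pdivlMr//.
suff -> : (\sum_(k < K) th ^+ k) * (1 - th) = 1 - th ^+ K by rewrite gerBl exprn_ge0// ltW.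
elim: K => [|K IH]; first by rewrite big_ord0 mul0r expr0 subrr.
by rewrite big_ord_recr/= mulrDl IH exprSr; ring.
Qed.

(** * Mean square error of a balanced point set under finite scrambling *)

Section discrete_mean_square_error.
Variables (R : realFieldType) (A I : finType) (K d M Bt : nat).
Hypothesis A0 : (0 < #|A|)%N.
Hypothesis MK : (M <= K)%N.
Local Notation grid := {ffun 'I_d -> K.-tuple A}.
Local Notation fam := {ffun 'I_d * K.-bseq A -> {perm A}}.
Variables (p : I -> grid) (g : grid -> R) (D th sg : R).
Hypothesis I0 : (0 < #|I|)%N.
Hypothesis th_itv : 0 < th < 1.
Hypothesis sg_itv : 0 < sg < 1.
Hypothesis D_ge0 : 0 <= D.
Hypothesis p_balanced : forall kap : 'I_d -> nat, (forall j, (kap j <= K)%N) ->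
  (\sum_j kap j = M)%N -> balanced p kap Bt.
Hypothesis haar_decay : forall kap : 'I_d -> nat, (forall j, (kap j <= K)%N) ->
  #|{: grid}|%:R^-1 * \sum_c haar g kap c ^+ 2 <= D * (th ^+ 2 * sg) ^+ (\sum_j kap j).

Let N : R := #|I|%:R.
Let n : R := #|{: grid}|%:R.
Let F : R := #|{: fam}|%:R.
Let Y (kap : 'I_d -> nat) (pi : fam) : R := N^-1 * \sum_i haar g kap (scr pi (p i)).

Let N0 : 0 < N. Proof. by rewrite ltr0n. Qed.

Let n0 : 0 < n.
Proof. by rewrite ltr0n card_ffun card_tuple !expn_gt0 A0. Qed.

Let F0 : 0 < F.
Proof. by rewrite ltr0n; apply/card_gt0P; exists [ffun=> 1%g]. Qed.

(** Raising the level of [j0] brings the total to [M]. The component is constant on the finer cells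
    of [kap'] as well, and its mean vanishes because [kap j0 > 0]. *)
Let Y_small kap pi j0 : (forall j, (kap j <= K)%N) -> (\sum_j kap j <= M)%N ->
  (0 < kap j0)%N -> Y kap pi = 0.
Proof.
move=> kK kM kj0.
pose kap' j := if j == j0 then (kap j + (M - \sum_j kap j))%N else kap j.
have kk' j : (kap j <= kap' j)%N by rewrite /kap'; case: ifP => // _; exact: leq_addr.
have s' : (\sum_j kap' j = M)%N.
  rewrite (bigD1 j0)//= {1}/kap' eqxx.
  rewrite [X in (_ + X)%N](eq_bigr kap); last by move=> j /negbTE jj0; rewrite /kap' jj0.
  by rewrite addnAC -[X in (X + _)%N](bigD1 j0 (P := xpredT))//= subnKC.
have k'K j : (kap' j <= K)%N.
  by apply: leq_trans MK; rewrite -s' (bigD1 j)//= leq_addr.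
rewrite /Y (sum_scr_balanced A0 pi (p_balanced k'K s')) ?mulr0//.
  by move=> c c' E; apply: eq_haar => j; exact: eq_take_leq (kk' j) (E j).
exact: sum_haar_grid kj0.
Qed.

(** A lowered level [kap'] of total [M] is balanced and satisfies [kap' j <= (kap j).-1 + 1], as the
    count of close points requires. *)
Let Y_large kap : (forall j, (kap j <= K)%N) -> (M <= \sum_j kap j)%N ->
  F^-1 * \sum_pi Y kap pi ^+ 2 <=
  (#|A| ^ d * Bt)%:R / N * (D * (th ^+ 2 * sg) ^+ (\sum_j kap j)).
Proof.
move=> kK kM.
have [kap' k'k s'] := exists_leq_sum kM.
have k'K j : (kap' j <= K)%N by exact: leq_trans (kK j).
have cnt i : (#|[pred i' | [forall j, take (kap j).-1 (p i j) == take (kap j).-1 (p i' j)]]|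
    <= #|A| ^ d * Bt)%N.
  apply: (card_close_le A0 i (p_balanced k'K s')) => j.
  by apply: leq_trans (k'k j) _; exact: leqSpred.
have := @sum_scr_sqr_le R A K d A0 I p kap _ (haar g kap) kK cnt.
move=> /(_ (fun c j l e => sum_haar_set_digit A0 g c e)); rewrite -/n -/F natrM -/N => h.
have -> : \sum_pi Y kap pi ^+ 2 = N^-1 ^+ 2 * \sum_pi (\sum_i haar g kap (scr pi (p i))) ^+ 2.
  by rewrite mulr_sumr; apply: eq_bigr => pi _; rewrite exprMn.
move: h (haar_decay kK); rewrite -/n; set S := \sum_pi _; set V := \sum_c _.
set B := (#|A| ^ d * Bt)%:R; set Dk := D * _ => h hD.
have B0 : 0 <= B by exact: ler0n.
have -> : F^-1 * (N^-1 ^+ 2 * S) = (F^-1 * N^-1 ^+ 2 / n) * (n * S).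
  by field; rewrite !gt_eqF.
apply: le_trans (ler_wpM2l _ h) _; first by rewrite !mulr_ge0 ?invr_ge0 ?exprn_ge0 ?invr_ge0// ltW.
have -> : F^-1 * N^-1 ^+ 2 / n * (F * (N * B) * V) = B / N * (n^-1 * V).
  by field; rewrite !gt_eqF.
by rewrite ler_wpM2l// divr_ge0// ltW.
Qed.

(** The decay [th^2 * sg] is split: one factor [th] is the Cauchy-Schwarz weight, the other keeps
    the sum over levels bounded, and [sg] gives the rate in [M]. Two geometric sums in each of [d]
    coordinates produce the exponent [2 * d]. *)
Lemma discrete_mse :
  F^-1 * \sum_pi (N^-1 * (\sum_i g (scr pi (p i))) - n^-1 * \sum_c g c) ^+ 2 <=
  (1 - th)^-1 ^+ (2 * d) * ((#|A| ^ d * Bt)%:R / N) * D * sg ^+ M.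
Proof.
have [/andP[t0 t1] /andP[s0 s1]] := (th_itv, sg_itv).
have a0 : 0 < 1 - th by rewrite subr_gt0.
pose idx := {ffun 'I_d -> 'I_K.+1}.
pose kp (kap : idx) (j : 'I_d) : nat := kap j.
have kpK kap j : (kp kap j <= K)%N by rewrite -ltnS ltn_ord.
pose big (kap : idx) := (M < \sum_j kp kap j)%N.
have decomp pi : N^-1 * (\sum_i g (scr pi (p i))) - n^-1 * \sum_c g c =
    \sum_(kap | big kap) Y (kp kap) pi.
  have -> : N^-1 * (\sum_i g (scr pi (p i))) = \sum_(kap : idx) Y (kp kap) pi.
    rewrite /Y -mulr_sumr exchange_big/=; congr (_ * _).
    by apply: eq_bigr => i _; rewrite [LHS]sum_haar.
  rewrite (bigID big)/= -[RHS]addr0 -addrA; congr (_ + _); apply/eqP; rewrite subr_eq0; apply/eqP.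
  (* Level zero reproduces the grid mean exactly; the other levels of total at most [M] have a
     positive coordinate and vanish. *)
  rewrite (bigD1 [ffun=> ord0])/=; last first.
    by rewrite /big -leqNgt big1// => j _; rewrite /kp ffunE.
  rewrite [X in _ + X]big1 => [|kap /andP[kM k0]].
    rewrite addr0 /Y (eq_bigr (fun=> n^-1 * \sum_c g c)) => [|i _].
      by rewrite sumr_cst -/N mulKf ?gt_eqF.
    rewrite haar0 => [|j]; last by rewrite /kp ffunE.
    by congr (_^-1 * _); rewrite /n card_ffun card_tuple card_ord -expnM.
  have [j0 kj0] : exists j, (0 < kp kap j)%N.
    apply/existsP; apply: contraNT k0; rewrite negb_exists => /forallP k0.
    apply/eqP/ffunP => j; rewrite ffunE; apply/val_inj => /=.
    by have := k0 j; rewrite lt0n negbK => /eqP.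
  by apply: (Y_small _ (kpK kap) _ kj0); rewrite leqNgt.
pose w (kap : idx) : R := th ^+ (\sum_j kp kap j).
have w0 kap : 0 < w kap by rewrite exprn_gt0.
have T0 : 0 < (1 - th)^-1 by rewrite invr_gt0.
have sumw (P : pred idx) : \sum_(kap | P kap) w kap <= (1 - th)^-1 ^+ d.
  apply: (@le_trans _ _ (\sum_(kap : idx) w kap)).
    by rewrite [leRHS](bigID P)/= lerDl; apply: sumr_ge0 => kap _; exact: ltW.
  rewrite /w; under eq_bigr do rewrite -prodrXr.
  rewrite -(bigA_distr_bigA (fun (j : 'I_d) (k : 'I_K.+1) => th ^+ k)).
  rewrite prodr_const card_ord; apply: lerXn2r; rewrite ?nnegrE.
  - by apply: sumr_ge0 => k _; rewrite exprn_ge0// ltW.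
  - exact: ltW.
  - exact: sum_geometric_le.
set C0 := (#|A| ^ d * Bt)%:R / N.
have C00 : 0 <= C0 by rewrite divr_ge0// ltW.
set T := (1 - th)^-1 ^+ d.
have T1 : 0 <= T by rewrite exprn_ge0// ltW.
rewrite (_ : (1 - th)^-1 ^+ (2 * d) = T * T); last by rewrite mulnC exprM expr2.
apply: (@le_trans _ _ (F^-1 * \sum_pi T * \sum_(kap | big kap) Y (kp kap) pi ^+ 2 / w kap)).
  rewrite ler_pM2l ?invr_gt0//; apply: ler_sum => pi _; rewrite decomp.
  apply: le_trans (sqr_sum_weighted _ _ w0) _; rewrite ler_wpM2r ?sumw//.
  by apply: sumr_ge0 => kap _; rewrite divr_ge0 ?sqr_ge0// ltW.
rewrite -mulr_sumr exchange_big/= mulrCA -!mulrA ler_wpM2l//.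
rewrite mulr_sumr.
apply: (@le_trans _ _ (\sum_(kap | big kap) w kap * (C0 * D * sg ^+ M))).
  apply: ler_sum => kap kb; rewrite -mulr_suml mulrA ler_pdivrMr//.
  apply: le_trans (Y_large (kpK kap) (ltnW kb)) _; rewrite -/C0 exprMn -exprM mulnC exprM -/(w kap).
  rewrite [leRHS](_ : _ = C0 * (D * (w kap ^+ 2 * sg ^+ M))); last by ring.
  rewrite !ler_wpM2l// ?exprn_ge0 ?(ltW t0)//.
  by apply: ler_wiXn2l; [exact: ltW|exact: ltW|exact: ltnW].
rewrite -mulr_suml -!mulrA; apply: ler_wpM2r; last exact: sumw.
have sM : 0 <= sg ^+ M by rewrite exprn_ge0// ltW.
have Ni : 0 <= N^-1 by rewrite invr_ge0 ltW.
by rewrite !mulr_ge0.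
Qed.

End discrete_mean_square_error.

(** * Owen scrambling *)

Section finite_valued_random_elements.
Variables (disp : measure_display) (Omega : measurableType disp) (R : realType).
Variables (P : probability Omega R) (T : finType) (X : Omega -> T).
Hypothesis mX : forall x, measurable (X @^-1` [set x]).
Implicit Types F : T -> R.

Let decomp F w : F (X w) = \sum_x F x * \1_(X @^-1` [set x]) w.
Proof.
rewrite (bigD1 (X w))//= [X in _ = _ + X]big1 => [|x xX].
  by rewrite indicE mem_set// mulr1 addr0.
by rewrite indicE memNset ?mulr0//= => E; rewrite E eqxx in xX.
Qed.

Lemma measurable_finite_valued F : measurable_fun [set: Omega] (fun w => F (X w)).
Proof.
under eq_fun do rewrite decomp.
apply: measurable_sum => x; apply: measurable_funM; first exact: measurable_cst.
exact: measurable_indic.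
Qed.

Lemma integral_finite_uniform F : (forall x, P (X @^-1` [set x]) = (#|T|%:R^-1)%:E) ->
  (forall x, 0 <= F x) ->
  (\int[P]_w (F (X w))%:E = (#|T|%:R^-1 * \sum_x F x)%:E)%E.
Proof.
move=> PX F0.
under eq_integral do rewrite decomp -sumEFin.
rewrite ge0_integral_sum//; last 2 first.
- move=> x; apply/measurable_EFinP; apply: measurable_funM; first exact: measurable_cst.
  exact: measurable_indic.
- by move=> x w _; rewrite lee_fin mulr_ge0.
rewrite mulr_sumr -sumEFin; apply: eq_bigr => x _.
under eq_integral do rewrite EFinM.
rewrite ge0_integralZl//; last 2 first.
- by apply/measurable_EFinP; exact: measurable_indic.
- by rewrite lee_fin.
by rewrite integral_indic//= setIT PX -EFinM mulrC.
Qed.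

End finite_valued_random_elements.

(** * Owen permutations restricted to short prefixes *)

Section owen_permutation_family.
Variables (disp : measure_display) (Omega : measurableType disp) (R : realType).
Variables (P : probability Omega R) (b d K : nat).
Variable perms : 'I_d -> seq 'I_b -> Omega -> {perm 'I_b}.
Hypothesis owen : owen_permutations P perms.
Local Notation fam := {ffun 'I_d * K.-bseq 'I_b -> {perm 'I_b}}.

Definition permutation_family (w : Omega) : fam :=
  [ffun q : 'I_d * K.-bseq 'I_b => perms q.1 q.2 w].

Let emb (q : 'I_d * K.-bseq 'I_b) : 'I_d * seq 'I_b := (q.1, q.2 : seq 'I_b).

(** Puts the event into the form of [mutually_independent], indexed by plain sequences; [insub_bseq]
    recovers the bounded prefix. *)
Let preimageE (pi : fam) : permutation_family @^-1` [set pi] =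
  \bigcap_(q in [set` [seq emb q | q <- enum {: 'I_d * K.-bseq 'I_b}]])
     (perms q.1 q.2) @^-1` [set pi (q.1, insub_bseq K q.2)].
Proof.
have insubK (s : K.-bseq 'I_b) : insub_bseq K s = s by rewrite /insub_bseq valKd.
apply/seteqP; split => w /=.
  move=> <- _ /mapP[q _ ->] /=; rewrite ffunE /= insubK.
  by [].
move=> H; apply/ffunP => q; rewrite ffunE.
have /H /= : [set` [seq emb q | q <- enum {: 'I_d * K.-bseq 'I_b}]] (emb q).
  by apply/mapP; exists q => //; rewrite mem_enum.
by rewrite insubK; case: q.
Qed.

Lemma measurable_permutation_family pi : measurable (permutation_family @^-1` [set pi]).
Proof.
have [mp _ _] := owen; rewrite preimageE; exact: fin_bigcap_measurable.
Qed.

Lemma permutation_family_uniform pi :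
  P (permutation_family @^-1` [set pi]) = (#|{: fam}|%:R^-1)%:E.
Proof.
have [_ Pp ind] := owen.
have := ind [seq emb q | q <- enum {: 'I_d * K.-bseq 'I_b}] _
  (fun q => [set pi (q.1, insub_bseq K q.2)]).
rewrite preimageE => ->; last first.
  rewrite map_inj_uniq ?enum_uniq// => -[i s] [j s'] [-> ss']; congr (_, _).
  exact/val_inj.
rewrite (eq_bigr (fun=> ((b`!)%:R^-1)%:E)) => [|q _]; last exact: Pp.
rewrite big_map big_enum/= prodEFin prodr_const; congr EFin.
by rewrite card_ffun card_Sn natrX exprVn.
Qed.

End owen_permutation_family.

(** * The error rate *)

Lemma is_derive_Psi (R : realType) (beta t : R) :
  is_derive (t : R) (1 : R) (Psi beta) ((1 + 2 * beta * t ^+ 2) * expR (beta * t ^+ 2)).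
Proof.
pose q (x : R) := beta * (x * x).
have h1 : is_derive (t : R) (1 : R) q (2 * beta * t).
  have hid := is_derive_id t (1 : R).
  have := is_deriveZ beta (is_deriveM hid hid).
  by rewrite /GRing.scale/=; set D := (X in is_derive _ _ _ X);
    move=> ?; rewrite (_ : 2 * beta * t = D)// /D; ring.
have h2 := is_derive1_comp (is_derive_expR (q t)) h1.
have := is_deriveM (is_derive_id t (1 : R)) h2.
rewrite (_ : id * _ = Psi beta); last first.
  by apply/funext => x; rewrite /Psi /q expr2.
set D := (X in is_derive _ _ _ X) => ?.
rewrite (_ : (1 + _) * _ = D)// /D /GRing.scale/= expr2; ring.
Qed.

(** * Decay of the components of the integrand *)

Section haar_decay.
Variables (R : realType) (b : nat) (b_gt1 : (1 < b)%N) (d : nat).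
Variables (H : 'cV[R]_d -> R) (beta C : R).
Hypothesis beta_itv : 0 < 12 * beta < 1.
Hypothesis C_ge0 : 0 <= C.
Hypothesis H_growth : forall v : pred 'I_d,
  partially_derivable (seq.filter v (enum 'I_d)) H /\
  forall z, `|partials (seq.filter v (enum 'I_d)) H z| <= C * gauss_growth beta z.

Definition grid_fun K (c : {ffun 'I_d -> K.-tuple 'I_b}) : R := H (\col_j grid_value R (c j)).

(** The squared bound is a product over coordinates, so its sum over the grid factorises into
    one-dimensional mean squares. *)
Lemma haar_decay : exists2 D : R, 0 <= D & forall K (kap : 'I_d -> nat),
  (forall j, (kap j <= K)%N) ->
  #|{: {ffun 'I_d -> K.-tuple 'I_b}}|%:R^-1 *
    (\sum_(c : {ffun 'I_d -> K.-tuple 'I_b}) haar (@grid_fun K) kap c ^+ 2) <=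
  D * haar_ratio b beta ^+ (\sum_j kap j).
Proof.
have b0 : 0 <= beta by case/andP: beta_itv => ? _; lra.
have [C1 C10 HC1] := haar_weight_mean_square b_gt1 beta_itv.
exists (C ^+ 2 * C1 ^+ d); first by rewrite mulr_ge0 ?exprn_ge0.
move=> K kap kK.
pose wt (t : R) := expR (beta * t ^+ 2).
pose hw k (x : K.-tuple 'I_b) := haar_weight (@grid_value R b K) (Psi beta) wt k x.
have bound c : haar (@grid_fun K) kap c ^+ 2 <=
    C ^+ 2 * \prod_j hw (kap j) (c j) ^+ 2.
  pose v := [pred j | (0 < kap j)%N]; have [Hd Hg] := H_growth v.
  have := @normr_haar_le R 'I_b K d (@grid_value R b K) _ (Psi beta)
    (fun t => (1 + 2 * beta * t ^+ 2) * expR (beta * t ^+ 2)) wt H C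
    (is_derive_Psi beta) _ _ C_ge0 kap c Hd.
  rewrite card_ord (ltnW b_gt1) => /(_ isT) h.
  rewrite prodrXl -exprMn -(real_normK (num_real (haar _ _ _))).
  have {}h : `|haar (@grid_fun K) kap c| <=
      C * \prod_j hw (kap j) (c j).
    apply: h => [t|t|z].
    - by rewrite mulr_ge0 ?expR_ge0// addr_ge0// mulr_ge0 ?sqr_ge0// mulr_ge0.
    - exact: expR_ge0.
    (* Both [wt] and the derivative of [Psi] are at least [exp (beta t^2)], so the same growth bound
       serves every [v]. *)
    - apply: le_trans (Hg z) _; rewrite ler_wpM2l// /gauss_growth.
      apply: ler_prod => j _; rewrite expR_ge0/=; case: ifP => // _.
      by rewrite ler_peMl ?expR_ge0// lerDl mulr_ge0 ?sqr_ge0// mulr_ge0.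
  by rewrite ler_sqr ?nnegrE// (le_trans _ h).
apply: (@le_trans _ _ (#|{: {ffun 'I_d -> K.-tuple 'I_b}}|%:R^-1 *
    (\sum_(c : {ffun 'I_d -> K.-tuple 'I_b}) C ^+ 2 * \prod_j hw (kap j) (c j) ^+ 2))).
  by rewrite ler_wpM2l ?invr_ge0//; apply: ler_sum => c _; exact: bound.
rewrite -mulr_sumr mulrCA -mulrA ler_wpM2l ?sqr_ge0//.
rewrite -(bigA_distr_bigA (fun j (x : K.-tuple 'I_b) => hw (kap j) x ^+ 2)).
have -> : #|{: {ffun 'I_d -> K.-tuple 'I_b}}|%:R^-1 = \prod_(j < d) (b ^ K)%:R^-1 :> R.
  by rewrite prodr_const card_ffun card_tuple !card_ord exprVn -natrX.
rewrite -big_split/= -prodrXr.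
have -> : C1 ^+ d = \prod_(j < d) C1 by rewrite prodr_const card_ord.
rewrite -big_split/=; apply: ler_prod => j _; rewrite HC1// andbT.
by rewrite mulr_ge0 ?invr_ge0// sumr_ge0// => x _; exact: sqr_ge0.
Qed.

End haar_decay.

Lemma limn_einf_le (R : realType) (u : (\bar R)^nat) (B : \bar R) :
  (forall n, (u n <= B)%E) -> (limn_einf u <= B)%E.
Proof.
move=> uB; rewrite limn_einf_lim; apply: lime_le; first exact: is_cvg_einfs.
by apply: nearW => n; apply: le_trans (uB n); apply: ereal_inf_lbound; exists n => /=.
Qed.

(** * Passage to the limit in the grid *)

Section scrambled_net_limit.
Variables (R : realType) (b : nat) (b_gt1 : (1 < b)%N) (d m : nat).
Variables (H : 'cV[R]_d -> R) (I : R) (a : 'I_(b ^ m) -> 'cV[R]_d).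
Variables (disp : measure_display) (Omega : measurableType disp).
Variables (P : probability Omega R) (perms : 'I_d -> seq 'I_b -> Omega -> {perm 'I_b}).
Hypothesis H_cont : continuous H.
Hypothesis owen : owen_permutations P perms.
Local Notation grid K := {ffun 'I_d -> K.-tuple 'I_b}.
Local Notation fam K := {ffun 'I_d * K.-bseq 'I_b -> {perm 'I_b}}.

Let g K (c : grid K) : R := H (\col_j grid_value R (c j)).
Let mean K : R := #|{: grid K}|%:R^-1 * \sum_(c : grid K) g c.
Let p K (i : 'I_(b ^ m)) : grid K := [ffun j => digits b_gt1 K (a i j ord0)].

Hypothesis mean_cvg : mean K @[K --> \oo] --> I.

Let err K (pi : fam K) : R :=
  (#|'I_(b ^ m)|%:R^-1 * (\sum_i g (scr pi (p K i))) - mean K) ^+ 2.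

Let perm_at (w : Omega) := fun j s => perms j s w.

(** Each permutation depends on earlier digits only, so scrambling the first [K] digits gives the
    first [K] digits of the scrambled point. *)
Let scr_digits K w i j :
  scr (permutation_family K perms w) (p K i) j =
  [seq scrambled_digit b_gt1 (perm_at w) j (a i j ord0) l | l <- iota 0 K] :> seq 'I_b.
Proof.
rewrite -val_enum_ord -map_comp ffunE /=; apply: eq_map => l /=.
rewrite ffunE val_key ffunE /scrambled_digit take_digits ?(ltnW (ltn_ord l))//.
by rewrite tnth_mktuple.
Qed.

(** Convergence holds for every outcome: where a scrambled coordinate is [0] or [1], the convention
    in [gridpt] matches the default of [Phi_inv]. *)
Let err_cvg w : err (permutation_family K perms w) @[K --> \oo] -->
  (qmc_estimate H (fun i => scramble b_gt1 (perm_at w) (a i)) - I) ^+ 2.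
Proof.
have gi i : g (scr (permutation_family K perms w) (p K i)) @[K --> \oo] -->
    H (map_mx (@Phi_inv R) (scramble b_gt1 (perm_at w) (a i))).
  apply: (cvg_comp _ H); last exact: H_cont.
  rewrite (_ : map_mx _ _ = \col_j Phi_inv (limn (series (fun k =>
     (scrambled_digit b_gt1 (perm_at w) j (a i j ord0) k)%:R * b%:R ^- k.+1 : R)))); last first.
    by apply/colP => j; rewrite !mxE.
  apply: cvg_col => j; rewrite /grid_value.
  under eq_fun do rewrite scr_digits.
  exact: gridpt_digits_cvg.
have sum_cvg (s : seq 'I_(b ^ m)) :
    \sum_(i <- s) g (scr (permutation_family K perms w) (p K i)) @[K --> \oo] -->
    \sum_(i <- s) H (map_mx (@Phi_inv R) (scramble b_gt1 (perm_at w) (a i))).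
  elim: s => [|i s IH].
    rewrite big_nil (_ : (fun K => _) = cst 0); first exact: cvg_cst.
    by apply/funext => K; rewrite big_nil.
  under eq_fun do rewrite big_cons.
  by rewrite big_cons; apply: cvgD; [exact: gi|exact: IH].
rewrite /err /qmc_estimate card_ord expr2; under eq_fun do rewrite expr2.
by apply: cvgM; apply: cvgB => //; apply: cvgM => //; exact: cvg_cst.
Qed.

Lemma mean_square_error_le (B : R) :
  (forall K, (m <= K)%N -> #|{: fam K}|%:R^-1 * (\sum_(pi : fam K) err pi) <= B) ->
  ('E_P[fun w => ((qmc_estimate H (fun i => scramble b_gt1 (fun j s => perms j s w) (a i))
      - I) ^+ 2)%R] <= B%:E)%E.
Proof.
move=> HB; rewrite unlock.
(* The shift by [m] makes the bound, assumed for [K >= m], valid for every term of the sequence. *)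
pose f k w := (err (permutation_family (k + m) perms w))%:E.
have fE k : (\int[P]_w f k w <= B%:E)%E.
  rewrite /f (@integral_finite_uniform _ _ _ P (fam (k + m))
    (permutation_family (k + m) perms) _ (@err (k + m))).
  - by rewrite lee_fin HB// leq_addl.
  - exact: (measurable_permutation_family owen).
  - exact: (permutation_family_uniform owen).
  - by move=> pi; exact: sqr_ge0.
have limf w : limn_einf (f ^~ w) =
    ((qmc_estimate H (fun i => scramble b_gt1 (perm_at w) (a i)) - I) ^+ 2)%:E.
  suff /cvg_limn_einf_sup[] : f k w @[k --> \oo] -->
    ((qmc_estimate H (fun i => scramble b_gt1 (perm_at w) (a i)) - I) ^+ 2)%:E by [].
  apply: cvg_EFin; first exact: nearW.
  by have := @err_cvg w; rewrite -(cvg_shiftn m); exact.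
under eq_integral do rewrite -limf.
apply: le_trans (fatou P measurableT _ _) _.
- move=> k; apply/measurable_EFinP.
  exact: (measurable_finite_valued (measurable_permutation_family owen) (@err (k + m))).
- by move=> k w _; rewrite lee_fin sqr_ge0.
- exact: limn_einf_le.
Qed.

End scrambled_net_limit.

Lemma scrambled_net_mse (R : realType) (d b t : nat) (b_gt1 : (1 < b)%N)
    (H : 'cV[R]_d -> R) (e C : R) :
  0 < e -> e <= 1 / 4 -> 0 <= C -> continuous H ->
  (forall v : pred 'I_d, partially_derivable (seq.filter v (enum 'I_d)) H /\
    forall z, `|partials (seq.filter v (enum 'I_d)) H z| <= C * gauss_growth (e / 12) z) ->
  exists2 C' : R, 0 <= C' & forall m (a : 'I_(b ^ m) -> 'cV[R]_d), is_net t a ->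
    forall (disp : measure_display) (Omega : measurableType disp)
      (P : probability Omega R) (perms : 'I_d -> seq 'I_b -> Omega -> {perm 'I_b}),
    owen_permutations P perms ->
    ('E_P[fun w => ((qmc_estimate H (fun i => scramble b_gt1 (fun j s => perms j s w) (a i))
       - gauss_integral H) ^+ 2)%R] <= (C' * (b ^ m)%:R `^ (- 2 + 2 * e))%:E)%E.
Proof.
move=> e0 e4 C0 Hc Hg.
have e12 : 12 * (e / 12) = e by field.
have bi : 0 < 12 * (e / 12) < 1 by rewrite e12; apply/andP; split; lra.
have [D D0 HD] := haar_decay b_gt1 bi C0 Hg.
have b0 : 0 < b%:R :> R by rewrite ltr0n ltnW.
have b1 : b%:R^-1 < 1 :> R by rewrite invf_lt1// ltr1n.
have bi0 : 0 < b%:R^-1 :> R by rewrite invr_gt0.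
have pow_itv (x : R) : 0 < x -> 0 < b%:R^-1 `^ x < 1.
  move=> x0; have p1 : (1 : R) `^ x = 1 by rewrite powR1.
  rewrite powR_gt0//= -[ltRHS]p1.
  by apply: gt0_ltr_powR; rewrite ?nnegrE// ltW.
(* Chosen so that [th^2 * sg = b^(-(1 - e))], the decay for [beta = e / 12]; [e <= 1 / 4] keeps [sg]
   below [1]. *)
pose th : R := b%:R^-1 `^ (e / 2); pose sg : R := b%:R^-1 `^ (1 - 2 * e).
have thI : 0 < th < 1 by apply: pow_itv; lra.
have sgI : 0 < sg < 1 by apply: pow_itv; lra.
have [/andP[s0 s1] /andP[t0 t1]] := (sgI, thI).
have ratioE : haar_ratio b (e / 12) = th ^+ 2 * sg.
  rewrite /haar_ratio e12 /th /sg -powR_mulrn ?powR_ge0// -powRrM.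
  rewrite -powRD; last by rewrite (gt_eqF bi0) implybT.
  by congr (_ `^ _); lra.
(* The factor [sg ^- t] turns the rate [sg ^+ (m - t)] into [sg ^+ m = N^(-(1 - 2 e))]. *)
exists ((1 - th)^-1 ^+ (2 * d) * (b ^ d * b ^ t)%:R * D * sg ^- t).
  by rewrite !mulr_ge0// ?exprn_ge0 ?invr_ge0 ?exprn_ge0 ?subr_ge0// ltW.
move=> m a net disp Omega P perms owen.
have tm : (t <= m)%N by case: net.
have N0 : 0 < (b ^ m)%:R :> R by rewrite ltr0n expn_gt0 (ltnW b_gt1).
have RE : (1 - th)^-1 ^+ (2 * d) * (b ^ d * b ^ t)%:R * D * sg ^- t *
     (b ^ m)%:R `^ (- 2 + 2 * e) =
   (1 - th)^-1 ^+ (2 * d) * ((b ^ d * b ^ t)%:R / (b ^ m)%:R) * D * sg ^+ (m - t).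
  have -> : sg ^+ (m - t) = sg ^- t * sg ^+ m.
    by rewrite -{2}(subnKC tm) exprD mulKf// expf_neq0// gt_eqF.
  have -> : sg ^+ m = (b ^ m)%:R^-1 `^ (1 - 2 * e).
    by rewrite /sg natrX -exprVn powR_expn ?ltW.
  have -> : (b ^ m)%:R `^ (- 2 + 2 * e) = (b ^ m)%:R^-1 * (b ^ m)%:R^-1 `^ (1 - 2 * e).
    rewrite -(powR_inv1 (ltW N0)) -powRrM -powRD; last by rewrite (gt_eqF N0) implybT.
    by congr (_ `^ _); lra.
  by ring.
rewrite RE; apply: mean_square_error_le => //.
  apply: (@gauss_integral_cvg R b b_gt1 d H (e / 12) C) => //; [lra|lra|].
  move=> z; have [_ /(_ z)] := Hg pred0.
  by rewrite filter_pred0.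
move=> K mK.
have := @discrete_mse R 'I_b 'I_(b ^ m) K d (m - t) (b ^ t) _ _ 
  (fun i => [ffun j => digits b_gt1 K (a i j ord0)])
  (fun c => H (\col_j grid_value R (c j))) D th sg _ thI sgI D0.
rewrite !card_ord (ltnW b_gt1) expn_gt0 (ltnW b_gt1) => /(_ isT); apply => //.
- exact: leq_trans (leq_subr _ _) mK.
- by move=> kap kK ks; exact: net_balanced.
- by move=> kap kK; rewrite -ratioE; exact: HD.
Qed.

Theorem theorem3p5 (R : realType) (d b t : nat) (d_gt0 : (0 < d)%N)
    (b_gt1 : (1 < b)%N) (G : 'cV[R]_d -> R) (mu0 mu : 'cV[R]_d)
    (Sigma0 Sigma L : 'M[R]_d) :
  let Gtilde := fun z : 'cV[R]_d => G (mu + L *m z) in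
  let GIS := fun z : 'cV[R]_d =>
    G (mu + L *m z) * importance_weight mu0 mu Sigma0 Sigma L z in
  (forall x, 0 <= G x) ->
  posdefmx Sigma0 -> posdefmx Sigma -> L *m L^T = Sigma ->
  (forall a : R, eigenvalue (L^T *m invmx Sigma0 *m L) a -> 1 <= a) ->
  mixed_smooth Gtilde -> qmc_friendly Gtilde ->
  forall eps : R, 0 < eps ->
  exists C : R, \forall m \near \oo,
    forall (a : 'I_(b ^ m) -> 'cV[R]_d), is_net t a ->
    forall (disp : measure_display) (Omega : measurableType disp)
      (P : probability Omega R)
      (perms : 'I_d -> seq 'I_b -> Omega -> {perm 'I_b}),
      owen_permutations P perms ->
    (sqrte 'E_P[fun w =>
       ((qmc_estimate GIS (fun i => scramble b_gt1 (fun j s => perms j s w) (a i))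
         - gauss_integral GIS) ^+ 2)%R]
     <= (C * (b ^ m)%:R `^ (-1 + eps))%:E)%E.
Proof.
move=> Gtilde GIS G0 [S0T _] _ _ eig Gs Gf eps eps0.
(* The cap [1 / 4] is the condition of the mean square bound; since [N >= 1], a smaller exponent
   only strengthens the estimate. *)
pose e : R := Num.min eps (1 / 4).
have e0 : 0 < e by rewrite /e lt_min eps0 divr_gt0.
have e4 : e <= 1 / 4 by rewrite /e ge_min lexx orbT.
have eeps : e <= eps by rewrite /e ge_min lexx.
have be0 : 0 < e / 12 by rewrite divr_gt0.
have [CH CH0 HH] := importance_integrand_growth mu0 mu Sigma d_gt0 S0T eig Gs Gf be0.
have Hc : continuous GIS by exact: (importance_integrand_continuous Gs).
have [C C0 HC] := scrambled_net_mse t b_gt1 e0 e4 CH0 Hc HH.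
exists (Num.sqrt C); near=> m => a net disp Omega P perms owen.
have bm1 : 1 <= (b ^ m)%:R :> R by rewrite ler1n expn_gt0 (ltnW b_gt1).
have mse := HC m a net disp Omega P perms owen.
set x := (b ^ m)%:R `^ (-1 + eps).
have x0 : 0 <= x by exact: powR_ge0.
have le2 : C * (b ^ m)%:R `^ (- 2 + 2 * e) <= (Num.sqrt C * x) ^+ 2.
  rewrite exprMn sqr_sqrtr// ler_wpM2l// /x -powR_mulrn ?powR_ge0// -powRrM.
  by rewrite ler_powR//; lra.
have -> : (Num.sqrt C * x)%:E = sqrte (((Num.sqrt C * x) ^+ 2)%:E).
  by rewrite /= sqrtr_sqr ger0_norm// mulr_ge0// sqrtr_ge0.
rewrite lee_sqrt ?lee_fin ?sqr_ge0//.
by apply: le_trans mse _; rewrite lee_fin.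
Unshelve. all: by end_near. Qed.
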